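(* Let $\mathcal{U}\subset\mathbb{P}^9=\mathbb{P}(\mathbb{C}[x,y,z]_3)$ be the set of classes $[f]$ of ternary cubic forms such that $E(f)$ is regular and contains an aligned triple, i.e. three distinct collinear points. Let $\mathcal{L}=\overline{\mathcal{U}}\subset\mathbb{P}^9$ be its Zariski closure. Then \[ \deg\mathcal{L}=15 . \]
   Context: For a nonzero ternary cubic form $f\in\mathbb{C}[x,y,z]_3$, the eigenscheme $E(f)\subset\mathbb{P}^2_{\mathbb{C}}$ is the subscheme defined by the $2\times2$ minors of the matrix $\begin{pmatrix}x&y&z\\ \partial_xf&\partial_yf&\partial_zf\end{pmatrix}$; its points are called eigenpoints. $E(f)$ is called regular if it is reduced of dimension $0$ (it then consists of $7$ points). $\mathcal{L}$ is a hypersurface in $\mathbb{P}^9$, and its degree is its degree as a projective subvariety (with reduced structure). *)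

(* Defs.v *)
From HB Require Import structures.
From mathcomp Require Import all_boot all_order all_algebra.
From mathcomp Require Import boolp classical_sets reals.
From mathcomp Require Import complex.
From mathcomp Require Import mpoly.

Set Implicit Arguments.
Unset Strict Implicit.
Unset Printing Implicit Defensive.

Import GRing.Theory.
Local Open Scope classical_set_scope.
Local Open Scope ring_scope.

(* Points of P^n over K are given by nonzero row vectors of length n.+1
   (homogeneous coordinates). A subset of P^n is given by a set of nonzero row
   vectors. Two vectors represent the same point when they span the same line,
   which for row vectors is (p == q)%MS. *)

Section Projective.
Variables (K : fieldType) (n : nat).
Implicit Types (X : set 'rV[K]_n.+1) (p q r : 'rV[K]_n.+1).

Definition zariski_closure X : set 'rV[K]_n.+1 :=
  [set p : 'rV[K]_n.+1 | p != 0 /\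
    forall (d : nat) (G : dhomog n.+1 K d),
      (forall q, X q -> (G : {mpoly K[n.+1]}).@[q 0] = 0) ->
      (G : {mpoly K[n.+1]}).@[p 0] = 0].

(* The value at d of the Hilbert function of X, namely dim (S_d / I(X)_d) with
   S = K[x_0, .., x_n] and I(X) the homogeneous (radical) ideal of X, is h. *)
Definition hilbert_value X (d h : nat) : Prop :=
  exists I : {vspace dhomog n.+1 K d},
    (forall G : dhomog n.+1 K d,
       G \in I <-> forall q, X q -> (G : {mpoly K[n.+1]}).@[q 0] = 0) /\
    h = (\dim {:dhomog n.+1 K d} - \dim I)%N.

Definition is_hilbert_polynomial X (P : {poly rat}) : Prop :=
  exists d0 : nat, forall d : nat, (d0 <= d)%N ->
    exists h : nat, hilbert_value X d h /\ P.[d%:R] = h%:R.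

(* size P = k.+1 means that P has degree k; in particular P is nonzero, and the
   empty set has no dimension. *)
Definition projective_dim X (k : nat) : Prop :=
  exists P : {poly rat}, is_hilbert_polynomial X P /\ size P = k.+1.

(* If X has dimension k, its degree is k! times the leading coefficient of its
   Hilbert polynomial. *)
Definition projective_degree X (e : nat) : Prop :=
  exists (k : nat) (P : {poly rat}),
    [/\ is_hilbert_polynomial X P, size P = k.+1
      & k`!%:R * lead_coef P = e%:R].

Definition same_point p q : Prop := (p == q)%MS.

End Projective.

Section PlaneCubics.
Variable K : fieldType.
Implicit Types (f : {mpoly K[3]}) (p q r : 'rV[K]_3).

Definition collinear p q r : Prop :=
  exists l : 'cV[K]_3, [/\ l != 0, p *m l = 0, q *m l = 0 & r *m l = 0].

Definition eigen_mx f : 'M[{mpoly K[3]}]_(2, 3) :=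
  \matrix_(i < 2, j < 3) (if i == 0 then 'X_j else f^`M(j)).

Definition eigen_minor f (k : 'I_3) : {mpoly K[3]} :=
  \det (col' k (eigen_mx f)).

Definition eigen_minors f : seq {mpoly K[3]} :=
  [seq eigen_minor f k | k <- enum 'I_3].

Definition eigenpoints f : set 'rV[K]_3 :=
  [set p : 'rV[K]_3 | p != 0 /\ forall k, (eigen_minor f k).@[p 0] = 0].

Definition in_ideal (gs : seq {mpoly K[3]}) (g : {mpoly K[3]}) : Prop :=
  exists c : 'I_(size gs) -> {mpoly K[3]},
    g = \sum_(i < size gs) c i * gs`_i.

Definition radical_ideal (gs : seq {mpoly K[3]}) : Prop :=
  forall (g : {mpoly K[3]}) (m : nat), in_ideal gs (g ^+ m) -> in_ideal gs g.

(* The coordinate ring of the affine open subscheme {x_i <> 0} of E(f) is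
   K[x_0, x_1, x_2] / (minors, x_i - 1). The scheme E(f) is reduced iff these
   three rings are, i.e. iff the ideals (minors, x_i - 1) are radical. *)
Definition eigenscheme_reduced f : Prop :=
  forall i : 'I_3, radical_ideal (('X_i - 1) :: eigen_minors f).

Definition eigenscheme_regular f : Prop :=
  eigenscheme_reduced f /\ projective_dim (eigenpoints f) 0.

Definition has_aligned_triple f : Prop :=
  exists p q r, [/\ eigenpoints f p, eigenpoints f q & eigenpoints f r] /\
    [/\ ~ same_point p q, ~ same_point p r, ~ same_point q r
      & collinear p q r].

Definition cubic_monomials : seq 'X_{1..3} :=
  [:: [multinom [tuple 3; 0; 0]]; [multinom [tuple 2; 1; 0]];
      [multinom [tuple 2; 0; 1]]; [multinom [tuple 1; 2; 0]];
      [multinom [tuple 1; 1; 1]]; [multinom [tuple 1; 0; 2]];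
      [multinom [tuple 0; 3; 0]]; [multinom [tuple 0; 2; 1]];
      [multinom [tuple 0; 1; 2]]; [multinom [tuple 0; 0; 3]]]%N.

(* The coordinates on P^9 = P(K[x,y,z]_3) are the coefficients of the form. *)
Definition cubic (v : 'rV[K]_10) : {mpoly K[3]} :=
  \sum_(k < 10) v 0 k *: 'X_[nth 0%MM cubic_monomials k].

Definition aligned_regular_cubics : set 'rV[K]_10 :=
  [set v : 'rV[K]_10 | [/\ v != 0, eigenscheme_regular (cubic v)
             & has_aligned_triple (cubic v)]].

Definition aligned_locus : set 'rV[K]_10 :=
  zariski_closure aligned_regular_cubics.

End PlaneCubics.

(* Main.v *)
(** If E(f) contains three distinct points of the line orthogonal to n, then the polar conic
    of f with respect to n contains that line: at an eigenpoint grad f is proportional to the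
    point, so the three points are zeros of the restriction of this quadratic form. Writing
    u_j = n x e_j, the condition reads tri f n u_j u_k = 0. Fifteen of the products
    n_i (tri f n u_j u_k) are quartic forms in n whose coefficients form a 15 x 15 matrix,
    linear in f; its determinant F therefore vanishes on the cubics with an aligned triple.

    Conversely, when n is not isotropic a similitude brings it to e_3, and the condition says
    that the coefficients of x^2 z, xyz and y^2 z vanish. Call f good if it is similar to a
    cubic of this linear slice outside an explicit discriminant. The ideal of the good cubics
    is generated by F. Indeed the derivatives of any two members in the directions transverse
    to the slice are proportional, so F_b G_w - F_w G_b belongs to the ideal with F and G; and
    some line meets F = 0 in 15 distinct points, all of them limits of good cubics. Dividing G
    by F along this line and its perturbations, the remainder has a zero of infinite order at
    these 15 points, hence is zero.

    Good cubics do have a regular eigenscheme with an aligned triple: on the slice the minors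
    are z N1, z N2 and a form restricting to a cubic on z = 0, and the discriminant makes the
    seven zeros reduced. Thus F generates the ideal of the locus, which has degree 15. *)

From HB Require Import structures.
From mathcomp Require Import all_boot all_order all_algebra.
From mathcomp Require Import boolp classical_sets reals.
From mathcomp Require Import complex mpoly ring lra zify.
Require Import Defs.

Set Implicit Arguments.
Unset Strict Implicit.
Unset Printing Implicit Defensive.

Import Order.TTheory GRing.Theory Num.Theory.
Local Open Scope ring_scope.

(** * Polynomial rings *)

Section ChainRule.
Variables (n : nat) (K A : comNzRingType).

(** A determinant that vanishes on a locus says nothing yet about its degree: it might have repeated
    factors, or components outside the closure. Both are excluded at once by computing the whole
    vanishing ideal, so that the degree is read off the Hilbert function of a principal ideal. The
    fifteen distinct zeros on one line play the part of reducedness; that they are limits of good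
    cubics excludes foreign components. The number 15 has an intrinsic origin. Over the plane of
    vectors n let S be the rank two bundle of vectors orthogonal to n. The locus is a hypersurface
    because the slice has dimension 7, the rotations moving it add 2, and the coefficient space has
    dimension 10. For reducedness of the eigenscheme, common zeros of proper ideals are produced by
    elimination: resultants of the two conics split into linear forms, which are adjoined to the
    ideal one at a time. A Jacobian computation at each zero then does the rest. *)

Lemma mpoly_alg_ind (P : {mpoly K[n]} -> Prop) :
  (forall c, P c%:MP) -> (forall i, P 'X_i) ->
  (forall p q, P p -> P q -> P (p + q)) ->
  (forall p q, P p -> P q -> P (p * q)) -> forall p, P p.
Proof.
move=> PC PX PD PM; elim/mpolyind => [|c m p _ _ Pp]; first by rewrite -mpolyC0.
apply: PD => //; rewrite -mul_mpolyC; apply: (PM) => //.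
rewrite mpolyXE_id; elim/big_ind: _ => [|x y|i _]; rewrite -?mpolyC1 //; first exact: PM.
elim: (m i) => [|k IHk]; first by rewrite expr0 -mpolyC1.
by rewrite exprS; apply: PM.
Qed.

Lemma rmorph_mmap (B : comNzRingType) (f : {rmorphism K -> A}) (g : {rmorphism A -> B})
    (h : 'I_n -> A) p :
  g (mmap f h p) = mmap (g \o f) (g \o h) p.
Proof.
elim/mpoly_alg_ind: p => [c|i|p q Hp Hq|p q Hp Hq].
- by rewrite !mmapC.
- by rewrite !mmapX !mmap1U.
- by rewrite !rmorphD /= Hp Hq.
- by rewrite !rmorphM /= Hp Hq.
Qed.

Lemma eq_mmap (f1 f2 : K -> A) (h1 h2 : 'I_n -> A) p :
  f1 =1 f2 -> h1 =1 h2 -> mmap f1 h1 p = mmap f2 h2 p.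
Proof.
move=> Ef Eh; apply: eq_bigr => m _; rewrite Ef; congr (_ * _).
by apply: eq_bigr => i _; rewrite Eh.
Qed.

(** Both sides are derivations along [mmap f h], so comparing them on constants and variables
    suffices. The derivation [D] is arbitrary because it is taken to be [deriv] as well as the
    coefficientwise derivative [ds]. *)
Lemma mmap_chain (f : {rmorphism K -> A}) (h : 'I_n -> A) (D : {additive A -> A}) p :
  (forall c, D (f c) = 0) ->
  (forall x y, D (x * y) = D x * y + x * D y) ->
  D (mmap f h p) = \sum_i mmap f h p^`M(i) * D (h i).
Proof.
move=> Df DM; elim/mpoly_alg_ind: p => [c|i|p q Hp Hq|p q Hp Hq].
- by rewrite mmapC Df big1 // => i _; rewrite mderivC mmap0 mul0r.
- rewrite mmapX mmap1U (bigD1 i) //= mderivX mmapZ mnm1E eqxx rmorph1 mul1r.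
  have -> : (U_(i) - U_(i))%MM = 0%MM :> 'X_{1..n} by rewrite -{1}[U_(i)%MM]add0m addmK.
  rewrite mpolyX0 rmorph1 mul1r big1 ?addr0 // => j ji.
  by rewrite mderivX mmapZ mnm1E eq_sym (negPf ji) rmorph0 !mul0r.
- rewrite !raddfD /= Hp Hq -big_split /=; apply: eq_bigr => i _.
  by rewrite mderivD raddfD /= mulrDl.
- rewrite rmorphM /= DM Hp Hq mulr_suml mulr_sumr -big_split /=.
  apply: eq_bigr => i _; rewrite mderivM rmorphD /= !rmorphM /= mulrDl.
  by rewrite mulrAC mulrA.
Qed.

End ChainRule.

Section Infinite.
Variables (n : nat) (K : numFieldType).

Lemma poly_eq0_val (p : {poly K}) : (forall s, p.[s] = 0) -> p = 0.
Proof.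
move=> p0; apply/eqP/negPn/negP => pn0.
pose rs := [seq i%:R : K | i <- iota 0 (size p)].
have := @max_poly_roots _ p rs pn0; rewrite size_map size_iota ltnn.
move=> H; apply: notF; apply: H; first by apply/allP => x _; rewrite /root p0.
by rewrite map_inj_uniq ?iota_uniq // => i j /eqP; rewrite eqr_nat => /eqP.
Qed.

Lemma poly_eq0_cofinite (p d : {poly K}) :
  d != 0 -> (forall s, d.[s] != 0 -> p.[s] = 0) -> p = 0.
Proof.
move=> dn0 H; suff: p * d = 0 by move/eqP; rewrite mulf_eq0 (negPf dn0) orbF => /eqP.
apply: poly_eq0_val => s; rewrite hornerM.
by case: (eqVneq d.[s] 0) => [->|/H ->]; rewrite ?mulr0 ?mul0r.
Qed.

Lemma horner_mmap (h : 'I_n -> {poly K}) (p : {mpoly K[n]}) s :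
  (mmap (@polyC K) h p).[s] = p.@[fun i => (h i).[s]].
Proof.
rewrite -[LHS]/(horner_eval s _) rmorph_mmap; apply: eq_mmap => // c /=.
by rewrite /horner_eval hornerC.
Qed.

(** Restriction to lines parallel to the axes shows that the partial derivatives vanish everywhere;
    by induction on the size they are zero, and in characteristic zero only a constant is left. *)
Lemma mpoly_eq0_val (p : {mpoly K[n]}) : (forall v, p.@[v] = 0) -> p = 0.
Proof.
have [k] := ubnP (msize p); elim: k p => // k IHk p; rewrite ltnS => sp p0.
have dp i : p^`M(i) = 0.
  have sdp : (msize p^`M(i) <= (msize p).-1)%N.
    rewrite msizeE; apply/bigmax_leqP_seq => m; rewrite mcoeff_msupp mcoeff_mderiv => nz _.
    have: (m + U_(i))%MM \in msupp p.
      by rewrite mcoeff_msupp; apply: contraNneq nz => ->; rewrite mul0rn.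
    by move/msize_mdeg_lt; rewrite mdegD mdeg1 addn1; case: (msize p).
  have [p_eq0|pn0] := eqVneq p 0; first by rewrite p_eq0 mderiv0.
  apply: IHk.
    apply: leq_ltn_trans sdp _; rewrite prednK //.
    by rewrite lt0n msize_poly_eq0.
  move=> v; pose h j : {poly K} := (v j)%:P + (j == i)%:R *: 'X.
  have: mmap (@polyC K) h p = 0.
    by apply: poly_eq0_val => s; rewrite horner_mmap.
  move/(congr1 (fun q : {poly K} => q^`().[0])); rewrite deriv0 horner0.
  rewrite (@mmap_chain _ _ _ _ h deriv) => [|c|x y]; [|exact: derivC|exact: derivM].
  rewrite horner_sum (bigD1 i) //= big1 => [|j ji].
    rewrite addr0 /h derivD derivC add0r eqxx scale1r derivX mulr1 horner_mmap => H.
    rewrite -[RHS]H; apply: meval_eq => j.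
    by rewrite hornerD hornerZ hornerX mulr0 addr0 hornerC.
  by rewrite /h derivD derivC add0r (negPf ji) scale0r deriv0 mulr0 horner0.
have pC : p = (p@_0)%:MP.
  apply/mpolyP => m; rewrite mcoeffC; have [->|mn0] := eqVneq m 0%MM; first by rewrite mulr1.
  have [i mi] : exists i, m i != 0%N.
    apply/existsP; apply: contraR mn0; rewrite negb_exists => /forallP H.
    by apply/eqP/mnmP => i; rewrite mnm0E; apply/eqP; have:= H i; rewrite negbK.
  have := congr1 (mcoeff (m - U_(i))%MM) (dp i).
  rewrite mcoeff_mderiv mcoeff0 submK; last by rewrite lep1mP.
  move=> /eqP; rewrite mulrn_eq0 /= => /eqP ->.
  by rewrite mulr0.
have := p0 (fun=> 0); rewrite pC mevalC => ->.
by rewrite mpolyC0.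
Qed.

End Infinite.

(** * Divisibility from tangent derivations *)

Section BivariateDivision.
Variable K : numFieldType.
Implicit Types P Q : {poly {poly K}}.

(* A bivariate polynomial in (T, s) is encoded with T as the outer variable. *)
Definition dT P : {poly {poly K}} := P^`().
Definition ds P : {poly {poly K}} := map_poly deriv P.
Definition at_s0 P : {poly K} := map_poly (horner_eval 0) P.

Lemma dsE P i : (ds P)`_i = (P`_i)^`().
Proof. by rewrite coef_map_id0 // linear0. Qed.

Lemma dsD P Q : ds (P + Q) = ds P + ds Q.
Proof. by apply/polyP => i; rewrite !(dsE, coefD) derivD. Qed.

Lemma dsM P Q : ds (P * Q) = ds P * Q + P * ds Q.
Proof.
apply/polyP => i; rewrite dsE coefD !coefM raddf_sum -big_split /=.
by apply: eq_bigr => j _; rewrite derivM !dsE.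
Qed.

Variable P0 : {poly {poly K}}.

(* The derivation tangent to the curve P0 = 0. *)
Definition tangent_der Q := dT P0 * ds Q - ds P0 * dT Q.

Lemma tangent_derD P Q : tangent_der (P + Q) = tangent_der P + tangent_der Q.
Proof. by rewrite /tangent_der dsD /dT derivD; ring. Qed.

Lemma tangent_der0 : tangent_der P0 = 0.
Proof. by rewrite /tangent_der mulrC subrr. Qed.

Lemma tangent_derM P Q : tangent_der (P * Q) = tangent_der P * Q + P * tangent_der Q.
Proof. by rewrite /tangent_der dsM /dT derivM; ring. Qed.

Lemma iter_tangent_derM k Q : iter k tangent_der (Q * P0) = iter k tangent_der Q * P0.
Proof. by elim: k => //= k ->; rewrite tangent_derM tangent_der0 mulr0 addr0. Qed.

Lemma iter_tangent_derD k P Q :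
  iter k tangent_der (P + Q) = iter k tangent_der P + iter k tangent_der Q.
Proof. by elim: k => //= k ->; rewrite tangent_derD. Qed.

Lemma at_s0M P Q : at_s0 (P * Q) = at_s0 P * at_s0 Q. Proof. exact: rmorphM. Qed.
Lemma at_s0D P Q : at_s0 (P + Q) = at_s0 P + at_s0 Q. Proof. exact: rmorphD. Qed.

Lemma at_s0_Xs P : at_s0 ('X%:P * P) = 0.
Proof. by rewrite at_s0M /at_s0 map_polyC /= /horner_eval hornerX mul0r. Qed.

Lemma iter_tangent_der_Xs m j Q : exists R,
  iter m tangent_der (('X ^+ (m + j))%:P * Q) = ('X ^+ j)%:P * R /\
  at_s0 R = ((m + j) ^_ m)%:R *: (at_s0 (dT P0) ^+ m * at_s0 Q).
Proof.
elim: m j => [|m IHm] j.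
  by exists Q; rewrite ffactn0 scale1r expr0 mul1r.
have [R [ER R0]] := IHm j.+1; rewrite addSnnS iterS ER.
exists (j.+1%:R * dT P0 * R + 'X%:P * tangent_der R); split.
  rewrite tangent_derM {1}/tangent_der {2}/dT derivC mulr0 subr0.
  rewrite {1}/ds map_polyC /= derivXn /= exprS rmorphMn rmorphM /=.
  by rewrite -mulr_natl; ring.
rewrite at_s0D at_s0_Xs addr0 !at_s0M R0 /at_s0 rmorph_nat -/(at_s0 _) -/(at_s0 _).
rewrite exprS -addSnnS ffactnSr addSn -addnS addKn natrM -!mul_polyC rmorphM /=.
by rewrite rmorph_nat; ring.
Qed.

Lemma at_s0_eq0 P : at_s0 P = 0 -> exists Q, P = 'X%:P * Q.
Proof.
move=> P0s; exists (map_poly (fun p => p %/ 'X) P); apply/polyP => i.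
rewrite coefCM coef_map_id0 ?div0p //.
have /dvdpP [q Eq] : 'X %| P`_i.
  rewrite -['X]subr0 dvdp_XsubCl /root.
  by have := congr1 (fun p : {poly K} => p`_i) P0s; rewrite coef_map /= coef0 => /eqP.
by rewrite Eq mulpK ?polyX_eq0 // mulrC.
Qed.

Variables (n : nat) (c : K) (ts : seq K).
Hypotheses (size_P0 : size P0 = n.+1) (lead_P0 : lead_coef P0 = c%:P) (c_neq0 : c != 0).
Hypotheses (ts_uniq : uniq ts) (size_ts : size ts = n).
Hypothesis P0_ts : forall t, t \in ts -> (at_s0 P0).[t] = 0.

Lemma size_at_s0_P0 : size (at_s0 P0) = n.+1.
Proof.
rewrite /at_s0 -size_P0; apply: size_poly_eq.
by rewrite -/(lead_coef _) lead_P0 /horner_eval hornerC.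
Qed.

Lemma simple_root_P0 t : t \in ts -> (at_s0 (dT P0)).[t] != 0.
Proof.
move=> tts; rewrite /at_s0 /dT -deriv_map -/(at_s0 P0).
have E : at_s0 P0 = lead_coef (at_s0 P0) *: \prod_(z <- ts) ('X - z%:P).
  apply: all_roots_prod_XsubC; rewrite ?size_ts ?size_at_s0_P0 ?uniq_rootsE //.
  by apply/allP => z zts; apply/eqP/P0_ts.
rewrite E (big_rem t) //= derivZ derivM derivXsubC mul1r hornerZ hornerD hornerM.
rewrite hornerXsubC subrr mul0r addr0 mulf_neq0 //.
  by rewrite lead_coef_eq0 -size_poly_eq0 size_at_s0_P0.
rewrite -rootE root_prod_XsubC mem_rem_uniq // inE eqxx //.
Qed.

(** If R = s^m Q, its m-th tangent derivative at s = 0 is m! (dT P0)^m Q(T, 0). It vanishes at n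
    points where [dT P0] does not, so Q(T, 0), of degree less than n, is zero and another factor s
    splits off. *)
Lemma tangent_remainder_dvd (R : {poly {poly K}}) m :
  (size R <= n)%N ->
  (forall k t, t \in ts -> (at_s0 (iter k tangent_der R)).[t] = 0) ->
  exists Q, R = ('X ^+ m)%:P * Q /\ (size Q <= n)%N.
Proof.
move=> sR HR; elim: m => [|m [Q [EQ sQ]]].
  by exists R; rewrite expr0 mul1r.
have [S []] := iter_tangent_der_Xs m 0 Q; rewrite addn0 -EQ expr0 mul1r => ES S0.
have Q0 : at_s0 Q = 0.
  apply/eqP/negPn/negP => Qn0; have := @max_poly_roots _ _ ts Qn0 _ ts_uniq.
  rewrite size_ts => /(_ _) H; have {H}: (n < size (at_s0 Q))%N.
    apply: H; apply/allP => t tts; apply/eqP.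
    have := HR m t tts; rewrite ES S0 hornerZ hornerM horner_exp => /eqP.
    rewrite !mulf_eq0 expf_eq0 (negPf (simple_root_P0 tts)) andbF orFb.
    by rewrite pnatr_eq0 ffactnn eqn0Ngt fact_gt0 => /eqP.
  by rewrite ltnNge (leq_trans (size_poly _ _) sQ).
have [Q' EQ'] := at_s0_eq0 Q0; exists Q'; split.
  by rewrite EQ EQ' mulrA -rmorphM /= -exprSr.
have [->|Q'n0] := eqVneq Q' 0; first by rewrite size_poly0.
by move: sQ; rewrite EQ' mul_polyC size_scale ?polyX_eq0.
Qed.

(** Multiples of [P0] stay multiples of [P0] under [tangent_der], so the remainder inherits the
    vanishing at the roots. Being divisible by every power of s, it is zero. *)
Lemma tangent_modp P :
  (forall k t, t \in ts -> (at_s0 (iter k tangent_der P)).[t] = 0) -> P %% P0 = 0.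
Proof.
move=> HP; have uP0 : lead_coef P0 \is a GRing.unit.
  by rewrite lead_P0 poly_unitE size_polyC c_neq0 coefC eqxx unitfE.
have EP := Pdiv.IdomainUnit.divp_eq uP0 P; set q := P %/ P0 in EP; set R := P %% P0 in EP *.
have sR : (size R <= n)%N.
  by rewrite -ltnS -size_P0 ltn_modp -size_poly_eq0 size_P0.
have HR k t : t \in ts -> (at_s0 (iter k tangent_der R)).[t] = 0.
  move=> tts; have := HP k t tts; rewrite EP iter_tangent_derD iter_tangent_derM.
  by rewrite at_s0D at_s0M hornerD hornerM P0_ts // mulr0 add0r.
apply/eqP/negPn/negP => Rn0.
(* The exponent is chosen above the degree in s of the leading coefficient of [R]. *)
have [Q [EQ _]] := tangent_remainder_dvd (size (lead_coef R)) sR HR.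
have Qn0 : Q != 0 by apply: contraNneq Rn0 => Q0; rewrite EQ Q0 mulr0.
have := congr1 (fun p : {poly {poly K}} => size (lead_coef p : {poly K})) EQ.
rewrite mul_polyC lead_coefZ size_mul ?expf_neq0 ?polyX_eq0 ?lead_coef_eq0 //.
rewrite size_polyXn addSn /= => /eqP; rewrite -{1}[size (lead_coef R)]addn0 eqn_add2l.
by rewrite eq_sym size_poly_eq0 lead_coef_eq0 (negPf Qn0).
Qed.

End BivariateDivision.

(** * Restriction of a form to a line *)

Section LineSubstitution.
Variables (n : nat) (K A : comNzRingType) (f : {rmorphism K -> A}).
Variables (x : 'I_n -> A) (b : 'I_n -> K).

(** The values of G on the line x + T b. The ring [A] is free so that the base point may be
    numerical, move in a pencil, or be generic. *)
Definition line_sub (G : {mpoly K[n]}) : {poly A} :=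
  mmap (@polyC A \o f) (fun i => (x i)%:P + (f (b i))%:P * 'X) G.

(** A degree bound with a coefficient, instead of [lead_coef]: this is multiplicative over any
    commutative ring, also when [c] is zero. *)
Definition top_coef_at d (c : A) (p : {poly A}) : Prop := (size p <= d.+1)%N /\ p`_d = c.

Lemma top_coef_atM d1 d2 c1 c2 p q :
  top_coef_at d1 c1 p -> top_coef_at d2 c2 q -> top_coef_at (d1 + d2) (c1 * c2) (p * q).
Proof.
move=> [sp pd] [sq qd]; split.
  apply: leq_trans (size_polyMleq _ _) _; move: sp sq.
  by case: (size p) => [|sp]; case: (size q) => [|sq] //=; lia.
have ltd : (d1 < (d1 + d2).+1)%N by rewrite ltnS leq_addr.
rewrite coefM (bigD1 (Ordinal ltd)) //= addKn pd qd big1 ?addr0 // => i ne.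
have [lti|gti] := ltnP i d1.
  by rewrite [q`_ _]nth_default ?mulr0 // (leq_trans sq) //; move: (ltn_ord i); lia.
rewrite [p`_ _]nth_default ?mul0r // (leq_trans sp) // ltn_neqAle gti andbT.
by apply: contraNneq ne => E; apply/eqP/val_inj.
Qed.

Lemma top_coef_at_exp d c p k : top_coef_at d c p -> top_coef_at (d * k) (c ^+ k) (p ^+ k).
Proof.
move=> Hp; elim: k => [|k IHk]; last by rewrite mulnS !exprS; apply: top_coef_atM.
by rewrite muln0 !expr0; split; rewrite ?size_poly1 // coef1.
Qed.

Lemma line_sub_top d (G : {mpoly K[n]}) :
  G \is d.-homog -> top_coef_at d (f G.@[b]) (line_sub G).
Proof.
move=> /dhomogP Gd; rewrite /line_sub /mmap mevalE rmorph_sum /=.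
have Hm m : m \in msupp G -> top_coef_at d (f (G@_m * \prod_i b i ^+ m i))
    ((f G@_m)%:P * mmap1 (fun i => (x i)%:P + (f (b i))%:P * 'X) m).
  move=> /Gd /= Ed; rewrite rmorphM -[d]add0n; apply: top_coef_atM.
    by split; rewrite ?size_polyC_leq1 // coefC.
  rewrite -Ed mdegE rmorph_prod /mmap1; elim: (index_enum _) => [|i r IHr].
    by rewrite !big_nil; split; rewrite ?size_poly1 // coef1.
  rewrite !big_cons; apply: top_coef_atM IHr; rewrite rmorphXn /=.
  rewrite -[X in top_coef_at X]mul1n; apply: top_coef_at_exp; split.
    apply: leq_trans (size_polyD _ _) _; rewrite geq_max (leq_trans (size_polyC_leq1 _)) //=.
    apply: leq_trans (size_polyMleq _ _) _; rewrite size_polyX addn2 /=.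
    by rewrite ltnS size_polyC_leq1.
  by rewrite coefD coefC coefCM coefX mulr1 add0r.
elim: (msupp G) Hm => [|m r IHr] Hm.
  by rewrite !big_nil; split; rewrite ?size_poly0 ?coef0.
rewrite !big_cons; have [s1 c1] := Hm m (mem_head _ _).
have [|s2 c2] := IHr; first by move=> k kr; apply: Hm; rewrite inE kr orbT.
split; last by rewrite coefD c1 c2.
by apply: leq_trans (size_polyD _ _) _; rewrite geq_max s1.
Qed.

End LineSubstitution.

(** * Members of a tangentially closed set of polynomials are multiples of a form *)

Section PrincipalIdeal.
Variables (n : nat) (K : numFieldType).

Definition dird (w : 'I_n -> K) (G : {mpoly K[n]}) : {mpoly K[n]} :=
  \sum_i w i *: G^`M(i).

(** The values of G at a + s w + T b, with s the inner and T the outer variable, so that [ds] and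
    [dT] become the directional derivatives along [w] and [b]. *)
Definition plane_sub (a b w : 'I_n -> K) : {mpoly K[n]} -> {poly {poly K}} :=
  line_sub (@polyC K) (fun i => (a i)%:P + w i *: 'X) b.

Lemma dT_plane_sub a b w G : dT (plane_sub a b w G) = plane_sub a b w (dird b G).
Proof.
rewrite /plane_sub /line_sub /dT (@mmap_chain _ _ _ _ _ deriv) => [|c|p q];
  [|exact: derivC|exact: derivM].
rewrite /dird rmorph_sum /=; apply: eq_bigr => i _; rewrite mmapZ /= mulrC; congr (_ * _).
by rewrite derivD derivC add0r derivM derivC mul0r add0r derivX mulr1.
Qed.

Lemma ds_plane_sub a b w G : ds (plane_sub a b w G) = plane_sub a b w (dird w G).
Proof.
pose D : {additive {poly {poly K}} -> {poly {poly K}}} :=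
  map_poly (@deriv K : {additive _ -> _}).
have DE P : ds P = D P by [].
rewrite DE /plane_sub /line_sub (@mmap_chain _ _ _ _ _ D) => [|c|p q]; last exact: dsM.
  rewrite /dird rmorph_sum /=; apply: eq_bigr => i _; rewrite mmapZ /= mulrC; congr (_ * _).
  rewrite -!DE dsD dsM; apply/polyP => j.
  rewrite coefD dsE coefC -!mul_polyC /= coefD !coefCM !coefMX !dsE !coefC.
  by case: j => [|[|j]] /=; rewrite ?derivD ?derivM ?derivC ?derivX ?(mulr0, mul0r, addr0, add0r, mulr1, coefX, linear0) //= ?derivC ?mulr0 ?addr0.
by apply/polyP => j; rewrite -DE dsE coef0 coefC; case: (j == 0%N); rewrite /= ?derivC ?deriv0.
Qed.

Lemma at_s0_plane_sub a b w G t :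
  (at_s0 (plane_sub a b w G)).[t] = G.@[fun i => a i + t * b i].
Proof.
rewrite /at_s0 /plane_sub /line_sub rmorph_mmap -[LHS]/(horner_eval t _) rmorph_mmap.
apply: eq_mmap => [c|i] /=.
  by rewrite map_polyC /= /horner_eval !hornerC.
rewrite rmorphD rmorphM /= !map_polyC map_polyX /= /horner_eval.
by rewrite !hornerE; ring.
Qed.

Variables (F : {mpoly K[n]}) (e : nat) (I : {mpoly K[n]} -> Prop).
Variables (a b : 'I_n -> K) (ts : seq K).
Hypotheses (F_homog : F \is e.-homog) (Fb_neq0 : F.@[b] != 0) (IF : I F).
Hypotheses (ts_uniq : uniq ts) (size_ts : size ts = e).
Hypothesis I_line : forall G, I G -> forall t, t \in ts -> G.@[fun i => a i + t * b i] = 0.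
Hypothesis I_tangent :
  forall G w, I G -> I (dird b F * dird w G - dird w F * dird b G).

Lemma line_sub_size_lead (A : idomainType) (f : {rmorphism K -> A}) x :
  size (line_sub f x b F) = e.+1 /\ lead_coef (line_sub f x b F) = f F.@[b].
Proof.
have [s c] := line_sub_top f x b F_homog.
have fn0 : f F.@[b] != 0 by rewrite fmorph_eq0.
have sz : size (line_sub f x b F) = e.+1.
  by apply/eqP; rewrite eqn_leq s ltnNge; apply: contra fn0 => /leq_sizeP/(_ e) H; rewrite -c H.
by split=> //; rewrite lead_coefE sz.
Qed.

(** On restrictions to the plane [tangent_der] is the bracket of [I_tangent], so its iterates never
    leave the restrictions of members of [I]. *)
Lemma iter_tangent_plane_sub w k G : I G -> exists2 H, I H &
  iter k (tangent_der (plane_sub a b w F)) (plane_sub a b w G) = plane_sub a b w H.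
Proof.
move=> IG; elim: k => [|k [H IH EH]]; first by exists G.
exists (dird b F * dird w H - dird w F * dird b H); first exact: I_tangent.
rewrite iterS EH /tangent_der !dT_plane_sub !ds_plane_sub.
by rewrite /plane_sub /line_sub rmorphB !rmorphM.
Qed.

(** The plane containing the line a + T b and the point y has the special line at s = 0 and the line
    y + T b at s = 1. Divisibility over the whole plane comes from s = 0 and is then specialised to
    s = 1. *)
Lemma line_sub_dvd G (y : 'I_n -> K) : I G -> line_sub idfun y b F %| line_sub idfun y b G.
Proof.
move=> IG; pose w i := y i - a i.
have [sP lP] := line_sub_size_lead (@polyC K) (fun i => (a i)%:P + w i *: 'X).
have PG0 : plane_sub a b w G %% plane_sub a b w F = 0.
  apply: (tangent_modp sP lP Fb_neq0 ts_uniq size_ts) => [t tts|k t tts].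
    by rewrite -/(plane_sub a b w F) at_s0_plane_sub I_line.
  have [H IH ->] := iter_tangent_plane_sub w k IG.
  by rewrite at_s0_plane_sub I_line.
have uP : lead_coef (plane_sub a b w F) \is a GRing.unit.
  by rewrite lP poly_unitE size_polyC Fb_neq0 coefC eqxx unitfE.
have := Pdiv.IdomainUnit.divp_eq uP (plane_sub a b w G).
rewrite PG0 addr0; set Q := _ %/ _ => EG.
have E H : map_poly (horner_eval 1) (plane_sub a b w H) = line_sub idfun y b H.
  rewrite /plane_sub /line_sub rmorph_mmap; apply: eq_mmap => [c|i] /=.
    by rewrite map_polyC /= /horner_eval hornerC.
  rewrite rmorphD rmorphM /= !map_polyC map_polyX /= /horner_eval.
  rewrite !(hornerD, hornerC, hornerZ, hornerX) mulr1.
  by have -> : a i + w i = y i by rewrite /w; ring.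
by rewrite -!E EG rmorphM dvdp_mull.
Qed.

(** G(X + T b) is divided by F(X + T b) with a generic base point X; the leading coefficient F(b) is
    a unit. The remainder dies when X is specialised to any y, because it is divisible by a
    polynomial of larger degree; hence it is zero, and T = 0 recovers G. *)
Theorem dvd_of_tangent_ideal G : I G -> exists H, G = H * F.
Proof.
move=> IG; pose X i : {mpoly K[n]} := 'X_i.
pose L := line_sub (@mpolyC n K) X b.
have [sL lL] := line_sub_size_lead (@mpolyC n K) X.
have uL : lead_coef (L F) \is a GRing.unit.
  by rewrite lL rmorph_unit // unitfE.
have EG := Pdiv.IdomainUnit.divp_eq uL (L G); move: EG.
set Q := L G %/ L F; set R := L G %% L F => EG.
have EL y H : map_poly (meval y) (L H) = line_sub idfun y b H.
  rewrite /L /line_sub rmorph_mmap; apply: eq_mmap => [c|i] /=.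
    by rewrite map_polyC /= mevalC.
  by rewrite rmorphD rmorphM /= !map_polyC map_polyX /= mevalXU mevalC.
have R0 : R = 0.
  apply/polyP => i; rewrite coef0; apply: mpoly_eq0_val => y.
  have sR : (size (map_poly (meval y) R) < size (line_sub idfun y b F))%N.
    have [-> _] := line_sub_size_lead idfun y.
    rewrite ltnS; apply: leq_trans (size_poly _ _) _.
    by rewrite -ltnS -sL ltn_modp -size_poly_eq0 sL.
  have dR : line_sub idfun y b F %| map_poly (meval y) R.
    have := line_sub_dvd y IG; rewrite -!EL EG rmorphD rmorphM /=.
    by rewrite dvdp_addr // dvdp_mull.
  have : map_poly (meval y) R = 0.
    apply/eqP/negPn/negP => Rn0; have := dvdp_leq Rn0 dR; by rewrite leqNgt sR.
  by move/(congr1 (fun p : {poly K} => p`_i)); rewrite coef_map coef0.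
have E0 H : (L H).[0] = H.
  rewrite -[LHS]/(horner_eval 0 _) /L /line_sub rmorph_mmap -[RHS]comp_mpoly_id.
  rewrite /comp_mpoly; apply: eq_mmap => [c|i] /=.
    by rewrite /horner_eval hornerC.
  by rewrite /horner_eval tnth_mktuple !hornerE ?mulr0 ?addr0.
by exists Q.[0]; rewrite -[LHS]E0 EG R0 addr0 hornerM E0.
Qed.

End PrincipalIdeal.

(** * Hilbert polynomial of a hypersurface *)

Section HypersurfaceDegree.
Variable K : fieldType.

(** Any cofactor of a form may thus be replaced by a homogeneous component, so that the multiples of
    F in degree d + e are the image of a linear map. *)
Lemma pihomog_mulr n (F H : {mpoly K[n]}) d e :
  F \is e.-homog -> pihomog mdeg (d + e) (H * F) = pihomog mdeg d H * F.
Proof.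
move=> Fe; have [->|Fn0] := eqVneq F 0; first by rewrite !mulr0 raddf0.
have Hk : (msize H <= maxn (msize H) d.+1)%N by rewrite leq_maxl.
rewrite {1}(pihomog_partitionE Hk) mulr_suml raddf_sum /=.
have dk : (d < maxn (msize H) d.+1)%N by rewrite leq_maxr.
rewrite (bigD1 (Ordinal dk)) //= big1 ?addr0 => [|i ne].
  by rewrite pihomog_dE //; apply: dhomogM => //; apply: pihomogP.
apply: (@pihomog_ne0 _ _ _ (i + e)%N); last by apply: dhomogM => //; apply: pihomogP.
by rewrite eqn_add2r; apply: contraNneq ne => E; apply/eqP/val_inj.
Qed.

Section Multiplication.
Variables (n d e : nat) (F : dhomog n.+1 K e).

Lemma dhomog_mul_subproof (H : dhomog n.+1 K d) :
  (H : {mpoly K[n.+1]}) * F \is (d + e).-homog.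
Proof. by apply: dhomogM; apply: dhomog_is_dhomog. Qed.

Definition dhomog_mul (H : dhomog n.+1 K d) : dhomog n.+1 K (d + e) :=
  DHomog (dhomog_mul_subproof H).

Lemma dhomog_mul_is_linear : linear dhomog_mul.
Proof. by move=> c G H; apply/val_inj; rewrite /= mulrDl scalerAl. Qed.

HB.instance Definition _ :=
  GRing.isLinear.Build K (dhomog n.+1 K d) (dhomog n.+1 K (d + e)) _ dhomog_mul
    dhomog_mul_is_linear.

Lemma mem_limg_dhomog_mul (G : dhomog n.+1 K (d + e)) :
  (G \in limg (linfun dhomog_mul)) <->
  exists H : {mpoly K[n.+1]}, (G : {mpoly K[n.+1]}) = H * F.
Proof.
split=> [/memv_imgP [H _ ->]|[H EG]]; first by exists H; rewrite lfunE.
have Hd : pihomog mdeg d H \is d.-homog by apply: pihomogP.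
apply/memv_imgP; exists (DHomog Hd); rewrite ?memvf // lfunE; apply/val_inj => /=.
rewrite -(pihomog_mulr _ _ (dhomog_is_dhomog F)).
by rewrite -EG pihomog_dE //; apply: dhomog_is_dhomog.
Qed.

Lemma dim_limg_dhomog_mul : (F : {mpoly K[n.+1]}) != 0 ->
  \dim (limg (linfun dhomog_mul)) = 'C(d + n, d).
Proof.
move=> Fn0; rewrite limg_dim_eq ?dimvf //; apply/eqP; rewrite capfv.
apply/lker0P => G H; rewrite !lfunE => /(congr1 val) /= /mulIf E.
by apply/val_inj/E.
Qed.

End Multiplication.

(** The product of the X - z over these nine roots is 9! times the binomial coefficient of X - e + 9
    over 9, which counts the monomials of degree X - e in ten variables. *)
Definition hilbert_roots (e : rat) : seq rat := [seq e - i%:R | i <- iota 1 9].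

(* [c] stands for 9!, kept abstract so that it is never computed in unary. *)
Lemma bin9 c m : c = 9`! -> c%:R * ('C(m + 9, m))%:R =
    (m%:R + 9%:R) * (m%:R + 8%:R) * (m%:R + 7%:R) * (m%:R + 6%:R) * (m%:R + 5%:R) * (m%:R + 4%:R)
    * (m%:R + 3%:R) * (m%:R + 2%:R) * (m%:R + 1) :> rat.
Proof.
move=> Ec.
have E : ('C(m + 9, m) * c = (m + 9) ^_ 9)%N.
  rewrite -bin_ffact -Ec; congr muln.
  by rewrite -(bin_sub (leq_addr 9 m)) addKn.
rewrite -natrM mulnC E {E Ec}.
rewrite !ffactnS ffactn0 !(addnS, succnK) addn0 muln1.
by rewrite !natrM -!natr1; ring.
Qed.

Definition hilbert_poly_15 (N : rat) : {poly rat} :=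
  N^-1 *: (\prod_(z <- hilbert_roots 0) ('X - z%:P)
           - \prod_(z <- hilbert_roots 15%:R) ('X - z%:P)).

Lemma hilbert_poly_15E c k : c = 9`! -> c != 0%N ->
  (hilbert_poly_15 c%:R).[(k + 15)%:R] = 'C(k + 15 + 9, k + 15)%:R - 'C(k + 9, k)%:R.
Proof.
move=> Ec c0; have Nn0 : c%:R != 0 :> rat by rewrite pnatr_eq0.
apply: (mulfI Nn0); rewrite /hilbert_poly_15 hornerZ mulrA (divff Nn0) mul1r.
rewrite mulrBr !(bin9 _ Ec) {Ec Nn0} hornerD hornerN !horner_prod /hilbert_roots !big_map /=.
by rewrite !big_cons !big_nil !hornerXsubC natrD; ring.
Qed.

(** Both products are monic of degree 9 and their leading terms cancel. In degree 8 the difference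
    of the sums of roots remains, 9 * 15 = 135, and 8! * 135 / 9! = 15. *)
Lemma size_hilbert_poly_15 (N : rat) : N != 0 ->
  size (hilbert_poly_15 N) = 9%N /\ lead_coef (hilbert_poly_15 N) = N^-1 * 135%:R.
Proof.
rewrite -invr_eq0 => nz.
rewrite /hilbert_poly_15 lead_coefZ size_scale // lead_coefE.
set p := \prod_(z <- hilbert_roots 0) _; set q := \prod_(z <- hilbert_roots 15%:R) _.
have sp : size p = 10%N by rewrite size_prod_XsubC.
have sq : size q = 10%N by rewrite size_prod_XsubC.
have c8 : (p - q)`_8 = 135%:R.
  rewrite coefB.
  have -> : p`_8 = - \sum_(z <- hilbert_roots 0) z by rewrite -coefPn_prod_XsubC.
  have -> : q`_8 = - \sum_(z <- hilbert_roots 15%:R) z by rewrite -coefPn_prod_XsubC.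
  by rewrite /hilbert_roots !big_map !big_cons !big_nil; ring.
suff s9 : size (p - q) = 9%N.
  rewrite s9; split; first reflexivity.
  congr (_ * _); exact: c8.
apply/eqP; rewrite eqn_leq; apply/andP; split.
  apply/leq_sizeP => j; rewrite leq_eqVlt => /predU1P [<-|gtj].
    have := monic_prod_XsubC (hilbert_roots 0) xpredT id.
    have := monic_prod_XsubC (hilbert_roots 15%:R) xpredT id.
    rewrite -/p -/q !monicE !lead_coefE sp sq /= coefB => /eqP -> /eqP ->.
    by rewrite subrr.
  by rewrite coefB !nth_default ?subrr ?sp ?sq.
rewrite ltnNge; apply/negP => /leq_sizeP/(_ 8%N (leqnn _)).
by rewrite c8 => /eqP; rewrite pnatr_eq0.
Qed.

Lemma degree_hypersurface_15 (X : set 'rV[K]_10) (F : dhomog 10 K 15) :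
  (F : {mpoly K[10]}) != 0 ->
  (forall d (G : dhomog 10 K d), (forall q, X q -> (G : {mpoly K[10]}).@[q 0] = 0) <->
     exists H : {mpoly K[10]}, (G : {mpoly K[10]}) = H * F) ->
  projective_degree X 15.
Proof.
(* [M] and [c] are opaque copies of 8! and 9!, so that no factorial gets evaluated. *)
move=> Fn0 HX; have [M EM] : exists M, M = 8`! by exists 8`!.
have M0 : M != 0%N by rewrite EM -lt0n fact_gt0.
have [c Ec] : exists c, c = (9 * M)%N by exists (9 * M)%N.
have c9 : c = 9`! by rewrite Ec EM -factS.
have c0 : c != 0%N by rewrite Ec muln_eq0.
have Nn0 : c%:R != 0 :> rat by rewrite pnatr_eq0.
have [szP lcP] := size_hilbert_poly_15 Nn0.
exists 8%N, (hilbert_poly_15 c%:R); split; [|exact: szP|]; last first.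
  rewrite lcP -EM Ec natrM; have: M%:R != 0 :> rat by rewrite pnatr_eq0.
  by move: (M%:R) => {EM M0 c9 szP lcP Nn0 Ec} N Nn0; field.
exists 15%N => d le15d; rewrite -(subnK le15d); set k := (d - 15)%N.
exists (\dim {:dhomog 10 K (k + 15)} - \dim (limg (linfun (dhomog_mul (d := k) F))))%N.
split.
  exists (limg (linfun (dhomog_mul (d := k) F))); split=> // G.
  by rewrite mem_limg_dhomog_mul HX.
rewrite (hilbert_poly_15E _ c9 c0) natrB ?dimvS ?subvf // dim_limg_dhomog_mul //.
by rewrite dimvf.
Qed.

End HypersurfaceDegree.

(** * Ternary cubics and linear substitutions *)

Section ExplicitCubics.
Variable A : comNzRingType.
Implicit Types (a : nat -> A) (u v w : nat -> A) (g h : nat -> nat -> A).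

(** Vectors and coefficient lists are functions on [nat]; beyond the intended range their values are
    meaningless (here the last entry is repeated), whence the bounds [i < 3] and [k < 10] in later
    statements. *)
Definition vec3 (x y z : A) : nat -> A := fun k => match k with 0 => x | 1 => y | _ => z end.

Definition cub a u : A :=
  a 0%N * u 0%N ^+ 3 + a 1%N * (u 0%N ^+ 2 * u 1%N) + a 2%N * (u 0%N ^+ 2 * u 2%N)
  + a 3%N * (u 0%N * u 1%N ^+ 2) + a 4%N * (u 0%N * u 1%N * u 2%N) + a 5%N * (u 0%N * u 2%N ^+ 2)
  + a 6%N * u 1%N ^+ 3 + a 7%N * (u 1%N ^+ 2 * u 2%N) + a 8%N * (u 1%N * u 2%N ^+ 2) + a 9%N * u 2%N ^+ 3.

Definition grad a u : nat -> A := vec3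
  (a 0%N * u 0%N ^+ 2 *+ 3 + a 1%N * (u 0%N * u 1%N) *+ 2 + a 2%N * (u 0%N * u 2%N) *+ 2
    + a 3%N * u 1%N ^+ 2 + a 4%N * (u 1%N * u 2%N) + a 5%N * u 2%N ^+ 2)
  (a 1%N * u 0%N ^+ 2 + a 3%N * (u 0%N * u 1%N) *+ 2 + a 4%N * (u 0%N * u 2%N)
    + a 6%N * u 1%N ^+ 2 *+ 3 + a 7%N * (u 1%N * u 2%N) *+ 2 + a 8%N * u 2%N ^+ 2)
  (a 2%N * u 0%N ^+ 2 + a 4%N * (u 0%N * u 1%N) + a 5%N * (u 0%N * u 2%N) *+ 2
    + a 7%N * u 1%N ^+ 2 + a 8%N * (u 1%N * u 2%N) *+ 2 + a 9%N * u 2%N ^+ 2 *+ 3).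

Definition dot u v : A := u 0%N * v 0%N + u 1%N * v 1%N + u 2%N * v 2%N.

(* The symmetric trilinear form with [tri a u u u = 6 * cub a u]. *)
Definition tri a u v w : A :=
  a 0%N * (u 0%N * v 0%N * w 0%N) *+ 6
  + a 1%N * (u 0%N * v 0%N * w 1%N + u 0%N * v 1%N * w 0%N + u 1%N * v 0%N * w 0%N) *+ 2
  + a 2%N * (u 0%N * v 0%N * w 2%N + u 0%N * v 2%N * w 0%N + u 2%N * v 0%N * w 0%N) *+ 2
  + a 3%N * (u 1%N * v 1%N * w 0%N + u 1%N * v 0%N * w 1%N + u 0%N * v 1%N * w 1%N) *+ 2
  + a 4%N * (u 0%N * v 1%N * w 2%N + u 0%N * v 2%N * w 1%N + u 1%N * v 0%N * w 2%N
           + u 1%N * v 2%N * w 0%N + u 2%N * v 0%N * w 1%N + u 2%N * v 1%N * w 0%N)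
  + a 5%N * (u 2%N * v 2%N * w 0%N + u 2%N * v 0%N * w 2%N + u 0%N * v 2%N * w 2%N) *+ 2
  + a 6%N * (u 1%N * v 1%N * w 1%N) *+ 6
  + a 7%N * (u 1%N * v 1%N * w 2%N + u 1%N * v 2%N * w 1%N + u 2%N * v 1%N * w 1%N) *+ 2
  + a 8%N * (u 2%N * v 2%N * w 1%N + u 2%N * v 1%N * w 2%N + u 1%N * v 2%N * w 2%N) *+ 2
  + a 9%N * (u 2%N * v 2%N * w 2%N) *+ 6.

Definition mulv g u : nat -> A := fun i => g i 0%N * u 0%N + g i 1%N * u 1%N + g i 2%N * u 2%N.
Definition mulm g h : nat -> nat -> A := fun i j => mulv g (fun k => h k j) i.

(* The coefficients of the cubic form [cub a] composed with the linear map g. *)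
Definition act g a : nat -> A := fun k =>
  let C j i := g i j in
  match k with
  | 0 => cub a (C 0%N)
  | 1 => dot (grad a (C 0%N)) (C 1%N)
  | 2 => dot (grad a (C 0%N)) (C 2%N)
  | 3 => dot (grad a (C 1%N)) (C 0%N)
  | 4 => tri a (C 0%N) (C 1%N) (C 2%N)
  | 5 => dot (grad a (C 2%N)) (C 0%N)
  | 6 => cub a (C 1%N)
  | 7 => dot (grad a (C 1%N)) (C 2%N)
  | 8 => dot (grad a (C 2%N)) (C 1%N)
  | _ => cub a (C 2%N)
  end%N.

Lemma cub_act g a u : cub (act g a) u = cub a (mulv g u).
Proof. by rewrite /cub /act /tri /dot /grad /vec3 /cub /mulv; ring. Qed.

Lemma grad_act g a u w : dot (grad (act g a) u) w = dot (grad a (mulv g u)) (mulv g w).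
Proof. by rewrite /act /tri /dot /grad /vec3 /cub /mulv; ring. Qed.

Lemma tri_act g a u v w :
  tri (act g a) u v w = tri a (mulv g u) (mulv g v) (mulv g w).
Proof. by rewrite /act /tri /dot /grad /vec3 /cub /mulv; ring. Qed.

(** Every coefficient of a transformed cubic is a value of [cub], [grad] or [tri] at columns of the
    matrix, so the composition law is the covariance of these three. *)
Lemma act_mul g h a k : act h (act g a) k = act (mulm g h) a k.
Proof.
case: k => [|[|[|[|[|[|[|[|[|k]]]]]]]]];
  [exact: cub_act|exact: grad_act|exact: grad_act|exact: grad_act|exact: tri_act
  |exact: grad_act|exact: cub_act|exact: grad_act|exact: grad_act|exact: cub_act].
Qed.

Lemma tri_grad a u v : tri a v u u = dot (grad a u) v *+ 2.
Proof. by rewrite /tri /dot /grad /vec3; ring. Qed.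

End ExplicitCubics.

(** * The determinant *)

Section Morphisms.
Variables (A B : comNzRingType) (f : {rmorphism A -> B}).

Lemma rmorph_cub a u : f (cub a u) = cub (f \o a) (f \o u).
Proof. by rewrite /cub /= !(rmorphD, rmorphM, rmorphXn). Qed.

Lemma rmorph_grad a u k : f (grad a u k) = grad (f \o a) (f \o u) k.
Proof.
by case: k => [|[|k]]; rewrite /grad /= !(rmorphD, rmorphM, rmorphXn, rmorphMn) /=.
Qed.

Lemma rmorph_dot_grad a u w :
  f (dot (grad a u) w) = dot (grad (f \o a) (f \o u)) (f \o w).
Proof. by rewrite /dot !rmorphD !rmorphM !rmorph_grad. Qed.

Lemma rmorph_tri a u v w : f (tri a u v w) = tri (f \o a) (f \o u) (f \o v) (f \o w).
Proof. by rewrite /tri /= !(rmorphMn, rmorphD, rmorphM). Qed.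

Lemma rmorph_act g a k : f (act g a k) = act (fun i j => f (g i j)) (f \o a) k.
Proof.
case: k => [|[|[|[|[|[|[|[|[|k]]]]]]]]];
  [exact: rmorph_cub|exact: rmorph_dot_grad|exact: rmorph_dot_grad|exact: rmorph_dot_grad
  |exact: rmorph_tri|exact: rmorph_dot_grad|exact: rmorph_cub|exact: rmorph_dot_grad
  |exact: rmorph_dot_grad|exact: rmorph_cub].
Qed.

End Morphisms.

Section Determinant.
Variable A : comNzRingType.
Implicit Types (a : nat -> A) (u v : nat -> A).

(* Column c of the matrix lists the coefficients of a product n_i * Q_jk: an entry (r, k, z)
   contributes z * a_k to row r, i.e. to the r-th quartic monomial of [quartics]. *)
Definition resultant_table : seq (seq (nat * nat * int)) :=
  [::
    [:: (6, 8, 2%Z); (7, 7, (-4)%Z); (8, 6, 6%Z); (10, 5, 2%Z); (11, 4, (-2)%Z);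
      (11, 9, 6%Z); (12, 3, 2%Z); (12, 8, (-4)%Z); (13, 7, 2%Z)];
    [:: (7, 8, 2%Z); (8, 7, (-4)%Z); (9, 6, 6%Z); (11, 5, 2%Z); (12, 4, (-2)%Z);
      (12, 9, 6%Z); (13, 3, 2%Z); (13, 8, (-4)%Z); (14, 7, 2%Z)];
    [:: (1, 8, (-2)%Z); (2, 7, 2%Z); (3, 5, (-2)%Z); (4, 4, 2%Z); (4, 9, (-6)%Z);
      (5, 3, (-2)%Z); (5, 8, 2%Z); (7, 2, 2%Z); (8, 1, (-2)%Z); (8, 5, 2%Z);
      (9, 4, (-1)%Z)];
    [:: (3, 8, (-2)%Z); (4, 7, 2%Z); (6, 5, (-2)%Z); (7, 4, 2%Z); (7, 9, (-6)%Z);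
      (8, 3, (-2)%Z); (8, 8, 2%Z); (11, 2, 2%Z); (12, 1, (-2)%Z); (12, 5, 2%Z);
      (13, 4, (-1)%Z)];
    [:: (4, 8, (-2)%Z); (5, 7, 2%Z); (7, 5, (-2)%Z); (8, 4, 2%Z); (8, 9, (-6)%Z);
      (9, 3, (-2)%Z); (9, 8, 2%Z); (12, 2, 2%Z); (13, 1, (-2)%Z); (13, 5, 2%Z);
      (14, 4, (-1)%Z)];
    [:: (1, 7, 2%Z); (2, 6, (-6)%Z); (4, 8, 2%Z); (5, 7, (-2)%Z); (6, 2, (-2)%Z);
      (7, 1, 2%Z); (7, 5, (-2)%Z); (8, 4, 1%Z)];
    [:: (3, 7, 2%Z); (4, 6, (-6)%Z); (7, 8, 2%Z); (8, 7, (-2)%Z); (10, 2, (-2)%Z);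
      (11, 1, 2%Z); (11, 5, (-2)%Z); (12, 4, 1%Z)];
    [:: (4, 7, 2%Z); (5, 6, (-6)%Z); (8, 8, 2%Z); (9, 7, (-2)%Z); (11, 2, (-2)%Z);
      (12, 1, 2%Z); (12, 5, (-2)%Z); (13, 4, 1%Z)];
    [:: (0, 8, 2%Z); (1, 5, 2%Z); (2, 4, (-2)%Z); (2, 9, 6%Z); (4, 2, (-4)%Z);
      (5, 1, 2%Z); (5, 5, (-4)%Z); (8, 0, 6%Z); (9, 2, 2%Z)];
    [:: (2, 8, 2%Z); (4, 5, 2%Z); (5, 4, (-2)%Z); (5, 9, 6%Z); (8, 2, (-4)%Z);
      (9, 1, 2%Z); (9, 5, (-4)%Z); (13, 0, 6%Z); (14, 2, 2%Z)];
    [:: (0, 7, (-2)%Z); (2, 3, 2%Z); (2, 8, (-2)%Z); (3, 2, 2%Z); (4, 5, 2%Z);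
      (5, 4, 1%Z); (7, 0, (-6)%Z); (8, 2, (-2)%Z)];
    [:: (1, 7, (-2)%Z); (4, 3, 2%Z); (4, 8, (-2)%Z); (6, 2, 2%Z); (7, 5, 2%Z);
      (8, 4, 1%Z); (11, 0, (-6)%Z); (12, 2, (-2)%Z)];
    [:: (2, 7, (-2)%Z); (5, 3, 2%Z); (5, 8, (-2)%Z); (7, 2, 2%Z); (8, 5, 2%Z);
      (9, 4, 1%Z); (12, 0, (-6)%Z); (13, 2, (-2)%Z)];
    [:: (0, 6, 6%Z); (1, 3, (-2)%Z); (2, 7, 2%Z); (3, 1, (-2)%Z); (4, 4, (-2)%Z);
      (6, 0, 6%Z); (7, 2, 2%Z)];
    [:: (1, 6, 6%Z); (3, 3, (-2)%Z); (4, 7, 2%Z); (6, 1, (-2)%Z); (7, 4, (-2)%Z);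
      (10, 0, 6%Z); (11, 2, 2%Z)]
  ]%N.

Definition resultant_mx a : 'M[A]_15 :=
  \matrix_(r < 15, c < 15)
    \sum_(t <- nth [::] resultant_table c | t.1.1 == r) t.2%:~R * a t.1.2.

Definition quartics (u : nat -> A) : seq A :=
  [seq u 0%N ^+ m.1.1 * u 1%N ^+ m.1.2 * u 2%N ^+ m.2 | m <-
    [:: (4, 0, 0); (3, 1, 0); (3, 0, 1); (2, 2, 0); (2, 1, 1); (2, 0, 2); (1, 3, 0);
        (1, 2, 1); (1, 1, 2); (1, 0, 3); (0, 4, 0); (0, 3, 1); (0, 2, 2); (0, 1, 3);
        (0, 0, 4)]%N].

Definition quartic_row u : 'rV[A]_15 := \row_(r < 15) nth 0 (quartics u) r.

(* In the coordinates (u, v, w) with quadratic form 2uv + w^2, the vectors orthogonal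
   to n = (u 1, u 0, u 2) are spanned by the [ortho u j]. *)
Definition ortho u (j : nat) : nat -> A :=
  match j with
  | 0 => vec3 0 (u 2%N) (- u 1%N)
  | 1 => vec3 (- u 2%N) 0 (u 0%N)
  | _ => vec3 (u 1%N) (- u 0%N) 0
  end%N.

(** The label (i, j, k) stands for n_i Q_jk. Of the 18 labels with j <= k the three (k, k, k) are
    left out: n_k Q_kk follows from the others, since the sum over j of n_j Q_jk is zero. *)
Definition resultant_cols : seq (nat * nat * nat) :=
  [:: (1, 0, 0); (2, 0, 0); (0, 0, 1); (1, 0, 1); (2, 0, 1); (0, 0, 2); (1, 0, 2);
      (2, 0, 2); (0, 1, 1); (2, 1, 1); (0, 1, 2); (1, 1, 2); (2, 1, 2); (0, 2, 2);
      (1, 2, 2)]%N.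

Lemma row_mul_resultant_mx a (x : 'rV[A]_15) (c : 'I_15) :
  (x *m resultant_mx a) 0 c =
  \sum_(t <- nth [::] resultant_table c) x 0 (inord t.1.1) * (t.2%:~R * a t.1.2).
Proof.
rewrite mxE; under eq_bigr => r _ do rewrite mxE mulr_sumr.
rewrite (exchange_big_dep xpredT) //= big_seq [RHS]big_seq; apply: eq_bigr => t tc.
have lt15 : (t.1.1 < 15)%N.
  have /allP/(_ c) : all (fun c => all (fun t => t.1.1 < 15)%N (nth [::] resultant_table c))
    (iota 0 15) by [].
  by rewrite mem_iota ltn_ord => /(_ isT) /allP/(_ t tc).
rewrite (bigD1 (inord t.1.1)) ?inordK //= big1 ?addr0 // => r /andP [/eqP Er /eqP].
by rewrite -{1}[r]inord_val Er.
Qed.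

(** This certifies [resultant_table]: each column is compared with the product of its label by
    expansion. *)
Lemma quartic_row_resultant a u (c : 'I_15) :
  let col := nth (0, 0, 0)%N resultant_cols c in
  (quartic_row u *m resultant_mx a) 0 c =
  u col.1.1 * tri a (vec3 (u 1%N) (u 0%N) (u 2%N)) (ortho u col.1.2) (ortho u col.2).
Proof.
rewrite row_mul_resultant_mx /=; case: c => c /=.
do 15?[case: c => [|c] //=] => _; rewrite !big_cons big_nil /= !mxE !inordK //= !expr0 !expr1.
all: rewrite /tri /ortho /vec3 /=; ring.
Qed.

End Determinant.

Section ActScalar.
Variable A : comNzRingType.
Implicit Types (a b : nat -> A) (g : nat -> nat -> A).

Lemma act_scalar c g a k : (forall i j, (i < 3)%N -> (j < 3)%N -> g i j = c * (i == j)%:R) ->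
  (k < 10)%N -> act g a k = c ^+ 3 * a k.
Proof.
move=> E; have E' i j : (i < 3)%N -> (j < 3)%N -> g i j = if i == j then c else 0.
  by move=> i3 j3; rewrite E //; case: (i == j); rewrite ?mulr1 ?mulr0.
do 10?[case: k => [|k] //] => _;
  rewrite /act /cub /dot /grad /tri /vec3 ?E' //=; ring.
Qed.

Lemma act_lin g a b t k :
  act g (fun k => a k + t * b k) k = act g a k + t * act g b k.
Proof.
do 9?[case: k => [|k]]; rewrite /act /cub /dot /grad /tri /vec3; ring.
Qed.

Lemma act_delta g a k :
  act g a k = \sum_(i < 10) a i * act g (fun j => (j == i :> nat)%:R) k.
Proof.
rewrite !big_ord_recr big_ord0 /=.
do 9?[case: k => [|k]]; rewrite /act /cub /dot /grad /tri /vec3 /=; ring.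
Qed.

Lemma eq_act g a b k : (forall i, (i < 10)%N -> a i = b i) -> act g a k = act g b k.
Proof. by move=> E; rewrite act_delta [RHS]act_delta; apply: eq_bigr => i _; rewrite E. Qed.

Lemma eq_tri a b u v w : (forall i, (i < 10)%N -> a i = b i) -> tri a u v w = tri b u v w.
Proof. by move=> E; rewrite /tri !E. Qed.

End ActScalar.

Lemma eq_act2 (A : comNzRingType) (g h : nat -> nat -> A) (a b : nat -> A) k :
  (forall i j, g i j = h i j) -> (forall i, a i = b i) -> act g a k = act h b k.
Proof.
move=> Eg Ea; have -> : g = h by apply/funext => i; apply/funext => j; apply: Eg.
by have -> : a = b by apply/funext.
Qed.

Section ResultantMorphism.
Variables (A B : comNzRingType) (f : {rmorphism A -> B}).

Lemma map_resultant_mx a : map_mx f (resultant_mx a) = resultant_mx (f \o a).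
Proof.
apply/matrixP => r c; rewrite !mxE rmorph_sum; apply: eq_bigr => t _.
by rewrite rmorphM rmorph_int.
Qed.

Lemma eq_resultant_mx (a b : nat -> A) :
  (forall i, (i < 10)%N -> a i = b i) -> resultant_mx a = resultant_mx b.
Proof.
move=> E; apply/matrixP => r c; rewrite !mxE [LHS]big_seq_cond [RHS]big_seq_cond.
apply: eq_bigr => t /andP [tc _]; rewrite E //.
have /allP/(_ c) : all (fun c => all (fun t => t.1.2 < 10)%N (nth [::] resultant_table c))
  (iota 0 15) by [].
by rewrite mem_iota ltn_ord => /(_ isT) /allP/(_ t tc).
Qed.

End ResultantMorphism.

(** For a cube root of unity e, the isometry (u, v, w) -> (e u, e^-1 v, w) of 2uv + w^2 scales the
    monomials u^2 w, u v^2, v w^2 of [pencil_phi0] by e^2 and the monomials u^2 v, u w^2, v^2 w of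
    [pencil_phi1] by e. Up to isometry and scaling a member of the pencil thus depends only on the
    cube of its parameter. *)
Definition pencil_phi0 (k : nat) : int := nth 0 [:: 0; 0; 6; 15; 0; 0; 0; 0; 4; 0]%Z k.
Definition pencil_phi1 (k : nat) : int := nth 0 [:: 0; 9; 0; 0; 0; -2; 0; 6; 0; 0]%Z k.

(** The symmetry of order three grades the quartic monomials modulo 3 and splits the system for a
    kernel vector into three blocks of five unknowns, each solved by itself. *)
Lemma det_resultant_phi1 : \det (resultant_mx pencil_phi1) != 0.
Proof.
suff : \det (map_mx (intr : int -> rat) (resultant_mx pencil_phi1)) != 0.
  by rewrite det_map_mx intr_eq0.
rewrite map_resultant_mx; apply/det0P => -[x xn0 /matrixP Ex]; move/eqP: xn0; apply.
have Ec c : (c < 15)%N -> \sum_(t <- nth [::] resultant_table c)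
    x 0 (inord t.1.1) * (t.2%:~R * (pencil_phi1 t.1.2)%:~R) = 0.
  by move=> c15; have := Ex 0 (Ordinal c15); rewrite row_mul_resultant_mx mxE.
suff x0 r : (r < 15)%N -> x 0 (inord r) = 0 by apply/rowP => r; rewrite -[r]inord_val mxE x0.
have [x1 x5 x7 x10 x13] : [/\ x 0 (inord 1) = 0, x 0 (inord 5) = 0, x 0 (inord 7) = 0, x 0 (inord 10) = 0
    & x 0 (inord 13) = 0].
  move: (Ec 0 isT) (Ec 4 isT) (Ec 5 isT) (Ec 8 isT) (Ec 11 isT).
  by rewrite !big_cons !big_nil /pencil_phi1 /= => *; split; lra.
have [x2 x3 x8 x11 x14] : [/\ x 0 (inord 2) = 0, x 0 (inord 3) = 0, x 0 (inord 8) = 0, x 0 (inord 11) = 0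
    & x 0 (inord 14) = 0].
  move: (Ec 1 isT) (Ec 2 isT) (Ec 6 isT) (Ec 12 isT) (Ec 13 isT).
  by rewrite !big_cons !big_nil /pencil_phi1 /= => *; split; lra.
have [x0 x4 x6 x9 x12] : [/\ x 0 (inord 0) = 0, x 0 (inord 4) = 0, x 0 (inord 6) = 0, x 0 (inord 9) = 0
    & x 0 (inord 12) = 0].
  move: (Ec 3 isT) (Ec 7 isT) (Ec 9 isT) (Ec 10 isT) (Ec 14 isT).
  by rewrite !big_cons !big_nil /pencil_phi1 /= => *; split; lra.
by do 15?[case: r => [|r] //].
Qed.

Section ResultantPolynomial.
Variable K : numClosedFieldType.
Implicit Types (a : nat -> K) (u v w n : nat -> K).

(* The change of coordinates u = x + iy, v = (x - iy)/2, w = z and its inverse. *)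
Definition null_coord (i j : nat) : K :=
  nth 0 (nth [::] [:: [:: 1; 'i; 0]; [:: 2^-1; - 'i / 2; 0]; [:: 0; 0; 1]] i) j.
Definition null_coord_inv (i j : nat) : K :=
  nth 0 (nth [::] [:: [:: 2^-1; 1; 0]; [:: - 'i / 2; 'i; 0]; [:: 0; 0; 1]] i) j.

Lemma null_coordK a k : (k < 10)%N -> act null_coord_inv (act null_coord a) k = a k.
Proof.
move=> k10; rewrite act_mul (@act_scalar _ 1) ?expr1n ?mul1r // => i j.
rewrite mul1r; have ii : 'i * 'i = -1 :> K by rewrite -expr2 sqrCi.
by case: i => [|[|[|i]]] //; case: j => [|[|[|j]]] // _ _;
  rewrite /mulm /mulv /null_coord /null_coord_inv /=; field: ii.
Qed.

Definition coefs (v : 'I_10 -> K) (k : nat) : K := v (inord k).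

Definition resultant_poly : {mpoly K[10]} :=
  \det (resultant_mx (act (fun i j => (null_coord_inv i j)%:MP)
                          (fun k => 'X_(inord k) : {mpoly K[10]}))).

Lemma resultant_polyE (v : 'I_10 -> K) :
  resultant_poly.@[v] = \det (resultant_mx (act null_coord_inv (coefs v))).
Proof.
rewrite /resultant_poly -det_map_mx map_resultant_mx; congr (\det _).
apply: eq_resultant_mx => k _; rewrite /= rmorph_act.
by apply: eq_act2 => [i j|i]; [exact: mevalC|exact: mevalXU].
Qed.

Lemma prod_homog1 (I : Type) (r : seq I) (E : I -> {mpoly K[10]}) d :
  size r = d -> (forall i, E i \is 1.-homog) -> \prod_(i <- r) E i \is d.-homog.
Proof.
move=> <- E1 {d}; elim: r => [|i r IHr]; first by rewrite big_nil dhomog1.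
by rewrite big_cons; apply: (@dhomogM _ _ _ 1).
Qed.

Lemma resultant_poly_homog : resultant_poly \is 15.-homog.
Proof.
have act1 k : act (fun i j => (null_coord_inv i j)%:MP) (fun k => 'X_(inord k)) k
    \is [in K[10], 1.-homog].
  rewrite act_delta; apply: rpred_sum => i _.
  have -> : act (fun i j => (null_coord_inv i j)%:MP) (fun j => (j == i :> nat)%:R) k
      = (act null_coord_inv (fun j => (j == i :> nat)%:R) k)%:MP_[10].
    rewrite (rmorph_act (@mpolyC 10 K)); apply: eq_act2 => // j /=.
    by rewrite rmorph_nat.
  by rewrite mulrC mul_mpolyC; apply: rpredZ; rewrite dhomogX /= mdeg1.
rewrite /resultant_poly /determinant; apply: rpred_sum => s _.
have sgE (b : bool) (p : {mpoly K[10]}) : p \is 15.-homog -> (-1) ^+ b * p \is 15.-homog.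
  by case: b => Hp; rewrite ?expr0 ?mul1r // expr1 mulN1r rpredN.
apply: sgE.
have sz : size (index_enum 'I_15) = 15%N by rewrite /index_enum -enumT size_enum_ord.
apply: (prod_homog1 sz) => i; rewrite mxE; apply: rpred_sum => t _.
by rewrite mulrC -[_%:~R]mulr1 mulrzl mulrzr; apply: rpredMz.
Qed.

Definition pencil (phi : nat -> int) : 'I_10 -> K :=
  fun k => act null_coord (fun k => (phi k)%:~R) k.

Lemma coefs_pencil phi k : (k < 10)%N ->
  coefs (pencil phi) k = act null_coord (fun k => (phi k)%:~R) k.
Proof. by move=> k10; rewrite /coefs /pencil inordK. Qed.

Lemma resultant_poly_pencil1 : resultant_poly.@[pencil pencil_phi1] != 0.
Proof.
rewrite resultant_polyE (@eq_resultant_mx _ _ (intr \o pencil_phi1)) => [|k k10].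
  by rewrite -map_resultant_mx det_map_mx intr_eq0 det_resultant_phi1.
rewrite -[RHS](null_coordK _ k10).
by apply: eq_act => i i10; rewrite coefs_pencil.
Qed.

(* [apolar a n]: the quadric of first polars of n vanishes on the line orthogonal to n. *)
Definition apolar a n : Prop :=
  (exists2 i, (i < 3)%N & n i != 0) /\
  forall u v, dot n u = 0 -> dot n v = 0 -> tri a n u v = 0.

(** The quartic monomials of n form a nonzero row whose product with the matrix lists the values n_i
    Q_jk, all zero by apolarity. *)
Lemma resultant_poly_apolar (v : 'I_10 -> K) n :
  apolar (coefs v) n -> resultant_poly.@[v] = 0.
Proof.
move=> [[i i3 ni] Hn]; rewrite resultant_polyE; apply/eqP/det0P.
have ii : 'i * 'i = -1 :> K by rewrite -expr2 sqrCi.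
(* [m] holds the null coordinates of the vector n; [c] holds those of the linear form dual to it
   under 2uv + w^2, which exchanges the first two. The quartics are evaluated at [c]. *)
pose m := mulv null_coord n; pose c := vec3 (m 1%N) (m 0%N) (m 2%N).
have nE k : (k < 3)%N -> mulv null_coord_inv m k = n k.
  by case: k => [|[|[|k]]] // _; rewrite /m /mulv /null_coord /null_coord_inv /=; field: ii.
exists (quartic_row c).
  have [j j3 cj] : exists2 j, (j < 3)%N & c j != 0.
    have [/existsP [j cj]|] := boolP [exists j : 'I_3, c j != 0]; first by exists j.
    rewrite negb_exists => /forallP c0; move/negP: ni; case; rewrite -nE // /mulv.
    have := c0 (inord 0); have := c0 (inord 1); have := c0 (inord 2).
    by rewrite !inordK // !negbK => /eqP /= -> /eqP -> /eqP ->; rewrite !mulr0 !addr0.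
  apply: contra cj => /eqP/rowP H.
  (* Rows 0, 10 and 14 carry the pure fourth powers. *)
  case: j j3 => [|[|[|j]]] // _.
  - by have := H (inord 0); rewrite !mxE inordK //= !expr0 !mulr1 => /eqP; rewrite expf_eq0.
  - by have := H (inord 10); rewrite !mxE inordK //= !expr0 mul1r mulr1 => /eqP; rewrite expf_eq0.
  - by have := H (inord 14); rewrite !mxE inordK //= !expr0 !mul1r => /eqP; rewrite expf_eq0.
apply/rowP => k; rewrite quartic_row_resultant mxE tri_act.
set u1 := mulv _ (ortho _ _); set u2 := mulv _ (ortho _ _).
have ort l : dot n (mulv null_coord_inv (ortho c l)) = 0.
  by case: l => [|[|l]]; rewrite /dot /ortho /c /m /mulv /null_coord /null_coord_inv /=; field: ii.
suff -> : tri (coefs v) (mulv null_coord_inv (vec3 (c 1%N) (c 0%N) (c 2%N))) u1 u2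
    = tri (coefs v) n u1 u2 by rewrite Hn ?ort // mulr0.
have E k' : (k' < 3)%N -> mulv null_coord_inv (vec3 (c 1%N) (c 0%N) (c 2%N)) k' = n k'.
  by move=> k3; rewrite -[RHS]nE //; case: k' k3 => [|[|[|k']]].
by rewrite /tri !E.
Qed.

End ResultantPolynomial.

(** * The slice and its discriminant *)

Section SliceDiscriminant.
Variable A : comNzRingType.
Implicit Types (a q r : nat -> A).

Definition vec6 (x0 x1 x2 x3 x4 x5 : A) : nat -> A := fun k =>
  match k with 0 => x0 | 1 => x1 | 2 => x2 | 3 => x3 | 4 => x4 | _ => x5 end%N.

(* For f = c(x, y) + z^2 l(x, y, z) one has y f_z - z f_y = z N1 and x f_z - z f_x = z N2,
   with the conics N1 and N2 given by their coefficients at x^2, xy, xz, y^2, yz, z^2. *)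
Definition conic1 a : nat -> A :=
  vec6 (- a 1%N) (a 5%N *+ 2 - a 3%N *+ 2) 0 (a 8%N *+ 2 - a 6%N *+ 3) (a 9%N *+ 3) (- a 8%N).
Definition conic2 a : nat -> A :=
  vec6 (a 5%N *+ 2 - a 0%N *+ 3) (a 8%N *+ 2 - a 1%N *+ 2) (a 9%N *+ 3) (- a 3%N) 0 (- a 5%N).

(** Half the determinant of the Hessian matrix of the conic. *)
Definition conic_det q : A :=
  q 0%N * q 3%N * q 5%N *+ 4 + q 1%N * q 2%N * q 4%N
  - q 0%N * q 4%N ^+ 2 - q 3%N * q 2%N ^+ 2 - q 5%N * q 1%N ^+ 2.

(* The coefficient of s in [conic_det (q + s r)]. *)
Definition conic_polar q r : A :=
  (r 0%N * q 3%N * q 5%N + q 0%N * r 3%N * q 5%N + q 0%N * q 3%N * r 5%N) *+ 4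
  + (r 1%N * q 2%N * q 4%N + q 1%N * r 2%N * q 4%N + q 1%N * q 2%N * r 4%N)
  - (r 0%N * q 4%N ^+ 2 + q 0%N * q 4%N * r 4%N *+ 2)
  - (r 3%N * q 2%N ^+ 2 + q 3%N * q 2%N * r 2%N *+ 2)
  - (r 5%N * q 1%N ^+ 2 + q 5%N * q 1%N * r 1%N *+ 2).

Definition cubic_disc (d0 d1 d2 d3 : A) : A :=
  d1 ^+ 2 * d2 ^+ 2 - d0 * d2 ^+ 3 *+ 4 - d1 ^+ 3 * d3 *+ 4 + d0 * d1 * d2 * d3 *+ 18
  - d0 ^+ 2 * d3 ^+ 2 *+ 27.

Definition quad_res (p0 p1 p2 q0 q1 q2 : A) : A :=
  (p0 * q2 - p2 * q0) ^+ 2 - (p0 * q1 - p1 * q0) * (p1 * q2 - p2 * q1).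

(** The discriminant of the binary cubic det(s N1 + t N2); it vanishes when the two conics are
    tangent at a common point with z nonzero. *)
Definition pencil_disc a : A :=
  cubic_disc (conic_det (conic1 a)) (conic_polar (conic1 a) (conic2 a))
             (conic_polar (conic2 a) (conic1 a)) (conic_det (conic2 a)).

(* The discriminant of (x f_y - y f_x)(x, y, 0). *)
Definition line_disc a : A :=
  cubic_disc (a 1%N) (a 3%N *+ 2 - a 0%N *+ 3) (a 6%N *+ 3 - a 1%N *+ 2) (- a 3%N).

Definition line_res a : A :=
  quad_res (conic1 a 0%N) (conic1 a 1%N) (conic1 a 3%N)
           (conic2 a 0%N) (conic2 a 1%N) (conic2 a 3%N).

(** The factors, in order: (0 : 1 : 0) is not an eigenpoint; the conics N1 and N2 meet transversally
    off z = 0; the three eigenpoints on z = 0 are distinct; N1 and N2 have no common point on z =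
    0. *)
Definition slice_disc a : A := a 3%N * pencil_disc a * line_disc a * line_res a.

Definition slice a : Prop := [/\ a 2%N = 0, a 4%N = 0 & a 7%N = 0].

End SliceDiscriminant.

Lemma rmorph_slice_disc (A B : comNzRingType) (f : {rmorphism A -> B}) a :
  f (slice_disc a) = slice_disc (f \o a).
Proof.
have f1 k : f (conic1 a k) = conic1 (f \o a) k.
  by case: k => [|[|[|[|[|k]]]]]; rewrite /= ?rmorph0 ?(rmorphB, rmorphN, rmorphMn).
have f2 k : f (conic2 a k) = conic2 (f \o a) k.
  by case: k => [|[|[|[|[|k]]]]]; rewrite /= ?rmorph0 ?(rmorphB, rmorphN, rmorphMn).
have fdet q q' : (forall k, f (q k) = q' k) -> f (conic_det q) = conic_det q'.
  by move=> E; rewrite /conic_det !(rmorphD, rmorphN, rmorphM, rmorphMn, rmorphXn) !E.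
have fpol q q' r r' : (forall k, f (q k) = q' k) -> (forall k, f (r k) = r' k) ->
    f (conic_polar q r) = conic_polar q' r'.
  move=> E E'; rewrite /conic_polar.
  by rewrite !(rmorphMn, rmorphD, rmorphN, rmorphM, rmorphXn) !E !E'.
have fdisc d0 d1 d2 d3 : f (cubic_disc d0 d1 d2 d3) = cubic_disc (f d0) (f d1) (f d2) (f d3).
  by rewrite /cubic_disc !(rmorphD, rmorphN, rmorphM, rmorphMn, rmorphXn).
have fres p0 p1 p2 q0 q1 q2 : f (quad_res p0 p1 p2 q0 q1 q2)
    = quad_res (f p0) (f p1) (f p2) (f q0) (f q1) (f q2).
  by rewrite /quad_res !(rmorphD, rmorphN, rmorphM, rmorphXn).
rewrite /slice_disc !rmorphM /pencil_disc /line_disc /line_res !fdisc fres.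
rewrite !(fdet _ _ f1) !(fdet _ _ f2) !(fpol _ _ _ _ f1 f2) !(fpol _ _ _ _ f2 f1) !f1 !f2.
by rewrite !(rmorphB, rmorphN, rmorphMn).
Qed.

(** * Similitudes and limits of good cubics *)

Section Slices.
Variable K : numClosedFieldType.
Implicit Types (a b : nat -> K) (g h : nat -> nat -> K) (u v w n : nat -> K).

(** The scalar [s] spares all normalisations: the reflections and rotations used below keep
    polynomial entries. *)
Definition similitude (s : K) g : Prop :=
  s != 0 /\ forall u v, dot (mulv g u) (mulv g v) = s * dot u v.

Definition good_slice a : Prop := slice a /\ slice_disc a != 0.

Definition good_cubic (v : 'I_10 -> K) : Prop :=
  exists s g a, [/\ similitude s g, good_slice a & forall k, v k = act g a k].

(* The cubic x y^2 - x z^2. *)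
Definition base_slice (k : nat) : K := nth 0 [:: 0; 0; 0; 1; 0; -1] k.

Lemma good_base_slice : good_slice base_slice.
Proof.
split; first by split.
rewrite /slice_disc !mulf_neq0 ?oner_neq0 //.
- suff -> : pencil_disc base_slice = 2%:R ^+ 17 by rewrite expf_neq0 // pnatr_eq0.
  by rewrite /pencil_disc /cubic_disc /conic_det /conic_polar /base_slice /=; ring.
- suff -> : line_disc base_slice = 32%:R by rewrite pnatr_eq0.
  by rewrite /line_disc /cubic_disc /base_slice /=; ring.
- suff -> : line_res base_slice = 32%:R by rewrite pnatr_eq0.
  by rewrite /line_res /quad_res /base_slice /=; ring.
Qed.

Lemma actZ g a t k : act g (fun k => t * a k) k = t * act g a k.
Proof. by rewrite act_delta [in RHS]act_delta mulr_sumr; apply: eq_bigr => i _; rewrite mulrA. Qed.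

(** The similitude is r times the reflection that exchanges n and m e_3, where m^2 = n.n. It maps
    e_3 to a multiple of n and e_1, e_2 into the plane orthogonal to n. Its square is r^2, so the
    transformed cubic divided by r^6 is the required [b]. *)
Lemma similitude_act a n : apolar a n -> dot n n != 0 ->
  exists s g b, [/\ similitude s g, slice b & forall k, (k < 10)%N -> a k = act g b k].
Proof.
move=> [_ Hn] nn.
(* One of the two square roots of n.n differs from the last coordinate of n; with it n - m e_3 is
   not isotropic. *)
have [m mm nm] : exists2 m, m ^+ 2 = dot n n & n 2%N != m.
  have [E|ne] := eqVneq (n 2%N) (sqrtC (dot n n)); last first.
    by exists (sqrtC (dot n n)); rewrite ?sqrtCK.
  exists (- sqrtC (dot n n)); first by rewrite sqrrN sqrtCK.
  by rewrite E -addr_eq0 -mulr2n mulrn_eq0 /= sqrtC_eq0.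
pose x := vec3 (n 0%N) (n 1%N) (n 2%N - m); pose r := dot x x.
have rE : r = - m * x 2%N *+ 2.
  have: m ^+ 2 - dot n n = 0 by rewrite mm subrr.
  rewrite /r /dot /x /= => H; apply/eqP; rewrite -subr_eq0 -[X in X == _]addr0 -{1}H.
  by apply/eqP; ring.
have m0 : m != 0 by apply: contraNneq nn => m0; rewrite -mm m0 expr0n.
have x2 : x 2%N != 0 by rewrite subr_eq0.
have r0 : r != 0 by rewrite rE mulrn_eq0 /= mulf_neq0 // oppr_eq0.
pose g i j : K := r * (i == j)%:R - x i * x j *+ 2.
have C2 i : (i < 3)%N -> g i 2%N = - x 2%N *+ 2 * n i.
  by case: i => [|[|[|i]]] // _; rewrite /g rE /x /=; ring.
have nC j : (j < 2)%N -> dot n (fun i => g i j) = 0.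
  have nx : dot n x *+ 2 = r.
    have: m ^+ 2 - dot n n = 0 by rewrite mm subrr.
    rewrite /r /dot /x /= => H; apply/eqP; rewrite -subr_eq0 -[X in X == _]addr0 -{1}H.
    by apply/eqP; ring.
  move=> j2; transitivity (n j * (r - dot n x *+ 2)); last by rewrite nx subrr mulr0.
  have xj : x j = n j by case: j j2 => [|[|j]].
  rewrite /dot /g xj; case: j j2 xj => [|[|j]] // _ _ /=; ring.
have T2 j k : (j < 2)%N -> (k < 2)%N ->
    tri a (fun i => g i 2%N) (fun i => g i j) (fun i => g i k) = 0.
  move=> j2 k2; transitivity (- x 2%N *+ 2 * tri a n (fun i => g i j) (fun i => g i k)).
    by rewrite {1}/tri !C2 // /tri; ring.
  by rewrite Hn ?nC ?mulr0.
pose b k := (r ^+ 2) ^- 3 * act g a k.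
exists (r ^+ 2), g, b; split; first split.
- by rewrite expf_neq0.
- by move=> u v; rewrite /mulv /g /r /dot /=; ring.
- rewrite /b; split; apply/eqP; rewrite mulf_eq0; apply/orP; right; apply/eqP.
  + apply: (@mulIf _ 2%:R); rewrite ?pnatr_eq0 // mul0r mulr_natr -tri_grad.
    exact: T2.
  + by rewrite -[RHS](T2 0%N 1%N) // /act /tri; ring.
  + apply: (@mulIf _ 2%:R); rewrite ?pnatr_eq0 // mul0r mulr_natr -tri_grad.
    exact: T2.
- move=> k k10; rewrite actZ act_mul (@act_scalar _ (r ^+ 2)) // => [|i j i3 j3].
    by rewrite mulrA mulVf ?mul1r // !expf_neq0.
  by case: i i3 => [|[|[|i]]] // _; case: j j3 => [|[|[|j]]] // _;
    rewrite /mulm /mulv /g /r /dot /=; ring.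
Qed.

Section VanishingIdeal.
Variable G : {mpoly K[10]}.
Hypothesis G_good : forall v : 'I_10 -> K, good_cubic v -> G.@[v] = 0.

(** A polynomial curve that is good at all but finitely many parameters satisfies the equation G
    identically, hence also at the exceptional parameters and to first order. *)
Lemma poly_eq0_of_good (h : 'I_10 -> {poly K}) (d : {poly K}) :
  d.[0] != 0 -> (forall s, d.[s] != 0 -> good_cubic (fun k => (h k).[s])) ->
  mmap (@polyC K) h G = 0.
Proof.
move=> d0 Hd; apply: (@poly_eq0_cofinite _ _ d) => [|s ds].
  by apply: contraNneq d0 => ->; rewrite horner0.
by rewrite horner_mmap; exact: (G_good (Hd s ds)).
Qed.

Definition ray a b (k : nat) : {poly K} := (a k)%:P + (b k) *: 'X.

Lemma horner_ray a b s k : (ray a b k).[s] = a k + s * b k.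
Proof. by rewrite /ray hornerD hornerC hornerZ hornerX mulrC. Qed.

Lemma good_ray s g a b : similitude s g -> good_slice a -> slice b ->
  mmap (@polyC K) (fun k : 'I_10 => ray (act g a) (act g b) k) G = 0.
Proof.
move=> sg [sa da] sb; apply: (@poly_eq0_of_good _ (slice_disc (ray a b))).
  have -> : (slice_disc (ray a b)).[0] = slice_disc a; last by [].
  rewrite -[LHS]/(horner_eval 0 _) rmorph_slice_disc; congr slice_disc.
  by apply/funext => k; rewrite /= /horner_eval horner_ray mul0r addr0.
move=> t; rewrite -[X in X != 0]/(horner_eval t _) rmorph_slice_disc => dt.
exists s, g, (horner_eval t \o ray a b); split=> //.
  split=> //; case: sa sb => [a2 a4 a7] [b2 b4 b7].
  by split; rewrite /= /horner_eval horner_ray ?a2 ?a4 ?a7 ?b2 ?b4 ?b7 mulr0 addr0.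
move=> k; rewrite horner_ray -act_lin; apply: eq_act2 => // i.
by rewrite /= /horner_eval horner_ray.
Qed.

(** The ray from [base_slice] that reaches [b] at parameter 1 is good at almost all parameters. *)
Lemma vanish_slice s g b : similitude s g -> slice b -> G.@[fun k => act g b k] = 0.
Proof.
move=> sg sb; have [s0 d0] := good_base_slice.
have sb' : slice (fun k => b k - base_slice k).
  by case: s0 sb => [a2 a4 a7] [b2 b4 b7]; split; rewrite ?a2 ?a4 ?a7 ?b2 ?b4 ?b7 subr0.
have := good_ray sg good_base_slice sb'.
move/(congr1 (horner_eval 1)); rewrite raddf0 /horner_eval horner_mmap => E.
rewrite -[RHS]E; apply: meval_eq => k; rewrite horner_ray -act_lin.
by apply: eq_act2 => // i; rewrite mul1r addrC subrK.
Qed.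

End VanishingIdeal.

End Slices.

Section SimilitudeInverse.
Variables (K : numClosedFieldType) (s : K) (g : nat -> nat -> K).
Hypothesis sg : similitude s g.

Definition similitude_inv i j : K := s^-1 * g j i.
Local Notation h := similitude_inv.

Lemma mulm_inv_similitude i j : (i < 3)%N -> (j < 3)%N -> mulm h g i j = (i == j)%:R.
Proof.
have [s0 Hg] := sg; move=> i3 j3; pose e (l m : nat) : K := (l == m)%:R.
have := Hg (e i) (e j); move/(congr1 ( *%R s^-1)); rewrite mulrA mulVf // mul1r.
move=> E; transitivity (dot (e i) (e j)); last first.
  by case: i i3 {E} => [|[|[|i]]] // _; case: j j3 => [|[|[|j]]] // _; rewrite /dot /e /=; ring.
rewrite -E; case: i i3 {E} => [|[|[|i]]] // _; case: j j3 => [|[|[|j]]] // _;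
  by rewrite /mulm /mulv /h /dot /e /=; ring.
Qed.

Lemma mulm_similitude_inv i j : (i < 3)%N -> (j < 3)%N -> mulm g h i j = (i == j)%:R.
Proof.
move=> i3 j3; pose G : 'M[K]_3 := \matrix_(i, j) g i j; pose H : 'M[K]_3 := \matrix_(i, j) h i j.
have E (M N : nat -> nat -> K) (i' j' : 'I_3) :
    ((\matrix_(i, j) M i j : 'M[K]_3) *m (\matrix_(i, j) N i j)) i' j' = mulm M N i' j'.
  by rewrite mxE !big_ord_recl big_ord0 !mxE addr0 /mulm /mulv /= addrA.
have HG : H *m G = 1%:M by apply/matrixP => i' j'; rewrite E mulm_inv_similitude // mxE.
by have /matrixP/(_ (Ordinal i3) (Ordinal j3)) := mulmx1C HG; rewrite E mxE.
Qed.

End SimilitudeInverse.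

(** * The pencil with fifteen apolar members *)

Section PencilPoints.
Variable K : numClosedFieldType.

(** The values of [t ^+ 3] for which the pencil has an apolar vector. Along the pencil the
    determinant has degree 15 in t, so five values with three cube roots each exhaust its zeros; the
    coefficients of the pencil make them rational. *)
Definition pencil_cubes : seq rat := [:: - 2%:R; 1; - (2%:R / 3%:R); 2%:R^-1; - 3%:R].

Definition cube_roots (c : K) : seq K :=
  [seq 3.-root c * w | w <- [:: 1; (sqrtC (- 3%:R) - 1) / 2%:R; (- sqrtC (- 3%:R) - 1) / 2%:R]].

Definition pencil_params : seq K := flatten [seq cube_roots (ratr c) | c <- pencil_cubes].

Lemma cube_rootsP c t : t \in cube_roots c -> t ^+ 3 = c.
Proof.
have r3 : 3.-root c ^+ 3 = c by rewrite rootCK.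
have s3 : sqrtC (- 3%:R) ^+ 2 = - 3%:R :> K by rewrite sqrtCK.
move=> /mapP [w]; rewrite !inE => /or3P [] /eqP -> ->; rewrite ?mulr1 // exprMn r3;
  rewrite -[RHS]mulr1; congr (_ * _); by field: s3.
Qed.

Lemma uniq_cube_roots c : c != 0 -> uniq (cube_roots c).
Proof.
move=> c0; have s3 : sqrtC (- 3%:R) ^+ 2 = - 3%:R :> K by rewrite sqrtCK.
have r0 : 3.-root c != 0 by rewrite rootC_eq0.
rewrite map_inj_uniq; last exact: mulfI.
set s := sqrtC _ in s3 *.
have ne a b : a - b != 0 -> (a == b) = false :> bool by rewrite subr_eq0 => /negPf.
have s0 : s != 0 by rewrite sqrtC_eq0 oppr_eq0 pnatr_eq0.
have h (x : K) : x ^+ 2 = - 3%:R -> x - 3%:R != 0.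
  move=> Ex; apply/eqP => /eqP; rewrite subr_eq0 => /eqP x3.
  have /eqP : (12%:R : K) = 0 by rewrite -[RHS](subrr (- 3%:R)) -{1}Ex x3; ring.
  by rewrite pnatr_eq0.
rewrite /= !inE; apply/and3P; split=> //; rewrite ?negb_or.
- apply/andP; split; rewrite -subr_eq0.
  + have -> : 1 - (s - 1) / 2%:R = - (s - 3%:R) / 2%:R by field.
    by rewrite mulf_neq0 ?invr_eq0 ?pnatr_eq0 // oppr_eq0 h.
  + have -> : 1 - (- s - 1) / 2%:R = - (- s - 3%:R) / 2%:R by field.
    by rewrite mulf_neq0 ?invr_eq0 ?pnatr_eq0 // oppr_eq0 h // sqrrN.
- by rewrite -subr_eq0; have -> : (s - 1) / 2%:R - (- s - 1) / 2%:R = s by field.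
Qed.

Lemma pencil_params_uniq : uniq pencil_params.
Proof.
have n0 : all (fun c => c != 0) pencil_cubes by vm_compute.
have u : uniq pencil_cubes by vm_compute.
rewrite /pencil_params; elim: pencil_cubes n0 u => // c r IHr /andP [c0 r0] /andP [cr ur].
change (uniq (cube_roots (ratr c) ++ flatten [seq cube_roots (ratr d) | d <- r])).
rewrite cat_uniq uniq_cube_roots ?fmorph_eq0 // IHr // andbT andTb.
apply/hasPn => t /flattenP [_ /mapP [d dr ->]] /cube_rootsP td.
apply/negP => /cube_rootsP; rewrite td => /fmorph_inj E.
by rewrite -E dr in cr.
Qed.

Definition pencil_at (t : K) : 'I_10 -> K :=
  fun k => pencil K pencil_phi0 k + t * pencil K pencil_phi1 k.

Lemma coefs_pencil_at t k : (k < 10)%N -> coefs (pencil_at t) k =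
  act (@null_coord K) (fun k => (pencil_phi0 k)%:~R + t * (pencil_phi1 k)%:~R) k.
Proof. by move=> k10; rewrite act_lin -!coefs_pencil. Qed.

Lemma pencil_apolar t : t \in pencil_params ->
  exists2 n, apolar (coefs (pencil_at t)) n & dot n n != 0.
Proof.
move=> /flattenP [_ /mapP [c cP ->]] /cube_rootsP t3.
have ii : 'i * 'i = -1 :> K by rewrite -expr2 sqrCi.
(* In null coordinates n is (p, q, 1), with norm 2pq + 1, and the plane orthogonal to it is spanned
   by (1, 0, -q) and (0, 1, -p). Apolarity amounts to three equations on this basis. *)
have H (p q : K) : p * q *+ 2 + 1 != 0 ->
  let phi := fun k => (pencil_phi0 k)%:~R + t * (pencil_phi1 k)%:~R in
  let m := vec3 p q 1 in
  tri phi m (vec3 1 0 (- q)) (vec3 1 0 (- q)) = 0 ->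
  tri phi m (vec3 1 0 (- q)) (vec3 0 1 (- p)) = 0 ->
  tri phi m (vec3 0 1 (- p)) (vec3 0 1 (- p)) = 0 ->
  exists2 n, apolar (coefs (pencil_at t)) n & dot n n != 0.
  move=> pq phi m Hxx Hxy Hyy; exists (mulv (@null_coord_inv K) m); last first.
    suff -> : dot (mulv (@null_coord_inv K) m) (mulv (@null_coord_inv K) m)
      = p * q *+ 2 + 1 by [].
    by rewrite /dot /mulv /null_coord_inv /m /=; field: ii.
  split; first by exists 2%N; rewrite // /mulv /null_coord_inv /m /= !mul0r !add0r mul1r oner_eq0.
  move=> u v un vn; rewrite (eq_tri _ _ _ (@coefs_pencil_at t)) tri_act -/phi.
  pose x := mulv (@null_coord K) u; pose y := mulv (@null_coord K) v.
  have E k : (k < 3)%N -> mulv (@null_coord K) (mulv (@null_coord_inv K) m) k = m k.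
    by case: k => [|[|[|k]]] // _; rewrite /mulv /null_coord /null_coord_inv /=; field: ii.
  have ort (w : nat -> K) : dot (mulv (@null_coord_inv K) m) w = 0 ->
      mulv (@null_coord K) w 2%N =
      - (q * mulv (@null_coord K) w 0%N + p * mulv (@null_coord K) w 1%N).
    move=> H; rewrite -[LHS]subr0 -H /dot /mulv /null_coord /null_coord_inv /m /=.
    by field: ii.
  transitivity (tri phi m (vec3 (x 0%N) (x 1%N) (- (q * x 0%N + p * x 1%N)))
                          (vec3 (y 0%N) (y 1%N) (- (q * y 0%N + p * y 1%N)))).
    have x2 := ort u un; have y2 := ort v vn; rewrite -/x in x2; rewrite -/y in y2.
    by rewrite /tri !E // -/x -/y x2 y2 /=.
  transitivity (x 0%N * y 0%N * tri phi m (vec3 1 0 (- q)) (vec3 1 0 (- q))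
    + (x 0%N * y 1%N + x 1%N * y 0%N) * tri phi m (vec3 1 0 (- q)) (vec3 0 1 (- p))
    + x 1%N * y 1%N * tri phi m (vec3 0 1 (- p)) (vec3 0 1 (- p))).
    by rewrite /tri /vec3; ring.
  by rewrite Hxx Hxy Hyy !mulr0 !addr0.
move: t3; move: cP; rewrite !inE => /or4P [||/eqP ->|/orP []] => [/eqP ->|/eqP ->||/eqP ->|/eqP ->];
  rewrite !(rmorphN, rmorph1, fmorph_div, fmorphV, rmorph_nat) /= => t3.
(* In all five cases p is a rational multiple of t and q one of t^2, as the symmetry of order three
   suggests. *)
- have pq : t / 2%:R * (- t ^+ 2) *+ 2 + 1 = 3%:R by field: t3.
  by apply: (H (t / 2%:R) (- t ^+ 2)); rewrite ?pq ?pnatr_eq0 // /tri /vec3 /pencil_phi0 /pencil_phi1 /=; field: t3.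
- have pq : t * 2%:R * (t ^+ 2 / 2%:R) *+ 2 + 1 = 3%:R by field: t3.
  by apply: (H (t * 2%:R) (t ^+ 2 / 2%:R)); rewrite ?pq ?pnatr_eq0 // /tri /vec3 /pencil_phi0 /pencil_phi1 /=; field: t3.
(* The cube of t is not an integer here; that of the multiple r is, and [field] receives the
   relation without denominators. *)
- pose r := t * 3%:R; have tr : t = r / 3%:R by rewrite /r; field.
  have r3 : r ^+ 3 = - 18%:R by rewrite /r exprMn t3; field.
  have pq : - t / 2%:R * (t ^+ 2 / 2%:R) *+ 2 + 1 = 4%:R / 3%:R by rewrite tr; field: r3.
  by apply: (H (- t / 2%:R) (t ^+ 2 / 2%:R)); rewrite ?pq ?mulf_neq0 ?invr_eq0 ?pnatr_eq0 //
    tr /tri /vec3 /pencil_phi0 /pencil_phi1 /=; field: r3.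
- pose r := t * 2%:R; have tr : t = r / 2%:R by rewrite /r; field.
  have r3 : r ^+ 3 = 4%:R by rewrite /r exprMn t3; field.
  have pq : t * 3%:R * (- t ^+ 2 * 3%:R) *+ 2 + 1 = - 8%:R by rewrite tr; field: r3.
  by apply: (H (t * 3%:R) (- t ^+ 2 * 3%:R)); rewrite ?pq ?oppr_eq0 ?pnatr_eq0 //
    tr /tri /vec3 /pencil_phi0 /pencil_phi1 /=; field: r3.
- have pq : t * 2%:R / 3%:R * (- t ^+ 2 * 2%:R / 3%:R) *+ 2 + 1 = 11%:R / 3%:R by field: t3.
  by apply: (H (t * 2%:R / 3%:R) (- t ^+ 2 * 2%:R / 3%:R)); rewrite ?pq ?mulf_neq0 ?invr_eq0 ?pnatr_eq0 // /tri /vec3 /pencil_phi0 /pencil_phi1 /=; field: t3.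
Qed.

Lemma vanish_pencil (G : {mpoly K[10]}) t :
  (forall v : 'I_10 -> K, good_cubic v -> G.@[v] = 0) ->
  t \in pencil_params -> G.@[pencil_at t] = 0.
Proof.
move=> HG /pencil_apolar [n Hn nn].
have [s [g [b [sg sb E]]]] := similitude_act Hn nn.
rewrite -(vanish_slice HG sg sb); apply: meval_eq => k.
by rewrite -E // /coefs inord_val.
Qed.

End PencilPoints.

(** * The ideal of the good cubics *)

Section Tangent.
Variable K : numClosedFieldType.
Implicit Types (a b w : nat -> K) (g : nat -> nat -> K).

(** The rational parametrisation of rotations, multiplied by 1 + s^2 so that the parameter can be
    the variable of a polynomial ring. *)
Definition rotation_xz (A : comNzRingType) (s : A) (i j : nat) : A :=
  nth 0 (nth [::] [:: [:: 1 - s ^+ 2; 0; s *+ 2]; [:: 0; 1 + s ^+ 2; 0];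
                      [:: - s *+ 2; 0; 1 - s ^+ 2]] i) j.
Definition rotation_yz (A : comNzRingType) (s : A) (i j : nat) : A :=
  nth 0 (nth [::] [:: [:: 1 + s ^+ 2; 0; 0]; [:: 0; 1 - s ^+ 2; s *+ 2];
                      [:: 0; - s *+ 2; 1 - s ^+ 2]] i) j.

Lemma similitude_mul s t g h :
  @similitude K s g -> similitude t h -> similitude (s * t) (mulm g h).
Proof.
move=> [s0 Hg] [t0 Hh]; split; first by rewrite mulf_neq0.
move=> u v; have E x : dot (mulv (mulm g h) u) x = dot (mulv g (mulv h u)) x.
  by rewrite /dot /mulm /mulv; ring.
have E' x : dot x (mulv (mulm g h) v) = dot x (mulv g (mulv h v)).
  by rewrite /dot /mulm /mulv; ring.
by rewrite E E' Hg Hh mulrA.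
Qed.

Lemma similitude_xz (s : K) : 1 + s ^+ 2 != 0 -> similitude ((1 + s ^+ 2) ^+ 2) (rotation_xz s).
Proof.
move=> s0; split; first by rewrite expf_neq0.
by move=> u v; rewrite /rotation_xz /mulv /dot /=; ring.
Qed.

Lemma similitude_yz (s : K) : 1 + s ^+ 2 != 0 -> similitude ((1 + s ^+ 2) ^+ 2) (rotation_yz s).
Proof.
move=> s0; split; first by rewrite expf_neq0.
by move=> u v; rewrite /rotation_yz /mulv /dot /=; ring.
Qed.

Definition tangent_xz a k : K := (act (rotation_xz ('X : {poly K})) (polyC \o a) k)^`().[0].
Definition tangent_yz a k : K := (act (rotation_yz ('X : {poly K})) (polyC \o a) k)^`().[0].

Lemma deriv_X2M (p : {poly K}) : (('X *+ 2) * p)^`().[0] = p.[0] *+ 2.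
Proof. by rewrite derivM derivMn derivX !hornerE; ring. Qed.

(** The rotation moves f with velocity 2 (z f_x - x f_z) = -2 z N2, whose coefficients at x^2 z, xyz
    and y^2 z are those of -2 N2(x, y, 0). For the rotation of y and z the velocity is -2 z N1. *)
Lemma tangent_xzE a : slice a ->
  [/\ tangent_xz a 2 = - conic2 a 0%N *+ 2, tangent_xz a 4 = - conic2 a 1%N *+ 2
    & tangent_xz a 7 = - conic2 a 3%N *+ 2].
Proof.
case=> a2 a4 a7; pose X : {poly K} := 'X; pose c := 1 - X ^+ 2; pose e := 1 + X ^+ 2.
have E k p : act (rotation_xz X) (polyC \o a) k = X *+ 2 * p -> tangent_xz a k = p.[0] *+ 2.
  by move=> E; rewrite /tangent_xz -/X E deriv_X2M.
have H := (a2, a4, a7, polyC0).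
split.
- rewrite (E 2%N ((a 0%N)%:P * c ^+ 2 *+ 3 + (a 5%N)%:P * ((X *+ 2) ^+ 2 - c ^+ 2 *+ 2)
     + (a 9%N)%:P * c * (X *+ 2) *+ 3)).
    by rewrite /c /X !hornerE /=; ring.
  by rewrite /act /dot /grad /rotation_xz /= !H /c; ring.
- rewrite (E 4%N (((a 1%N)%:P - (a 8%N)%:P) * c * e *+ 2)).
    by rewrite /c /e /X !hornerE /=; ring.
  by rewrite /act /tri /rotation_xz /= !H /c /e; ring.
- rewrite (E 7%N ((a 3%N)%:P * e ^+ 2)).
    by rewrite /e /X !hornerE /=; ring.
  by rewrite /act /dot /grad /rotation_xz /= !H /e; ring.
Qed.

Lemma tangent_yzE a : slice a ->
  [/\ tangent_yz a 2 = - conic1 a 0%N *+ 2, tangent_yz a 4 = - conic1 a 1%N *+ 2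
    & tangent_yz a 7 = - conic1 a 3%N *+ 2].
Proof.
case=> a2 a4 a7; pose X : {poly K} := 'X; pose c := 1 - X ^+ 2; pose e := 1 + X ^+ 2.
have E k p : act (rotation_yz X) (polyC \o a) k = X *+ 2 * p -> tangent_yz a k = p.[0] *+ 2.
  by move=> E; rewrite /tangent_yz -/X E deriv_X2M.
have H := (a2, a4, a7, polyC0).
split.
- rewrite (E 2%N ((a 1%N)%:P * e ^+ 2)).
    by rewrite /e /X !hornerE /=; ring.
  by rewrite /act /dot /grad /rotation_yz /= !H /e; ring.
- rewrite (E 4%N (((a 3%N)%:P - (a 5%N)%:P) * c * e *+ 2)).
    by rewrite /c /e /X !hornerE /=; ring.
  by rewrite /act /tri /rotation_yz /= !H /c /e; ring.
- rewrite (E 7%N ((a 6%N)%:P * c ^+ 2 *+ 3 + (a 8%N)%:P * ((X *+ 2) ^+ 2 - c ^+ 2 *+ 2)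
     + (a 9%N)%:P * c * (X *+ 2) *+ 3)).
    by rewrite /c /X !hornerE /=; ring.
  by rewrite /act /dot /grad /rotation_yz /= !H /c; ring.
Qed.

Lemma horner_act (h : nat -> nat -> {poly K}) (b : nat -> {poly K}) k t :
  (act h b k).[t] = act (fun i j => (h i j).[t]) (fun i => (b i).[t]) k.
Proof. exact: (rmorph_act (horner_eval t)). Qed.

Section AtGoodPoint.
Variables (s : K) (g : nat -> nat -> K) (a : nat -> K).
Hypotheses (g_sim : similitude s g) (a_good : good_slice a).

(** The differential of G at the good cubic, with directions pulled back along [g] so that tangent
    vectors are computed at a point of the slice. *)
Definition diff_at (G : {mpoly K[10]}) (w : nat -> K) : K :=
  (dird (fun k : 'I_10 => act g w k) G).@[fun k => act g a k].

Lemma diff_atE G w :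
  diff_at G w = \sum_(i < 10) G^`M(i).@[fun k => act g a k] * act g w i.
Proof.
rewrite /diff_at /dird rmorph_sum; apply: eq_bigr => i _.
by rewrite /= mevalZ mulrC.
Qed.

Lemma diff_at_delta G w :
  diff_at G w = \sum_(i < 10) w i * diff_at G (fun j => (j == i :> nat)%:R).
Proof.
rewrite diff_atE; under eq_bigr => j _ do rewrite act_delta mulr_sumr.
rewrite exchange_big; apply: eq_bigr => i _; rewrite diff_atE mulr_sumr.
by apply: eq_bigr => j _; rewrite mulrCA.
Qed.

Variable G : {mpoly K[10]}.
Hypothesis G_good : forall v : 'I_10 -> K, good_cubic v -> G.@[v] = 0.

Lemma diff_at_curve (h : nat -> {poly K}) :
  mmap (@polyC K) (fun k : 'I_10 => act (fun i j => (g i j)%:P) h k) G = 0 ->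
  (forall k, (h k).[0] = a k) -> diff_at G (fun k => (h k)^`().[0]) = 0.
Proof.
move=> E h0; move/(congr1 (fun p : {poly K} => p^`().[0])): E.
rewrite deriv0 horner0 (@mmap_chain _ _ _ _ _ deriv) => [|c|x y];
  [|exact: derivC|exact: derivM].
rewrite diff_atE horner_sum => E; rewrite -[RHS]E; apply: eq_bigr => i _.
rewrite hornerM horner_mmap; congr (_ * _).
  apply: meval_eq => k; rewrite horner_act; apply: eq_act2 => [i' j|j]; last by rewrite h0.
  by rewrite hornerC.
rewrite act_delta [in RHS]act_delta raddf_sum horner_sum; apply: eq_bigr => j _.
have -> : act (fun i j => (g i j)%:P) (fun k : nat => (k == j)%:R) i
    = (act g (fun k : nat => (k == j)%:R) i)%:P.
  by rewrite (rmorph_act (@polyC K)); apply: eq_act2 => // k; rewrite /= rmorph_nat.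
by rewrite /= derivM derivC mulr0 addr0 hornerM hornerC.
Qed.

Lemma diff_at_slice w : slice w -> diff_at G w = 0.
Proof.
move=> sw; have E := good_ray G_good g_sim a_good sw.
have -> : w = (fun k => (ray a w k)^`().[0]).
  apply/funext => k; rewrite /ray derivD derivC add0r derivZ derivX.
  by rewrite hornerZ hornerC mulr1.
apply: diff_at_curve => [|k]; last by rewrite horner_ray mul0r addr0.
rewrite -[RHS]E; apply: eq_mmap => // k; apply/polyP => i.
have F : act (fun i j => (g i j)%:P) (ray a w) k = (act g a k)%:P + 'X * (act g w k)%:P.
  rewrite !(rmorph_act (@polyC K)) -act_lin; apply: eq_act2 => // l.
  by rewrite /ray /= -mul_polyC mulrC.
by rewrite F /ray -mul_polyC mulrC.
Qed.

Lemma diff_at_rotation (R : forall A : comNzRingType, A -> nat -> nat -> A) :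
  (forall s : K, 1 + s ^+ 2 != 0 -> similitude ((1 + s ^+ 2) ^+ 2) (R K s)) ->
  (forall s i j, (R {poly K} 'X i j).[s] = R K s i j) ->
  (forall i j, (i < 3)%N -> (j < 3)%N -> R K 0 i j = (i == j)%:R) ->
  diff_at G (fun k => (act (R {poly K} 'X) (polyC \o a) k)^`().[0]) = 0.
Proof.
move=> simR hR R0; pose A k := act (R {poly K} 'X) (polyC \o a) k.
have hA s' k : (A k).[s'] = act (R K s') a k.
  by rewrite horner_act; apply: eq_act2 => [i j|i]; rewrite ?hR //= hornerC.
have A0 k : (k < 10)%N -> (A k).[0] = a k.
  by move=> k10; rewrite hA (@act_scalar _ 1) ?expr1n ?mul1r // => i j i3 j3; rewrite mul1r R0.
(* Beyond index 9 [act] repeats its last coefficient, so the curve is redefined there in order to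
   start at [a] for every index. *)
pose A' k := if (k < 10)%N then A k else (a k)%:P.
have A'E h k : act h A' k = act h A k by apply: eq_act => i i10; rewrite /A' i10.
have -> : diff_at G (fun k => (A k)^`().[0]) = diff_at G (fun k => (A' k)^`().[0]).
  rewrite diff_at_delta [RHS]diff_at_delta; apply: eq_bigr => i _.
  by rewrite /A' ltn_ord.
apply: diff_at_curve => [|k]; last first.
  by rewrite /A'; case: ltnP => [/A0|_] //; rewrite hornerC.
apply: (poly_eq0_of_good G_good (d := 1 + 'X ^+ 2)) => [|t].
  by rewrite !hornerE expr0n addr0 oner_eq0.
rewrite !hornerE => dt; exists (((1 + t ^+ 2) ^+ 2) * s), (mulm (R K t) g), a; split=> //.
  by apply: similitude_mul => //; apply: simR.
move=> k; rewrite A'E -act_mul horner_act; apply: eq_act2 => [i j|i].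
  by rewrite hornerC.
by rewrite hA.
Qed.

Lemma diff_at_tangent_xz : diff_at G (tangent_xz a) = 0.
Proof.
apply: (@diff_at_rotation rotation_xz); first exact: similitude_xz.
- move=> t i j; rewrite /rotation_xz; case: i => [|[|[|i]]]; case: j => [|[|[|j]]];
  by rewrite /= ?nth_nil ?hornerE ?horner0 //=; ring.
- by case=> [|[|[|i]]] // [|[|[|j]]] // _ _; rewrite /rotation_xz /=; ring.
Qed.

Lemma diff_at_tangent_yz : diff_at G (tangent_yz a) = 0.
Proof.
apply: (@diff_at_rotation rotation_yz); first exact: similitude_yz.
- move=> t i j; rewrite /rotation_yz; case: i => [|[|[|i]]]; case: j => [|[|[|j]]];
  by rewrite /= ?nth_nil ?hornerE ?horner0 //=; ring.
- by case=> [|[|[|i]]] // [|[|[|j]]] // _ _; rewrite /rotation_yz /=; ring.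
Qed.

(* Only the coefficients of x^2 z, xyz and y^2 z are transverse to the slice. *)
Definition diff_transverse (k : nat) : K :=
  diff_at G (fun j => (j == nth 0 [:: 2; 4; 7] k)%:R)%N.

Lemma diff_at_transverse w :
  diff_at G w = w 2%N * diff_transverse 0 + w 4%N * diff_transverse 1
                + w 7%N * diff_transverse 2.
Proof.
rewrite diff_at_delta !big_ord_recr big_ord0 /= /diff_transverse /=.
have D k : k \notin [:: 2; 4; 7]%N -> diff_at G (fun j => (j == k)%:R) = 0.
  rewrite !inE !negb_or => /and3P [k2 k4 k7]; apply: diff_at_slice.
  by split; rewrite eq_sym ?(negPf k2) ?(negPf k4) ?(negPf k7).
by rewrite !(D 0%N, D 1%N, D 3%N, D 5%N, D 6%N, D 8%N, D 9%N) //; ring.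
Qed.

End AtGoodPoint.

Definition cross (u v : nat -> K) : nat -> K :=
  vec3 (u 1%N * v 2%N - u 2%N * v 1%N) (u 2%N * v 0%N - u 0%N * v 2%N)
       (u 0%N * v 1%N - u 1%N * v 0%N).

(** Both vectors are multiples of the cross product of p and q: z x (p x q) = (q.z) p - (p.z) q is
    zero for z = x and z = y. *)
Lemma cross_proportional (p q x y : nat -> K) k : (k < 3)%N -> cross p q k != 0 ->
  dot p x = 0 -> dot q x = 0 -> dot p y = 0 -> dot q y = 0 ->
  forall i j, (i < 3)%N -> (j < 3)%N -> x i * y j = x j * y i.
Proof.
move=> k3 mk px qx py qy i j i3 j3.
have H z l : (l < 3)%N -> dot p z = 0 -> dot q z = 0 -> z l * cross p q k = z k * cross p q l.
  move=> l3 pz qz.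
  suff : z l * cross p q k - z k * cross p q l = 0 by move/eqP; rewrite subr_eq0 => /eqP.
  transitivity (cross (vec3 (p 0%N * dot q z - q 0%N * dot p z)
    (p 1%N * dot q z - q 1%N * dot p z) (p 2%N * dot q z - q 2%N * dot p z))
    (fun m => (m == 0%N)%:R) 0%N * 0 + (z l * cross p q k - z k * cross p q l)).
    by rewrite mulr0 add0r.
  case: l l3 => [|[|[|l]]] // _; case: k k3 {mk} => [|[|[|k]]] // _; rewrite mulr0 add0r /=.
  - by ring.
  - by transitivity (p 2%N * dot q z - q 2%N * dot p z); [rewrite /dot; ring|rewrite pz qz; ring].
  - by transitivity (q 1%N * dot p z - p 1%N * dot q z); [rewrite /dot; ring|rewrite pz qz; ring].
  - by transitivity (q 2%N * dot p z - p 2%N * dot q z); [rewrite /dot; ring|rewrite pz qz; ring].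
  - by ring.
  - by transitivity (p 0%N * dot q z - q 0%N * dot p z); [rewrite /dot; ring|rewrite pz qz; ring].
  - by transitivity (p 1%N * dot q z - q 1%N * dot p z); [rewrite /dot; ring|rewrite pz qz; ring].
  - by transitivity (q 0%N * dot p z - p 0%N * dot q z); [rewrite /dot; ring|rewrite pz qz; ring].
  - by ring.
apply: (mulfI mk); apply: (mulfI mk).
have xi := H x i i3 px qx; have xj := H x j j3 px qx.
have yi := H y i i3 py qy; have yj := H y j j3 py qy.
transitivity ((x i * cross p q k) * (y j * cross p q k)); first by ring.
transitivity ((x j * cross p q k) * (y i * cross p q k)); last by ring.
by rewrite xi xj yi yj; ring.
Qed.

(** The resultant of two binary quadratics is a quadratic form in the 2 x 2 minors of their
    coefficients, so [line_res] would vanish with the cross product. *)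
Lemma good_slice_cross a : good_slice a -> exists2 k, (k < 3)%N &
  cross (vec3 (conic1 a 0%N) (conic1 a 1%N) (conic1 a 3%N))
        (vec3 (conic2 a 0%N) (conic2 a 1%N) (conic2 a 3%N)) k != 0.
Proof.
move=> [_]; rewrite /slice_disc !mulf_eq0 !negb_or => /andP [_ nz].
set p := vec3 _ _ _; set q := vec3 _ _ _.
have [/existsP [k ck]|] := boolP [exists k : 'I_3, cross p q k != 0]; first by exists k.
rewrite negb_exists => /forallP c0; case/negP: nz; rewrite /line_res.
have := c0 (inord 0); have := c0 (inord 1); have := c0 (inord 2).
rewrite !inordK // !negbK /cross /= => /eqP E2 /eqP E1 /eqP E0.
have -> : quad_res (conic1 a 0) (conic1 a 1) (conic1 a 3)
                   (conic2 a 0) (conic2 a 1) (conic2 a 3)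
  = cross p q 1 ^+ 2 - cross p q 2 * cross p q 0 by rewrite /quad_res /=; ring.
by rewrite /cross /= E0 E1 E2 expr0n mul0r subr0.
Qed.

(** Every equation of the good cubics has a differential that kills the slice directions and the two
    rotations. Modulo the slice the rotations are the independent vectors N1(x, y, 0) and N2(x, y,
    0) up to a factor, so these directions span a hyperplane and the differentials are multiples of
    one linear form. *)
Lemma diff_at_proportional s g a (F G : {mpoly K[10]}) w1 w2 :
  similitude s g -> good_slice a ->
  (forall v : 'I_10 -> K, good_cubic v -> F.@[v] = 0) ->
  (forall v : 'I_10 -> K, good_cubic v -> G.@[v] = 0) ->
  diff_at g a F w1 * diff_at g a G w2 = diff_at g a F w2 * diff_at g a G w1.
Proof.
move=> sg ga HF HG; have sa := ga.1.
have [k k3 ck] := good_slice_cross ga.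
have Hdot H : (forall v : 'I_10 -> K, good_cubic v -> H.@[v] = 0) ->
    dot (vec3 (conic1 a 0%N) (conic1 a 1%N) (conic1 a 3%N)) (diff_transverse g a H) = 0 /\
    dot (vec3 (conic2 a 0%N) (conic2 a 1%N) (conic2 a 3%N)) (diff_transverse g a H) = 0.
  move=> HH; have [x2 x4 x7] := tangent_xzE sa; have [y2 y4 y7] := tangent_yzE sa.
  have := diff_at_tangent_xz sg ga HH; rewrite (diff_at_transverse sg ga HH) x2 x4 x7 => Ex.
  have := diff_at_tangent_yz sg ga HH; rewrite (diff_at_transverse sg ga HH) y2 y4 y7 => Ey.
  have n2 : - 2%:R != 0 :> K by rewrite oppr_eq0 pnatr_eq0.
  by split; apply: (mulfI n2); rewrite mulr0; [rewrite -Ey|rewrite -Ex]; rewrite /dot /=; ring.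
have [F1 F2] := Hdot F HF; have [G1 G2] := Hdot G HG.
have P := cross_proportional k3 ck F1 F2 G1 G2.
rewrite !(diff_at_transverse sg ga HF) !(diff_at_transverse sg ga HG).
have P01 := P 0%N 1%N isT isT; have P02 := P 0%N 2%N isT isT; have P12 := P 1%N 2%N isT isT.
move: P01 P02 P12; move: (diff_transverse g a F) (diff_transverse g a G) => f h P01 P02 P12.
apply/eqP; rewrite -subr_eq0; apply/eqP.
transitivity ((w1 2%N * w2 4%N - w1 4%N * w2 2%N) * (f 0%N * h 1%N - f 1%N * h 0%N)
  + (w1 2%N * w2 7%N - w1 7%N * w2 2%N) * (f 0%N * h 2%N - f 2%N * h 0%N)
  + (w1 4%N * w2 7%N - w1 7%N * w2 4%N) * (f 1%N * h 2%N - f 2%N * h 1%N)); first by ring.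
by rewrite P01 P02 P12 !subrr !mulr0 !addr0.
Qed.

Lemma similitude_act_onto s g (w : nat -> K) : similitude s g ->
  exists w', forall k, (k < 10)%N -> w k = act g w' k.
Proof.
move=> sg; exists (act (similitude_inv s g) w) => k k10.
rewrite act_mul (@act_scalar _ 1) ?expr1n ?mul1r // => i j i3 j3.
by rewrite mulm_inv_similitude // mul1r.
Qed.

Lemma good_tangent_closed (F G : {mpoly K[10]}) (b w : 'I_10 -> K) :
  (forall v : 'I_10 -> K, good_cubic v -> F.@[v] = 0) ->
  (forall v : 'I_10 -> K, good_cubic v -> G.@[v] = 0) ->
  forall v : 'I_10 -> K, good_cubic v ->
  (dird b F * dird w G - dird w F * dird b G).@[v] = 0.
Proof.
move=> HF HG v [s [g [a [sg ga Ev]]]].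
have [b' Eb] := similitude_act_onto (coefs b) sg.
have [w' Ew] := similitude_act_onto (coefs w) sg.
have Eval H (x : 'I_10 -> K) x' : (forall k, (k < 10)%N -> coefs x k = act g x' k) ->
    (dird x H).@[v] = diff_at g a H x'.
  move=> Ex; have -> : x = (fun k : 'I_10 => act g x' k).
    by apply/funext => k; rewrite -Ex // /coefs inord_val.
  by rewrite /diff_at; apply: meval_eq => k; rewrite Ev.
rewrite mevalB !mevalM !(Eval _ _ _ Eb) !(Eval _ _ _ Ew).
by rewrite (diff_at_proportional _ _ sg ga HF HG) subrr.
Qed.

Theorem good_ideal_principal (G : {mpoly K[10]}) :
  (forall v : 'I_10 -> K, good_cubic v -> (resultant_poly K).@[v] = 0) ->
  (forall v : 'I_10 -> K, good_cubic v -> G.@[v] = 0) ->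
  exists H, G = H * resultant_poly K.
Proof.
move=> HF HG.
apply: (@dvd_of_tangent_ideal _ _ _ 15
  (fun G => forall v : 'I_10 -> K, good_cubic v -> G.@[v] = 0)
  (pencil K pencil_phi0) (pencil K pencil_phi1) (pencil_params K)) => //.
- exact: resultant_poly_homog.
- exact: resultant_poly_pencil1.
- exact: pencil_params_uniq.
- by move=> P HP t tP; apply: vanish_pencil.
- by move=> P w HP; apply: good_tangent_closed.
Qed.

End Tangent.

(** * Minors and eigenpoints *)

Section Minors.
Variable A : comNzRingType.
Implicit Types (a u : nat -> A).

Definition minor a u : nat -> A := vec3
  (u 1%N * grad a u 2 - u 2%N * grad a u 1)
  (u 0%N * grad a u 2 - u 2%N * grad a u 0)
  (u 0%N * grad a u 1 - u 1%N * grad a u 0).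

End Minors.

Lemma rmorph_minor (A B : comNzRingType) (f : {rmorphism A -> B}) (a u : nat -> A) k :
  f (minor a u k) = minor (f \o a) (f \o u) k.
Proof. by case: k => [|[|k]]; rewrite /minor /vec3 rmorphB !rmorphM !rmorph_grad. Qed.

Section Bridge.
Variable K : fieldType.
Implicit Types (v : 'rV[K]_10) (p : 'rV[K]_3).

Definition rcoefs n (v : 'rV[K]_n.+1) (k : nat) : K := v 0 (inord k).

Definition mX (i : nat) : {mpoly K[3]} := 'X_(inord i).

Lemma cubicE v : cubic v = cub (fun k => (rcoefs v k)%:MP) mX.
Proof.
have X3 x y z : 'X_[[multinom [tuple x; y; z]]] = mX 0 ^+ x * mX 1 ^+ y * mX 2 ^+ z :> {mpoly K[3]}.
  rewrite mpolyXE_id !big_ord_recl big_ord0 mulr1 mulrA.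
  by do 3?[congr (_ * _)]; rewrite mnm_tnth; congr ('X_ _ ^+ _);
    apply/val_inj; rewrite /= inordK.
rewrite /cubic (eq_bigr (fun k : 'I_10 => (rcoefs v k)%:MP *
  'X_[nth 0%MM cubic_monomials k])) => [|k _]; last by rewrite mul_mpolyC /rcoefs inord_val.
by rewrite !big_ord_recl big_ord0 /= !X3 /cub; ring.
Qed.

Lemma mderiv_mX i j : (i < 3)%N -> (mX i)^`M(j) = (i == j)%:R.
Proof.
move=> i3; rewrite /mX mderivX mnm1E -val_eqE /= inordK //.
have [->|_] := eqVneq i j; last by rewrite scale0r.
have -> : (U_(inord j) - U_(j))%MM = 0%MM :> 'X_{1..3}.
  by rewrite inord_val -{1}[U_(j)%MM]add0m addmK.
by rewrite mpolyX0 scale1r.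
Qed.

Lemma mderiv_cub (c : nat -> K) (j : 'I_3) :
  (cub (fun k => (c k)%:MP) mX)^`M(j) = grad (fun k => (c k)%:MP) mX j.
Proof.
rewrite /cub !exprS !expr0 !mulr1 !(mderivD, mderivM, mderivC) !mderiv_mX //.
by case: j => [[|[|[|j]]] //= _]; ring.
Qed.

Lemma eigen_minorE v (k : 'I_3) :
  eigen_minor (cubic v) k = minor (fun k => (rcoefs v k)%:MP) mX k.
Proof.
have Ex (i : 'I_3) : 'X_i = mX i by rewrite /mX inord_val.
rewrite /eigen_minor /eigen_mx (expand_det_row _ ord0) !big_ord_recl big_ord0 /cofactor.
rewrite !det_mx11 !mxE /= addr0 !Ex cubicE !mderiv_cub.
by case: k => [[|[|[|k]]] //= kk]; rewrite /minor /= ?expr0 ?expr1 ?mul1r ?mulN1r ?mulrN.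
Qed.

Lemma meval_eigen_minor v (k : 'I_3) p :
  (eigen_minor (cubic v) k).@[p 0] = minor (rcoefs v) (rcoefs p) k.
Proof.
rewrite eigen_minorE rmorph_minor.
have -> : meval (p 0) \o (fun k => (rcoefs v k)%:MP) = rcoefs v.
  by apply/funext => i; rewrite /= mevalC.
by have -> : meval (p 0) \o mX = rcoefs p by apply/funext => i; rewrite /= mevalXU.
Qed.

Lemma eigenpointsP v p : eigenpoints (cubic v) p <->
  p != 0 /\ forall k, (k < 3)%N -> minor (rcoefs v) (rcoefs p) k = 0.
Proof.
split=> -[p0 H]; split=> //.
  by move=> k k3; have := H (Ordinal k3); rewrite meval_eigen_minor.
by move=> k; rewrite meval_eigen_minor H.
Qed.

Lemma rV3_neq0 p : p != 0 -> exists2 i, (i < 3)%N & rcoefs p i != 0.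
Proof.
move=> p0; have [/existsP [i pi]|] := boolP [exists i, p 0 i != 0].
  by exists i => //; rewrite /rcoefs inord_val.
rewrite negb_exists => /forallP H; case/negP: p0; apply/eqP/rowP => i.
by rewrite mxE; apply/eqP; have := H i; rewrite negbK.
Qed.

Lemma rV3P p q : (forall i, (i < 3)%N -> rcoefs p i = rcoefs q i) -> p = q.
Proof. by move=> H; apply/rowP => i; have := H i (ltn_ord i); rewrite /rcoefs inord_val. Qed.

Lemma rcoefsZ n (c : K) (q : 'rV[K]_n.+1) i : rcoefs (c *: q) i = c * rcoefs q i.
Proof. by rewrite /rcoefs mxE. Qed.

Lemma same_point_scale (c : K) p q : p != 0 -> p = c *: q -> same_point p q.
Proof.
move=> p0 E; have c0 : c != 0 by apply: contraNneq p0 => c0; rewrite E c0 scale0r.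
by rewrite /same_point E; apply/eqmxP; apply: eqmx_scale.
Qed.

Lemma same_point_cross p q : p != 0 -> q != 0 ->
  (forall i j, (i < 3)%N -> (j < 3)%N -> rcoefs p i * rcoefs q j = rcoefs p j * rcoefs q i) ->
  same_point p q.
Proof.
move=> p0 q0 H; have [k k3 qk] := rV3_neq0 q0.
apply: (@same_point_scale (rcoefs p k / rcoefs q k)) => //; apply: rV3P => i i3.
rewrite rcoefsZ; apply: (mulIf qk).
by rewrite H //; field.
Qed.

End Bridge.

(** * From an aligned triple to an apolar vector *)

Section AlignedTriple.
Variable K : numClosedFieldType.

Lemma tri_lin2 (a n p q u v : nat -> K) (m x y z w : K) :
  (forall i, (i < 3)%N -> m * u i = x * p i + y * q i) ->
  (forall i, (i < 3)%N -> m * v i = z * p i + w * q i) ->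
  m ^+ 2 * tri a n u v =
  x * z * tri a n p p + (x * w + y * z) * tri a n p q + y * w * tri a n q q.
Proof.
move=> Hu Hv; transitivity (tri a n (fun i => m * u i) (fun i => m * v i)).
  by rewrite /tri; ring.
by rewrite /tri !Hu // !Hv //; ring.
Qed.

(** At an eigenpoint the gradient is proportional to p, hence orthogonal to n, and the polar form
    equals twice this scalar product. *)
Lemma eigen_polar (a n p : nat -> K) i :
  (forall k, (k < 3)%N -> minor a p k = 0) -> (i < 3)%N -> p i != 0 -> dot n p = 0 ->
  tri a n p p = 0.
Proof.
move=> Hm i3 pi np; rewrite tri_grad; apply: (mulIf pi); rewrite mul0r.
have m0 := Hm 0%N isT; have m1 := Hm 1%N isT; have m2 := Hm 2%N isT; rewrite /minor /grad /vec3 /= in m0 m1 m2.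
transitivity (grad a p i * dot n p *+ 2); last by rewrite np mulr0 mul0rn.
apply/eqP; rewrite -subr_eq0; apply/eqP.
case: i i3 pi => [|[|[|i]]] // _ pi.
- transitivity ((n 1%N * 0 + n 2%N * 0 : K) *+ 2); last by ring.
  by rewrite -{1}m2 -m1 /dot /grad /vec3 /=; ring.
- transitivity ((- n 0%N * 0 + n 2%N * 0 : K) *+ 2); last by ring.
  by rewrite -{1}m2 -m0 /dot /grad /vec3 /=; ring.
- transitivity ((- n 0%N * 0 - n 1%N * 0 : K) *+ 2); last by ring.
  by rewrite -{1}m1 -m0 /dot /grad /vec3 /=; ring.
Qed.

(** Cramer's rule in the plane orthogonal to n, where the triple product of u, p and q vanishes. *)
Lemma in_span (n p q u : nat -> K) j k : (j < 3)%N -> n j != 0 -> (k < 3)%N ->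
  dot n p = 0 -> dot n q = 0 -> dot n u = 0 ->
  forall i, (i < 3)%N ->
  cross p q k * u i = cross u q k * p i + cross p u k * q i.
Proof.
move=> j3 nj k3 np nq nu i i3.
have D : dot u (cross p q) = 0.
  apply: (mulIf nj); rewrite mul0r.
  transitivity (cross p q j * dot n u + cross q u j * dot n p + cross u p j * dot n q).
    by case: j j3 {nj} => [|[|[|j]]] // _; rewrite /dot /cross /=; ring.
  by rewrite np nq nu !mulr0 !addr0.
apply/eqP; rewrite -subr_eq0; apply/eqP.
transitivity ((i == k)%:R * dot u (cross p q)); last by rewrite D mulr0.
by case: i i3 => [|[|[|i]]] // _; case: k k3 => [|[|[|k]]] // _; rewrite /dot /cross /=; ring.
Qed.

Lemma cross_neq0 (p q : 'rV[K]_3) : p != 0 -> q != 0 -> ~ same_point p q ->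
  exists2 k, (k < 3)%N & cross (rcoefs p) (rcoefs q) k != 0.
Proof.
move=> p0 q0 npq.
have [/existsP [k ck]|] := boolP [exists k : 'I_3, cross (rcoefs p) (rcoefs q) k != 0].
  by exists k.
rewrite negb_exists => /forallP c0; case: npq; apply: same_point_cross => //.
have := c0 (inord 0); have := c0 (inord 1); have := c0 (inord 2).
rewrite !inordK // !negbK /cross /= !subr_eq0 => /eqP E2 /eqP E1 /eqP E0 i j i3 j3.
by case: i i3 => [|[|[|i]]] // _; case: j j3 => [|[|[|j]]] // _.
Qed.

(** The third point is a combination of p and q with both coefficients nonzero, since it differs
    from each. A quadratic form vanishing at p and q has at this point twice the product of the
    coefficients times its mixed value, so the mixed value vanishes too. *)
Lemma aligned_apolar (v : 'rV[K]_10) : has_aligned_triple (cubic v) ->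
  exists n, apolar (rcoefs v) n.
Proof.
move=> [p [q [r [[/eigenpointsP [p0 Hp] /eigenpointsP [q0 Hq] /eigenpointsP [r0 Hr]]
  [npq npr nqr [l [l0 pl ql rl]]]]]]].
pose n i := l (inord i) 0.
have dn (x : 'rV[K]_3) : x *m l = 0 -> dot n (rcoefs x) = 0.
  move/matrixP/(_ 0 0); rewrite !mxE !big_ord_recl big_ord0 addr0 => E.
  rewrite -[RHS]E /dot /n /rcoefs addrA.
  by do 2?[congr (_ + _)]; rewrite mulrC; congr (_ * _); congr (_ _ _);
    apply/val_inj; rewrite /= inordK.
have [j j3 nj] : exists2 j, (j < 3)%N & n j != 0.
  have [/existsP [i li]|] := boolP [exists i, l i 0 != 0].
    by exists i => //; rewrite /n inord_val.
  rewrite negb_exists => /forallP H; case/negP: l0; apply/eqP/colP => i.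
  by rewrite mxE; apply/eqP; have := H i; rewrite negbK.
exists n; split; first by exists j.
have [k k3 mk] := cross_neq0 p0 q0 npq.
have dp := dn _ pl; have dq := dn _ ql; have dr := dn _ rl.
have [ip ip3 pi] := rV3_neq0 p0; have [iq iq3 qi] := rV3_neq0 q0.
have [ir ir3 ri] := rV3_neq0 r0.
have Tp := eigen_polar Hp ip3 pi dp; have Tq := eigen_polar Hq iq3 qi dq.
have Tr := eigen_polar Hr ir3 ri dr.
have Sr := in_span j3 nj k3 dp dq dr.
have ar : cross (rcoefs r) (rcoefs q) k != 0.
  apply/eqP => a0; apply: nqr.
  have E i : (i < 3)%N -> rcoefs r i =
      cross (rcoefs p) (rcoefs r) k / cross (rcoefs p) (rcoefs q) k * rcoefs q i.
    by move=> i3; apply: (mulfI mk); rewrite Sr // a0 mul0r add0r; field.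
  rewrite /same_point; apply/eqmxP; apply: eqmx_sym; apply/eqmxP.
  by apply: (same_point_scale r0); apply: rV3P => i i3; rewrite rcoefsZ E.
have br : cross (rcoefs p) (rcoefs r) k != 0.
  apply/eqP => b0; apply: npr.
  have E i : (i < 3)%N -> rcoefs r i =
      cross (rcoefs r) (rcoefs q) k / cross (rcoefs p) (rcoefs q) k * rcoefs p i.
    by move=> i3; apply: (mulfI mk); rewrite Sr // b0 mul0r addr0; field.
  rewrite /same_point; apply/eqmxP; apply: eqmx_sym; apply/eqmxP.
  by apply: (same_point_scale r0); apply: rV3P => i i3; rewrite rcoefsZ E.
have Tpq : tri (rcoefs v) n (rcoefs p) (rcoefs q) = 0.
  have := tri_lin2 (rcoefs v) n Sr Sr; rewrite Tp Tq Tr !mulr0 add0r addr0 => /esym/eqP.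
  rewrite mulf_eq0 [X in X + _]mulrC -mulr2n mulrn_eq0 /= mulf_eq0.
  by rewrite (negPf ar) (negPf br) => /eqP.
move=> x y dx dy; apply: (mulfI (expf_neq0 2 mk)); rewrite mulr0.
rewrite (tri_lin2 _ _ (in_span j3 nj k3 dp dq dx) (in_span j3 nj k3 dp dq dy)).
by rewrite Tp Tq Tpq !mulr0 !addr0.
Qed.

End AlignedTriple.

(** * A criterion for radical ideals *)

Section IdealCriterion.
Variables (n : nat) (K : fieldType).
Implicit Types (J : {mpoly K[n]} -> Prop) (p q c h : {mpoly K[n]}) (x : 'I_n -> K).

Definition ideal J : Prop :=
  [/\ J 0, forall p q, J p -> J q -> J (p + q) & forall c p, J p -> J (c * p)].

Definition adjoin J t : {mpoly K[n]} -> Prop := fun p => exists c q, J q /\ p = q + c * t.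

Lemma ideal_adjoin J t : ideal J -> ideal (adjoin J t).
Proof.
case=> J0 JD JM; split.
- by exists 0, 0; rewrite mul0r addr0.
- move=> _ _ [c [q [Jq ->]]] [c' [q' [Jq' ->]]]; exists (c + c'), (q + q').
  by split; [apply: JD|ring].
- move=> c _ [c' [q [Jq ->]]]; exists (c * c'), (c * q).
  by split; [apply: JM|ring].
Qed.

Lemma adjoin_sub J t p : J p -> adjoin J t p.
Proof. by move=> Jp; exists 0, p; rewrite mul0r addr0. Qed.

Lemma adjoin_gen J t : ideal J -> adjoin J t t.
Proof. by case=> J0 _ _; exists 1, 0; rewrite mul1r add0r. Qed.

Lemma ideal_sub J p q : ideal J -> J p -> J q -> J (p - q).
Proof. by case=> _ JD JM Jp Jq; rewrite -mulN1r; apply: JD => //; apply: JM. Qed.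

Lemma ideal_unscale J (c : K) p : ideal J -> c != 0 -> J (c%:MP * p) -> J p.
Proof.
case=> _ _ JM c0 /(JM (c^-1)%:MP); rewrite mulrA -mpolyCM mulVf //.
by rewrite mpolyC1 mul1r.
Qed.

Lemma proper_factor J (r : seq {mpoly K[n]}) : ideal J -> ~ J 1 -> J (\prod_(t <- r) t) ->
  exists2 t, t \in r & ~ adjoin J t 1.
Proof.
move=> iJ J1; elim: r => [|t r IHr]; first by rewrite big_nil.
rewrite big_cons => Jtr; have [[c [q [Jq E]]]|] := EM (adjoin J t 1); last first.
  by exists t; rewrite ?mem_head.
have [|u ur Hu] := IHr; last by exists u; rewrite ?inE ?ur ?orbT.
case: iJ => _ JD JM; set P := \prod_(t <- r) t in Jtr *.
have -> : P = P * q + c * (t * P).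
  by rewrite -[LHS]mul1r [in LHS]E mulrDl mulrA [P * q]mulrC.
by apply: JD; apply: JM.
Qed.

Lemma taylor1 h x : exists e : 'I_n -> {mpoly K[n]},
  h = (h.@[x])%:MP + \sum_j e j * ('X_j - (x j)%:MP) /\
  forall j, (e j).@[x] = h^`M(j).@[x].
Proof.
elim/mpoly_alg_ind: h => [c|i|p q [e [Ep Ee]] [e' [Eq Ee']]|p q [e [Ep Ee]] [e' [Eq Ee']]].
- exists (fun=> 0); split=> [|j]; last by rewrite mderivC meval0.
  by rewrite mevalC big1 ?addr0 // => j _; rewrite mul0r.
- exists (fun j => (i == j)%:R); split=> [|j].
    rewrite mevalXU (bigD1 i) //= eqxx mul1r big1 ?addr0 => [|j ji].
      by rewrite addrC subrK.
    by rewrite eq_sym (negPf ji) mul0r.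
  rewrite mderivX mnm1E rmorph_nat.
  have [->|_] := eqVneq i j; last by rewrite scale0r meval0.
  have -> : (U_(j) - U_(j))%MM = 0%MM :> 'X_{1..n} by rewrite -{1}[U_(j)%MM]add0m addmK.
  by rewrite mpolyX0 scale1r meval1.
- exists (fun j => e j + e' j); split=> [|j]; last by rewrite mderivD !mevalD Ee Ee'.
  under eq_bigr => j _ do rewrite mulrDl.
  by rewrite big_split /= mevalD rmorphD /= {1}Ep {1}Eq; ring.
- exists (fun j => e j * q + (p.@[x])%:MP * e' j); split=> [|j]; last first.
    by rewrite mderivM !mevalD !mevalM mevalC Ee Ee'.
  under eq_bigr => j _ do rewrite mulrDl mulrAC -[_%:MP * _ * _]mulrA.
  rewrite big_split /= -mulr_suml -mulr_sumr mevalM rmorphM /=.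
  move: Ep Eq; set A := \sum_j e j * _; set B := \sum_j e' j * _ => Ep Eq.
  by rewrite {1}Ep mulrDl {1}Eq; ring.
Qed.

Section Generated.
Variable gs : seq {mpoly K[n]}.

(** For three variables this is convertible to [in_ideal]. *)
Definition gen_ideal p : Prop :=
  exists c : 'I_(size gs) -> {mpoly K[n]}, p = \sum_(i < size gs) c i * gs`_i.

Lemma ideal_gen : ideal gen_ideal.
Proof.
split.
- by exists (fun=> 0); rewrite big1 // => i _; rewrite mul0r.
- move=> _ _ [c ->] [c' ->]; exists (fun i => c i + c' i).
  by rewrite -big_split; apply: eq_bigr => i _; rewrite mulrDl.
- move=> c _ [c' ->]; exists (fun i => c * c' i).
  by rewrite mulr_sumr; apply: eq_bigr => i _; rewrite mulrA.
Qed.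

Lemma mem_gen_ideal p : p \in gs -> gen_ideal p.
Proof.
rewrite -index_mem => lt; exists (fun i => (i == Ordinal lt)%:R).
rewrite (bigD1 (Ordinal lt)) //= eqxx mul1r nth_index -?index_mem // big1 ?addr0 // => i ne.
by rewrite (negPf ne) mul0r.
Qed.

Lemma gen_ideal_min J : ideal J -> (forall p, p \in gs -> J p) -> forall p, gen_ideal p -> J p.
Proof.
case=> J0 JD JM Jg _ [c ->]; elim/big_ind: _ => // i _.
by apply: JM; apply: Jg; apply: mem_nth.
Qed.

(** In the local ring at x the given polynomials generate the maximal ideal. Written as combinations
    of the X_j - x_j, they have a coefficient matrix that is the Jacobian at x; a left inverse makes
    it a square matrix [H] equal to the identity at x, and Cramer's rule yields c = det H. *)
Lemma jacobian_local_generators x :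
  (forall p, p \in gs -> p.@[x] = 0) ->
  (forall w : 'I_n -> K,
     (forall p, p \in gs -> \sum_j p^`M(j).@[x] * w j = 0) -> forall j, w j = 0) ->
  exists c, c.@[x] != 0 /\ forall j, gen_ideal (c * ('X_j - (x j)%:MP)).
Proof.
move=> gx Hw; pose m := size gs.
have /choice [e He] (i : 'I_m) : exists e : 'I_n -> {mpoly K[n]},
    gs`_i = \sum_j e j * ('X_j - (x j)%:MP) /\ forall j, (e j).@[x] = (gs`_i)^`M(j).@[x].
  have [e [E1 E2]] := taylor1 gs`_i x; exists e; split=> //.
  by rewrite {1}E1 gx ?mem_nth // mpolyC0 add0r.
pose G : 'M[K]_(m, n) := \matrix_(i, j) (e i j).@[x].
have /row_fullP [B BG] : row_full G.
  rewrite -cokermx_eq0; apply/eqP/matrixP => j l; rewrite [RHS]mxE; move: j.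
  apply: (Hw (fun j => cokermx G j l)) => p pgs; move: (pgs); rewrite -index_mem => lt.
  have /matrixP/(_ (Ordinal lt) l) := mulmx_coker G; rewrite mxE [RHS]mxE => E.
  rewrite -[RHS]E; apply: eq_bigr => k _; congr (_ * _).
  by rewrite [RHS]mxE (He (Ordinal lt)).2 /= nth_index.
pose H : 'M[{mpoly K[n]}]_n := \matrix_(j, l) \sum_(i < m) (B j i)%:MP * e i l.
have H1 : map_mx (meval x) H = 1%:M.
  rewrite -BG; apply/matrixP => j l; rewrite !mxE rmorph_sum; apply: eq_bigr => i _.
  by rewrite rmorphM /= mevalC !mxE.
have [J0 JD JM] := ideal_gen.
have Jsum (I : finType) (F : I -> {mpoly K[n]}) : (forall i, gen_ideal (F i)) ->
  gen_ideal (\sum_i F i) by move=> HF; elim/big_ind: _.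
have JH j : gen_ideal (\sum_l H j l * ('X_l - (x l)%:MP)).
  under eq_bigr => l _ do rewrite mxE mulr_suml.
  rewrite exchange_big; apply: Jsum => i /=.
  under eq_bigr => l _ do rewrite -mulrA.
  by rewrite -mulr_sumr -(He i).1; apply: JM; apply: mem_gen_ideal; apply: mem_nth.
exists (\det H); split; first by rewrite -det_map_mx H1 det1 oner_neq0.
move=> j; have -> : \det H * ('X_j - (x j)%:MP) =
    \sum_k (\adj H) j k * \sum_l H k l * ('X_l - (x l)%:MP).
  under eq_bigr => k _ do rewrite mulr_sumr.
  rewrite exchange_big (bigD1 j) //= [X in _ = _ + X]big1 => [|l lj].
    under eq_bigr => k _ do rewrite mulrA.
    rewrite -mulr_suml addr0; congr (_ * _).
    by have /matrixP/(_ j j) := mul_adj_mx H; rewrite !mxE eqxx mulr1n => <-.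
  under eq_bigr => k _ do rewrite mulrA.
  rewrite -mulr_suml; have /matrixP/(_ j l) := mul_adj_mx H.
  by rewrite !mxE eq_sym (negPf lj) mulr0n => ->; rewrite mul0r.
by apply: Jsum => k; apply: JM.
Qed.

(* The first hypothesis is applied to the colon ideal ((gs) : h). *)
Lemma radical_criterion :
  (forall J, ideal J -> ~ J 1 -> (forall p, p \in gs -> J p) ->
     exists x, forall p, J p -> p.@[x] = 0) ->
  (forall x, (forall p, p \in gs -> p.@[x] = 0) -> forall w : 'I_n -> K,
     (forall p, p \in gs -> \sum_j p^`M(j).@[x] * w j = 0) -> forall j, w j = 0) ->
  forall h m, gen_ideal (h ^+ m) -> gen_ideal h.
Proof.
move=> Hnull Hjac h m Hh; have [J0 JD JM] := ideal_gen.
pose J c := gen_ideal (c * h); suff : J 1 by rewrite /J mul1r.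
apply: contrapT => J1; have [|//||x Jx] := Hnull J.
- split; rewrite /J; first by rewrite mul0r.
  + by move=> p q Hp Hq; rewrite mulrDl; apply: JD.
  + by move=> c p Hp; rewrite -mulrA; apply: JM.
- by move=> p pgs; rewrite /J mulrC; apply: JM; apply: mem_gen_ideal.
have gx p : p \in gs -> p.@[x] = 0.
  by move=> pgs; apply: Jx; rewrite /J mulrC; apply: JM; apply: mem_gen_ideal.
have hx : h.@[x] = 0.
  have : (h ^+ m).@[x] = 0.
    apply: (gen_ideal_min (J := fun p => p.@[x] = 0)) Hh => //; split.
    - exact: meval0.
    - by move=> p q Hp Hq; rewrite mevalD Hp Hq addr0.
    - by move=> c p Hp; rewrite mevalM Hp mulr0.
  by rewrite rmorphXn /= => /eqP; rewrite expf_eq0 => /andP [_ /eqP].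
have [c [cx Hc]] := jacobian_local_generators gx (Hjac x gx).
case/negP: cx; apply/eqP; apply: Jx; rewrite /J.
have [e [-> _]] := taylor1 h x; rewrite hx mpolyC0 add0r mulr_sumr.
elim/big_ind: _ => // j _; rewrite mulrCA; exact: JM.
Qed.

End Generated.
End IdealCriterion.

(** * Dimension of finite sets of points *)

Section FiniteCone.
Variables (K : numFieldType) (n : nat).
Implicit Types (X : set 'rV[K]_n.+1) (p q : 'rV[K]_n.+1).

Lemma mevalZ_homog d (G : {mpoly K[n.+1]}) (c : K) (p q : 'rV[K]_n.+1) :
  G \is d.-homog -> p = c *: q -> G.@[p 0] = c ^+ d * G.@[q 0].
Proof.
move=> /dhomogP Gd ->; rewrite !mevalE mulr_sumr !big_seq; apply: eq_bigr => m /Gd /= <-.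
under eq_bigr => i _ do rewrite mxE exprMn.
by rewrite big_split /= prodrXr -mdegE mulrCA.
Qed.

Variables (X : set 'rV[K]_n.+1) (D : seq 'rV[K]_n.+1).
Hypothesis X_D : forall p, X p -> exists c q, [/\ q \in D, X q & p = c *: q].
Hypothesis D_X : forall q, q \in D -> X q.
Hypothesis X_neq0 : forall q, X q -> q != 0.

Local Notation N := (size D).

Definition eval_at_points d (G : dhomog n.+1 K d) : 'rV[K]_N :=
  \row_(i < N) (G : {mpoly K[n.+1]}).@[D`_i 0].

Lemma eval_at_points_is_linear d : linear (@eval_at_points d).
Proof. by move=> c G H; apply/rowP => i; rewrite !mxE /= mevalD mevalZ. Qed.

HB.instance Definition _ d :=
  GRing.isLinear.Build K (dhomog n.+1 K d) 'rV[K]_N _ (@eval_at_points d)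
    (@eval_at_points_is_linear d).

Lemma lker_eval_at_points d (G : dhomog n.+1 K d) :
  G \in lker (linfun (@eval_at_points d)) <->
  forall q, X q -> (G : {mpoly K[n.+1]}).@[q 0] = 0.
Proof.
rewrite memv_ker lfunE; split=> [/eqP/rowP H q /X_D [c [r [rD _ E]]]|H].
  rewrite (mevalZ_homog (dhomog_is_dhomog G) E).
  move: (rD); rewrite -index_mem => lt; have := H (Ordinal lt).
  by rewrite !mxE nth_index //= => ->; rewrite mulr0.
by apply/eqP/rowP => i; rewrite !mxE H //; apply: D_X; apply: mem_nth.
Qed.

Definition point_rank d : nat := \dim (limg (linfun (@eval_at_points d))).

Lemma hilbert_value_point_rank d : hilbert_value X d (point_rank d).
Proof.
exists (lker (linfun (@eval_at_points d))); split; first exact: lker_eval_at_points.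
by rewrite -(limg_ker_dim (linfun (@eval_at_points d)) fullv) capfv addKn.
Qed.

Lemma point_rank_le d : (point_rank d <= N)%N.
Proof.
apply: leq_trans (dimvS (subvf _)) _; by rewrite dimvf /= /dim /= mul1n.
Qed.

Lemma point_rank0 : D != [::] -> (0 < point_rank 0)%N.
Proof.
move=> Dn0; rewrite lt0n dimv_eq0; apply/eqP => E.
have H1 : (1 : {mpoly K[n.+1]}) \is 0.-homog by apply: dhomog1.
have : linfun (@eval_at_points 0) (DHomog H1) \in limg (linfun (@eval_at_points 0)).
  by apply: memv_img; apply: memvf.
rewrite E memv0 lfunE => /eqP/rowP.
have lt : (0 < N)%N by rewrite lt0n size_eq0.
by move/(_ (Ordinal lt)); rewrite !mxE /= meval1 => /eqP; rewrite oner_eq0.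
Qed.

(** With coefficients t^i on the moment curve, the value at each point is a nonzero polynomial in t;
    a t outside the roots of their product serves all points at once. *)
Lemma separating_form : exists l : 'I_n.+1 -> K,
  forall q, q \in D -> \sum_i l i * q 0 i != 0.
Proof.
pose P (q : 'rV[K]_n.+1) : {poly K} := \poly_(i < n.+1) q 0 (inord i).
have P0 q : q \in D -> P q != 0.
  move=> /D_X/X_neq0; apply: contraNneq => Pq; apply/eqP/rowP => i.
  have := congr1 (fun p : {poly K} => p`_i) Pq.
  by rewrite coef_poly ltn_ord inord_val coef0 mxE.
pose Q : {poly K} := \prod_(q <- D) P q.
have Qn0 : Q != 0 by rewrite prodf_seq_neq0; apply/allP => q /P0.
have [t Qt] : exists t, Q.[t] != 0.
  apply: contrapT => H; case/negP: Qn0; apply/eqP/poly_eq0_val => t.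
  by apply/eqP/negPn/negP => Ht; apply: H; exists t.
exists (fun i => t ^+ i) => q qD; move: Qt.
rewrite horner_prod prodf_seq_neq0 => /allP /(_ q qD) /=.
suff -> : \sum_(i < n.+1) t ^+ i * q 0 i = (P q).[t] by [].
by rewrite /P horner_poly; apply: eq_bigr => i _; rewrite inord_val mulrC.
Qed.

(** Multiplication by a linear form without zeros among the points acts on the values by an
    invertible diagonal matrix. *)
Lemma point_rank_leS d : (point_rank d <= point_rank d.+1)%N.
Proof.
have [l Hl] := separating_form.
pose L : {mpoly K[n.+1]} := \sum_i l i *: 'X_i.
have L1 : L \is 1.-homog.
  by apply: rpred_sum => i _; apply: rpredZ; rewrite dhomogX /= mdeg1.
pose M : 'M[K]_N := diag_mx (\row_i L.@[D`_i 0]).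
have Mu : M \in unitmx.
  rewrite unitmxE det_diag unitfE prodf_seq_neq0; apply/allP => i _ /=.
  rewrite mxE /L rmorph_sum /=; under eq_bigr => j _ do rewrite mevalZ mevalXU.
  by apply: Hl; apply: mem_nth.
pose m : 'End('rV[K]_N) := linfun (mulmxr M).
have mi : lker m == 0%VS.
  apply/lker0P => u v; rewrite !lfunE /= => /(congr1 (mulmx^~ (invmx M))).
  by rewrite !mulmxK.
rewrite /point_rank -(limg_dim_eq (f := m)); last by rewrite (eqP mi) capv0.
apply: dimvS; apply/subvP => _ /memv_imgP [_ /memv_imgP [G _ ->] ->].
have HL : L * (G : {mpoly K[n.+1]}) \is d.+1.-homog.
  by apply: (@dhomogM _ _ _ 1) => //; apply: dhomog_is_dhomog.
apply/memv_imgP; exists (DHomog HL); rewrite ?memvf // !lfunE /=.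
apply/rowP => i; rewrite mul_mx_diag !mxE mevalM /=.
by rewrite mulrC.
Qed.

Lemma nondecreasing_bounded_stable (f : nat -> nat) B :
  (forall d, f d <= f d.+1)%N -> (forall d, f d <= B)%N ->
  exists d0, forall d, (d0 <= d)%N -> f d = f d0.
Proof.
move=> fS fB.
have fle d e : (d <= e)%N -> (f d <= f e)%N.
  by move=> /subnKC <-; elim: (e - d)%N => [|k IHk]; rewrite ?addn0 // addnS (leq_trans IHk).
have [k] := ubnP (B - f 0)%N; move: 0%N => d0; elim: k d0 => // k IHk d0 Hk.
have [[d [le ne]]|] := EM (exists d, (d0 <= d)%N /\ f d <> f d0).
  apply: (IHk d); have := fle _ _ le; have := fB d; move: Hk ne; lia.
by move=> H; exists d0 => d le; apply: contrapT => ne; apply: H; exists d.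
Qed.

(** The Hilbert function is the rank of evaluation at the points: nondecreasing, bounded by the
    length of [D] and positive in degree 0, hence eventually a nonzero constant. *)
Lemma projective_dim0_finite : D != [::] -> projective_dim X 0.
Proof.
move=> Dn0; have [d0 Hd0] := nondecreasing_bounded_stable point_rank_leS point_rank_le.
exists ((point_rank d0)%:R)%:P; split.
  exists d0 => d le; exists (point_rank d); split; first exact: hilbert_value_point_rank.
  by rewrite hornerC Hd0.
rewrite size_polyC pnatr_eq0 -lt0n (leq_trans (point_rank0 Dn0)) //.
by elim: (d0) => // d IHd; apply: leq_trans IHd (point_rank_leS d).
Qed.

End FiniteCone.

(** * Eigenschemes of the slice cubics *)

Section BinaryForms.
Variable K : closedFieldType.

(** The homogenisation of p in degree n, evaluated in [A]. With [A] free, one factorisation serves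
    for points and, with the coordinates as arguments, for ideals of polynomials. *)
Definition bform (A : comNzRingType) (f : K -> A) n (p : {poly K}) (s t : A) : A :=
  \sum_(i < n.+1) f p`_i * s ^+ i * t ^+ (n - i).

Lemma bform_XsubC (A : comNzRingType) (f : {rmorphism K -> A}) n (q : {poly K}) x s t :
  (size q <= n.+1)%N ->
  bform f n.+1 (('X - x%:P) * q) s t = (s - f x * t) * bform f n q s t.
Proof.
move=> sq; transitivity (s * bform f n q s t - f x * t * bform f n q s t); last by ring.
transitivity (bform f n.+1 ('X * q) s t - bform f n.+1 (x%:P * q) s t).
  rewrite /bform -sumrB; apply: eq_bigr => i _.
  by rewrite mulrBl coefB rmorphB !mulrBl.
congr (_ - _); rewrite /bform mulr_sumr.
  rewrite big_ord_recl coefXM /= rmorph0 !mul0r add0r; apply: eq_bigr => i _.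
  by rewrite coefXM /= subSS exprS; ring.
rewrite big_ord_recr coefCM /= [q`_n.+1]nth_default // mulr0 rmorph0 !mul0r addr0.
apply: eq_bigr => i _; rewrite coefCM rmorphM subSn ?exprS; first by ring.
by rewrite -ltnS.
Qed.

Lemma bform_prod (A : comNzRingType) (f : {rmorphism K -> A}) c (rs : seq K) s t :
  bform f (size rs) (c *: \prod_(x <- rs) ('X - x%:P)) s t =
  f c * \prod_(x <- rs) (s - f x * t).
Proof.
elim: rs => [|x rs IHrs].
  by rewrite /bform !big_nil big_ord_recl big_ord0 coefZ coef1 /= !mulr1 addr0.
rewrite !big_cons /= scalerAr bform_XsubC ?IHrs; first by ring.
by apply: leq_trans (size_scale_leq _ _) _; rewrite size_prod_XsubC.
Qed.

Lemma bform_split n (p : {poly K}) : size p = n.+1 -> exists rs : seq K,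
  [/\ size rs = n, p = lead_coef p *: \prod_(x <- rs) ('X - x%:P) &
   forall (A : comNzRingType) (f : {rmorphism K -> A}) s t,
     bform f n p s t = f (lead_coef p) * \prod_(x <- rs) (s - f x * t)].
Proof.
move=> sp; have [rs E] := closed_field_poly_normal p.
have srs : size rs = n.
  have := congr1 (fun p : {poly K} => size p) E.
  rewrite size_scale ?lead_coef_eq0 -?size_poly_eq0 ?sp // size_prod_XsubC.
  by case.
exists rs; split=> // A f s t; have <- := bform_prod f (lead_coef p) rs s t.
by rewrite srs -E.
Qed.

End BinaryForms.

(** * Elimination between two conics *)

Section Conics.
Variable A : comNzRingType.
Implicit Types (q r u a : nat -> A).

Definition conic_ev q u : A :=
  q 0%N * u 0%N ^+ 2 + q 1%N * (u 0%N * u 1%N) + q 2%N * (u 0%N * u 2%N)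
  + q 3%N * u 1%N ^+ 2 + q 4%N * (u 1%N * u 2%N) + q 5%N * u 2%N ^+ 2.

Definition conic_grad q u : nat -> A := vec3
  (q 0%N * u 0%N *+ 2 + q 1%N * u 1%N + q 2%N * u 2%N)
  (q 1%N * u 0%N + q 3%N * u 1%N *+ 2 + q 4%N * u 2%N)
  (q 2%N * u 0%N + q 4%N * u 1%N + q 5%N * u 2%N *+ 2).

(* The coefficients at x^(4-k) z^k of the resultant of two conics with respect to y. *)
Definition conic_res q r : nat -> A :=
  let al := q 3%N * r 1%N - q 1%N * r 3%N in
  let be := q 3%N * r 4%N - q 4%N * r 3%N in
  let ga := q 3%N * r 0%N - q 0%N * r 3%N in
  let de := q 3%N * r 2%N - q 2%N * r 3%N in
  let ep := q 3%N * r 5%N - q 5%N * r 3%N in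
  let r0 := q 1%N * r 0%N - q 0%N * r 1%N in
  let r1 := q 1%N * r 2%N + q 4%N * r 0%N - q 0%N * r 4%N - q 2%N * r 1%N in
  let r2 := q 1%N * r 5%N + q 4%N * r 2%N - q 2%N * r 4%N - q 5%N * r 1%N in
  let r3 := q 4%N * r 5%N - q 5%N * r 4%N in
  vec6 (ga ^+ 2 - al * r0) (ga * de *+ 2 - al * r1 - be * r0)
       (de ^+ 2 + ga * ep *+ 2 - al * r2 - be * r1) (de * ep *+ 2 - al * r3 - be * r2)
       (ep ^+ 2 - be * r3) 0.

Lemma conic_res_comb q r u : exists s t,
  conic_res q r 0%N * u 0%N ^+ 4 + conic_res q r 1%N * (u 0%N ^+ 3 * u 2%N)
  + conic_res q r 2%N * (u 0%N ^+ 2 * u 2%N ^+ 2) + conic_res q r 3%N * (u 0%N * u 2%N ^+ 3)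
  + conic_res q r 4%N * u 2%N ^+ 4 = s * conic_ev q u + t * conic_ev r u.
Proof.
pose a1 := q 1%N * u 0%N + q 4%N * u 2%N.
pose a2 := q 0%N * u 0%N ^+ 2 + q 2%N * (u 0%N * u 2%N) + q 5%N * u 2%N ^+ 2.
pose b1 := r 1%N * u 0%N + r 4%N * u 2%N.
pose b2 := r 0%N * u 0%N ^+ 2 + r 2%N * (u 0%N * u 2%N) + r 5%N * u 2%N ^+ 2.
pose p := q 3%N * b1 - a1 * r 3%N; pose k := q 3%N * b2 - a2 * r 3%N.
(* With y = u_1, the combination q_3 r - r_3 q equals p y + k, and (r_3 y + b1) q - (q_3 y + a1) r
   is also linear in y, with leading coefficient -k. Multiplying by k and p respectively and adding
   cancels y. *)
exists (- k * r 3%N + p * (r 3%N * u 1%N + b1)), (k * q 3%N - p * (q 3%N * u 1%N + a1)).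
by rewrite /conic_res /conic_ev /k /p /a1 /a2 /b1 /b2 /=; ring.
Qed.

(** Exchanging x and y lets [conic_res] eliminate x as well. *)
Definition conic_swap q : nat -> A := vec6 (q 3%N) (q 1%N) (q 4%N) (q 0%N) (q 2%N) (q 5%N).

Lemma conic_ev_swap q u : conic_ev (conic_swap q) u = conic_ev q (vec3 (u 1%N) (u 0%N) (u 2%N)).
Proof. by rewrite /conic_ev /=; ring. Qed.

Definition line_cubic a : nat -> A :=
  vec6 (a 1%N) (a 3%N *+ 2 - a 0%N *+ 3) (a 6%N *+ 3 - a 1%N *+ 2) (- a 3%N) 0 0.

Lemma minor_slice a u : slice a ->
  [/\ minor a u 0%N = u 2%N * conic_ev (conic1 a) u,
      minor a u 1%N = u 2%N * conic_ev (conic2 a) u &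
      minor a u 2%N = line_cubic a 0%N * u 0%N ^+ 3 + line_cubic a 1%N * (u 0%N ^+ 2 * u 1%N)
        + line_cubic a 2%N * (u 0%N * u 1%N ^+ 2) + line_cubic a 3%N * u 1%N ^+ 3
        + u 2%N ^+ 2 * (a 8%N * u 0%N - a 5%N * u 1%N)].
Proof.
case=> a2 a4 a7.
by split; rewrite /minor /grad /conic_ev /conic1 /conic2 /line_cubic /= a2 a4 a7; ring.
Qed.

(** Setting z = 0 in the resultant gives the resultant of the restrictions to z = 0; on a good slice
    it therefore has full degree, and z is not among its linear factors. *)
Lemma conic_res_lead a :
  conic_res (conic1 a) (conic2 a) 0%N = line_res a /\
  conic_res (conic_swap (conic1 a)) (conic_swap (conic2 a)) 0%N = line_res a.
Proof. by split; rewrite /conic_res /line_res /quad_res /=; ring. Qed.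

End Conics.

Section Discriminants.
Variable K : numFieldType.
Implicit Types (q r u w : nat -> K).

Lemma cubic_disc_eq0 (d0 d1 d2 d3 s t : K) : (s, t) != (0, 0) ->
  d0 * s ^+ 2 *+ 3 + d1 * (s * t) *+ 2 + d2 * t ^+ 2 = 0 ->
  d1 * s ^+ 2 + d2 * (s * t) *+ 2 + d3 * t ^+ 2 *+ 3 = 0 ->
  cubic_disc d0 d1 d2 d3 = 0.
Proof.
move=> st Hs Ht; have [t0|t0] := eqVneq t 0.
  have s0 : s != 0 by apply: contraNneq st => ->; rewrite t0.
  have /eqP : d0 * s ^+ 2 *+ 3 = 0 by rewrite -[RHS]Hs t0; ring.
  rewrite mulrn_eq0 /= mulf_eq0 expf_eq0 (negPf s0) orbF => /eqP ->.
  have /eqP : d1 * s ^+ 2 = 0 by rewrite -[RHS]Ht t0; ring.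
  rewrite mulf_eq0 expf_eq0 (negPf s0) orbF => /eqP ->.
  by rewrite /cubic_disc; ring.
pose x := s / t.
have E2 : d2 = - (d0 * x ^+ 2 *+ 3 + d1 * x *+ 2).
  by apply: (mulIf (expf_neq0 2 t0)); apply/eqP; rewrite -subr_eq0 -Hs; apply/eqP; rewrite /x; field.
have E3 : d3 = d0 * x ^+ 3 *+ 2 + d1 * x ^+ 2.
  have n3 : 3%:R != 0 :> K by rewrite pnatr_eq0.
  apply: (mulIf (expf_neq0 2 t0)); apply: (mulfI n3); apply/eqP; rewrite -subr_eq0 -[X in _ == X]Ht E2.
  by apply/eqP; rewrite /x; field.
by rewrite E2 E3 /cubic_disc; ring.
Qed.

Lemma quad_res_eq0 (p0 p1 p2 q0 q1 q2 x y : K) : (x, y) != (0, 0) ->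
  p0 * x ^+ 2 + p1 * (x * y) + p2 * y ^+ 2 = 0 ->
  q0 * x ^+ 2 + q1 * (x * y) + q2 * y ^+ 2 = 0 ->
  quad_res p0 p1 p2 q0 q1 q2 = 0.
Proof.
move=> xy Hp Hq; have [y0|y0] := eqVneq y 0.
  have x0 : x != 0 by apply: contraNneq xy => ->; rewrite y0.
  have /eqP : p0 * x ^+ 2 = 0 by rewrite -[RHS]Hp y0; ring.
  rewrite mulf_eq0 expf_eq0 (negPf x0) orbF => /eqP ->.
  have /eqP : q0 * x ^+ 2 = 0 by rewrite -[RHS]Hq y0; ring.
  rewrite mulf_eq0 expf_eq0 (negPf x0) orbF => /eqP ->.
  by rewrite /quad_res; ring.
have E2 : p2 = - (p0 * (x / y) ^+ 2 + p1 * (x / y)).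
  by apply: (mulIf (expf_neq0 2 y0)); apply/eqP; rewrite -subr_eq0 -Hp; apply/eqP; field.
have E2' : q2 = - (q0 * (x / y) ^+ 2 + q1 * (x / y)).
  by apply: (mulIf (expf_neq0 2 y0)); apply/eqP; rewrite -subr_eq0 -Hq; apply/eqP; field.
by rewrite E2 E2' /quad_res; ring.
Qed.

(* If the conic q is singular at u then its adjugate is a multiple of u u^T. *)
Lemma conic_polar_singular q r u : u 2%N != 0 ->
  (forall i, (i < 3)%N -> conic_grad q u i = 0) -> conic_ev r u = 0 -> conic_polar q r = 0.
Proof.
move=> u2 Hq Hr.
have H0 := Hq 0%N isT; have H1 := Hq 1%N isT; have H2 := Hq 2%N isT.
rewrite /conic_grad /= in H0 H1 H2.
have E2 : q 2%N = - (q 0%N * u 0%N *+ 2 + q 1%N * u 1%N) / u 2%N.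
  by apply: (mulIf u2); apply/eqP; rewrite -subr_eq0 -H0; apply/eqP; field.
have E4 : q 4%N = - (q 1%N * u 0%N + q 3%N * u 1%N *+ 2) / u 2%N.
  by apply: (mulIf u2); apply/eqP; rewrite -subr_eq0 -H1; apply/eqP; field.
have n2 : 2%:R != 0 :> K by rewrite pnatr_eq0.
have E5 : q 5%N = - (q 2%N * u 0%N + q 4%N * u 1%N) / (u 2%N *+ 2).
  apply: (mulIf u2); apply: (mulIf n2); apply/eqP; rewrite -subr_eq0 -H2; apply/eqP.
  by field.
apply: (mulIf (expf_neq0 2 u2)); rewrite mul0r.
transitivity ((q 0%N * q 3%N *+ 4 - q 1%N ^+ 2) * conic_ev r u); last by rewrite Hr mulr0.
by rewrite /conic_polar /conic_ev E5 E2 E4; field.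
Qed.

Lemma conic_euler q u : dot (conic_grad q u) u = conic_ev q u *+ 2.
Proof. by rewrite /dot /conic_grad /conic_ev /=; ring. Qed.

(** The member s q + t r is singular at u, where q and r vanish. Its polars with q and with r are
    the two partial derivatives of the binary cubic det(s q + t r), so this cubic has a double root
    at (s, t). *)
Lemma pencil_disc_tangent q r u s t : (s, t) != (0, 0) -> u 2%N != 0 ->
  conic_ev q u = 0 -> conic_ev r u = 0 ->
  (forall i, (i < 3)%N -> s * conic_grad q u i + t * conic_grad r u i = 0) ->
  cubic_disc (conic_det q) (conic_polar q r) (conic_polar r q) (conic_det r) = 0.
Proof.
move=> st u2 qu ru H; pose m k := s * q k + t * r k.
have Hm i : (i < 3)%N -> conic_grad m u i = 0.
  by move=> i3; rewrite -[RHS](H i i3); case: i i3 => [|[|[|i]]] // _; rewrite /conic_grad /m /=; ring.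
apply: (cubic_disc_eq0 st).
  by rewrite -(conic_polar_singular u2 Hm qu) /conic_det /conic_polar /m; ring.
by rewrite -(conic_polar_singular u2 Hm ru) /conic_det /conic_polar /m; ring.
Qed.

End Discriminants.

Section ConicMorphism.
Variables (A B : comNzRingType) (f : {rmorphism A -> B}).

Lemma rmorph_conic1 a k : f (conic1 a k) = conic1 (f \o a) k.
Proof. by case: k => [|[|[|[|[|k]]]]]; rewrite /= ?rmorph0 ?(rmorphB, rmorphN, rmorphMn). Qed.

Lemma rmorph_conic2 a k : f (conic2 a k) = conic2 (f \o a) k.
Proof. by case: k => [|[|[|[|[|k]]]]]; rewrite /= ?rmorph0 ?(rmorphB, rmorphN, rmorphMn). Qed.

Lemma rmorph_line_cubic a k : f (line_cubic a k) = line_cubic (f \o a) k.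
Proof. by case: k => [|[|[|[|[|k]]]]]; rewrite /= ?rmorph0 ?(rmorphB, rmorphN, rmorphMn). Qed.

Lemma rmorph_conic_res q r k : f (conic_res q r k) = conic_res (f \o q) (f \o r) k.
Proof.
by case: k => [|[|[|[|[|k]]]]];
  rewrite /= ?rmorph0 ?(rmorphD, rmorphN, rmorphMn, rmorphM, rmorphXn).
Qed.

End ConicMorphism.

(** * The zeros of the minors on a good slice *)

Section GoodSliceGeometry.
Variable K : numClosedFieldType.
Implicit Types (q r u w : nat -> K).

Lemma conic_res_prod (q r : nat -> K) : conic_res q r 0%N != 0 ->
  exists rs : seq K, forall (A : comNzRingType) (f : {rmorphism K -> A}) (u : nat -> A),
    exists s t, \prod_(x <- rs) (u 0%N - f x * u 2%N) =
                s * conic_ev (f \o q) u + t * conic_ev (f \o r) u.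
Proof.
set e := conic_res q r => e0; pose p := Poly [:: e 4%N; e 3%N; e 2%N; e 1%N; e 0%N].
have pE : p = [:: e 4%N; e 3%N; e 2%N; e 1%N; e 0%N] :> seq K by rewrite (@PolyK _ 0).
have lp : lead_coef p = e 0%N by rewrite lead_coefE pE.
have sp : size p = 5%N by rewrite pE.
have [rs [_ _ Hrs]] := bform_split sp.
exists rs => A f u; have [s [t E]] := conic_res_comb (f \o q) (f \o r) u.
have fe : f (e 0%N)^-1 * f (e 0%N) = 1 by rewrite -rmorphM mulVf // rmorph1.
exists (f (e 0%N)^-1 * s), (f (e 0%N)^-1 * t).
rewrite -!mulrA -mulrDr -E -!rmorph_conic_res -/e.
have := Hrs A f (u 0%N) (u 2%N); rewrite lp => H.
set P := \prod_(x <- rs) _ in H *.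
transitivity (f (e 0%N)^-1 * (f (e 0%N) * P)); first by rewrite mulrA fe mul1r.
rewrite -H; congr (_ * _).
by rewrite /bform pE !big_ord_recl big_ord0 /=; ring.
Qed.

Variable a : nat -> K.
Hypothesis a_good : good_slice a.

Lemma good_slice_neq0 : [/\ a 3%N != 0, pencil_disc a != 0, line_disc a != 0 & line_res a != 0].
Proof.
move: a_good.2; rewrite /slice_disc !mulf_eq0 !negb_or.
by move=> /andP [/andP [/andP [-> ->] ->] ->].
Qed.

(** The coefficient of y^3 is - [a 3], so there are three roots with x = 1; a double root would
    annihilate [line_disc]. *)
Lemma line_cubic_prod : exists rs : seq K, [/\ size rs = 3%N, uniq rs &
  forall (A : comNzRingType) (f : {rmorphism K -> A}) (u : nat -> A),
    let b := line_cubic (f \o a) in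
    b 0%N * u 0%N ^+ 3 + b 1%N * (u 0%N ^+ 2 * u 1%N) + b 2%N * (u 0%N * u 1%N ^+ 2)
    + b 3%N * u 1%N ^+ 3 = - f (a 3%N) * \prod_(x <- rs) (u 1%N - f x * u 0%N)].
Proof.
have [a3 _ ld _] := good_slice_neq0; pose b := line_cubic a.
pose p := Poly [:: b 0%N; b 1%N; b 2%N; b 3%N].
have pE : p = [:: b 0%N; b 1%N; b 2%N; b 3%N] :> seq K by rewrite (@PolyK _ 0) //= oppr_eq0.
have lp : lead_coef p = b 3%N by rewrite lead_coefE pE.
have sp : size p = 4%N by rewrite pE.
have [rs [srs Ep Hrs]] := bform_split sp.
exists rs; split=> //; last first.
  move=> A f u /=; have := Hrs A f (u 1%N) (u 0%N); rewrite lp /b /= rmorphN => <-.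
  by rewrite /bform pE !big_ord_recl big_ord0 /b /= !(rmorphB, rmorphN, rmorphMn); ring.
have dbl x : ~~ (('X - x%:P) ^+ 2 %| p).
  apply/negP => /dvdpP [k Ek]; case/negP: ld; apply/eqP.
  have p0 : p.[x] = 0 by rewrite Ek hornerM horner_exp hornerXsubC subrr expr0n mulr0.
  have p1 : p^`().[x] = 0.
    by rewrite Ek expr2 !derivM derivXsubC hornerD !hornerM !hornerXsubC hornerD !hornerM !hornerXsubC subrr !(mul0r, mulr0) addr0 mulr0 addr0.
  move: p0 p1; rewrite horner_Poly /= => p0.
  have -> : p^`() = Poly [:: b 1%N; b 2%N *+ 2; b 3%N *+ 3].
    apply/polyP => i; rewrite coef_deriv !coef_Poly.
    by case: i => [|[|[|[|i]]]] //=; rewrite ?mulr1n ?nth_nil ?mul0rn.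
  rewrite horner_Poly /= => p1.
  apply: (@cubic_disc_eq0 _ _ _ _ _ 1 x); first by rewrite xpair_eqE oner_eq0.
    transitivity (((((0 * x + b 3%N) * x + b 2%N) * x + b 1%N) * x + b 0%N) *+ 3
      - x * (((0 * x + b 3%N *+ 3) * x + b 2%N *+ 2) * x + b 1%N)).
      by rewrite /b /=; ring.
    by rewrite p0 p1 mul0rn mulr0 subr0.
  by rewrite -[RHS]p1 /b /=; ring.
have nd x (q : {poly K}) : p <> lead_coef p *: (('X - x%:P) ^+ 2 * q).
  by move=> E; case/negP: (dbl x); rewrite E dvdpZr ?dvdp_mulIl // lp oppr_eq0.
case: rs srs Ep {Hrs} => [|x [|y [|z []]]] // _ Ep.
rewrite /= !inE negb_or andbT -andbA.
by apply/and3P; split; apply/negP => /eqP E;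
  [apply: (@nd x ('X - z%:P))|apply: (@nd x ('X - y%:P))|apply: (@nd y ('X - x%:P))];
  rewrite {1}Ep !big_cons big_nil -E; congr (_ *: _); ring.
Qed.

Lemma conic_prod_xz : exists rs : seq K,
  forall (A : comNzRingType) (f : {rmorphism K -> A}) (u : nat -> A), exists s t,
    u 2%N * \prod_(x <- rs) (u 0%N - f x * u 2%N) =
    s * minor (f \o a) u 0%N + t * minor (f \o a) u 1%N.
Proof.
have [_ _ _ lr] := good_slice_neq0.
rewrite -(conic_res_lead a).1 in lr; have [rs H] := conic_res_prod lr.
exists rs => A f u; have [s [t ->]] := H A f u; exists s, t.
have sf : slice (f \o a) by case: a_good => -[a2 a4 a7] _; split; rewrite /= ?a2 ?a4 ?a7 rmorph0.
have [-> -> _] := minor_slice u sf.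
have E1 : f \o conic1 a = conic1 (f \o a) by apply/funext => k; rewrite /= rmorph_conic1.
have E2 : f \o conic2 a = conic2 (f \o a) by apply/funext => k; rewrite /= rmorph_conic2.
by rewrite E1 E2; ring.
Qed.

Lemma conic_prod_yz : exists rs : seq K,
  forall (A : comNzRingType) (f : {rmorphism K -> A}) (u : nat -> A), exists s t,
    u 2%N * \prod_(x <- rs) (u 1%N - f x * u 2%N) =
    s * minor (f \o a) u 0%N + t * minor (f \o a) u 1%N.
Proof.
have [_ _ _ lr] := good_slice_neq0.
rewrite -(conic_res_lead a).2 in lr; have [rs H] := conic_res_prod lr.
exists rs => A f u; have [s [t E]] := H A f (vec3 (u 1%N) (u 0%N) (u 2%N)).
exists s, t; rewrite /= in E; rewrite E.
have sf : slice (f \o a) by case: a_good => -[a2 a4 a7] _; split; rewrite /= ?a2 ?a4 ?a7 rmorph0.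
have [-> -> _] := minor_slice u sf.
have E1 : f \o conic_swap (conic1 a) = conic_swap (conic1 (f \o a)).
  by apply/funext => k; case: k => [|[|[|[|[|k]]]]]; rewrite /= ?rmorph0 ?(rmorphB, rmorphN, rmorphMn).
have E2 : f \o conic_swap (conic2 a) = conic_swap (conic2 (f \o a)).
  by apply/funext => k; case: k => [|[|[|[|[|k]]]]]; rewrite /= ?rmorph0 ?(rmorphB, rmorphN, rmorphMn).
rewrite E1 E2 !conic_ev_swap /=.
have EV (q : nat -> A) : conic_ev q (vec3 (u 0%N) (u 1%N) (u 2%N)) = conic_ev q u by [].
by rewrite !EV; ring.
Qed.

(** Points with z = 0 come from the line cubic; for the others x / z and y / z are roots of the two
    resultants. The list may contain points that are not eigenpoints; only its finiteness
    matters. *)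
Lemma slice_eigen_list : exists D : seq (nat -> K),
  forall u, (forall k, (k < 3)%N -> minor a u k = 0) -> exists c d,
    (exists2 i, (i < size D)%N & d = nth (fun=> 0) D i) /\
    forall i, (i < 3)%N -> u i = c * d i.
Proof.
have [rs [_ _ H3]] := line_cubic_prod.
have [rx Hx] := conic_prod_xz; have [ry Hy] := conic_prod_yz.
have [a3 _ _ _] := good_slice_neq0.
pose D := [seq vec3 1 x 0 | x <- rs] ++ [seq vec3 x y 1 | x <- rx, y <- ry].
exists D => u Hu; have m0 := Hu 0%N isT; have m1 := Hu 1%N isT; have m2 := Hu 2%N isT.
have [u2|u2] := eqVneq (u 2%N) 0.
  have [_ _ E] := minor_slice u a_good.1; rewrite E u2 expr0n mul0r addr0 in m2.
  move: m2; have /= -> := H3 K idfun u => /eqP.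
  rewrite mulf_eq0 oppr_eq0 (negPf a3) prodf_seq_eq0 => /hasP [x xrs] /=.
  rewrite subr_eq0 => /eqP ux; exists (u 0%N), (vec3 1 x 0); split.
    move: (xrs); rewrite -index_mem => lt; exists (index x rs).
      by rewrite size_cat size_map ltn_addr.
    by rewrite nth_cat size_map lt (nth_map 0) // nth_index.
  by case=> [|[|[|i]]] // _ /=; rewrite ?mulr1 ?mulr0 // ux mulrC.
have [s [t /esym/eqP]] := Hx K idfun u; rewrite m0 m1 !mulr0 addr0 eq_sym.
rewrite mulf_eq0 (negPf u2) prodf_seq_eq0 => /hasP [x xr] /=; rewrite subr_eq0 => /eqP ux.
have [s' [t' /esym/eqP]] := Hy K idfun u; rewrite m0 m1 !mulr0 addr0 eq_sym.
rewrite mulf_eq0 (negPf u2) prodf_seq_eq0 => /hasP [y yr] /=; rewrite subr_eq0 => /eqP uy.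
exists (u 2%N), (vec3 x y 1); split.
  pose xy := [seq (x, y) | x <- rx, y <- ry].
  have inxy : (x, y) \in xy by apply/allpairsP; exists (x, y).
  have DE : [seq vec3 x y 1 | x <- rx, y <- ry] = [seq vec3 p.1 p.2 1 | p <- xy].
    by rewrite /xy map_allpairs.
  move: (inxy); rewrite -index_mem => lt; exists (size rs + index (x, y) xy)%N.
    by rewrite size_cat size_map DE size_map ltn_add2l.
  rewrite nth_cat size_map ltnNge leq_addr /= addKn DE (nth_map (0, 0)) //.
  by rewrite nth_index.
by case=> [|[|[|i]]] // _ /=; rewrite ?mulr1 // ?ux ?uy mulrC.
Qed.

(** The chart equation is l = 1 for a general linear form, because the chart where a coordinate
    equals 1 becomes such an equation after a similitude. *)
Definition slice_gens (l : nat -> K) : seq {mpoly K[3]} :=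
  (dot (fun i => (l i)%:MP) (mX K) - 1) ::
  [seq minor (fun i => (a i)%:MP) (mX K) k | k <- iota 0 3].

Lemma mem_slice_gens_minor l k : (k < 3)%N ->
  minor (fun i => (a i)%:MP) (mX K) k \in slice_gens l.
Proof. by move=> k3; rewrite inE; apply/orP; right; apply: map_f; rewrite mem_iota. Qed.

(** Modulo J the vector of coordinates is w d, and l = 1 forces w (l.d) = 1. As J is proper l.d is
    nonzero, and J is contained in the ideal of the point d / (l.d). *)
Lemma ideal_point (l : nat -> K) J (d : nat -> K) (w : {mpoly K[3]}) : ideal J -> ~ J 1 ->
  J (dot (fun i => (l i)%:MP) (mX K) - 1) ->
  (forall i, (i < 3)%N -> J (mX K i - (d i)%:MP * w)) ->
  exists x : 'I_3 -> K, forall p, J p -> p.@[x] = 0.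
Proof.
move=> iJ J1 JL Jd; have [J0 JD JM] := iJ; pose c := dot l d.
have Jc : J (c%:MP * w - 1).
  have -> : c%:MP * w - 1 = dot (fun i => (l i)%:MP) (mX K) - 1
     - ((l 0%N)%:MP * (mX K 0 - (d 0%N)%:MP * w) + (l 1%N)%:MP * (mX K 1 - (d 1%N)%:MP * w)
        + (l 2%N)%:MP * (mX K 2 - (d 2%N)%:MP * w)).
    by rewrite /c /dot !rmorphD !rmorphM /=; ring.
  apply: ideal_sub => //; apply: (JD); first apply: (JD); apply: JM; exact: Jd.
have c0 : c != 0.
  apply/eqP => c0; apply: J1; rewrite c0 mpolyC0 mul0r sub0r in Jc.
  by rewrite -[1]opprK -mulN1r; apply: JM.
pose x (i : 'I_3) := d i / c.
have Jx i : J ('X_i - (x i)%:MP).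
  have -> : 'X_i - (x i)%:MP = (mX K i - (d i)%:MP * w) + (x i)%:MP * (c%:MP * w - 1).
    rewrite mulrBr mulr1 mulrA -mpolyCM /x divfK // /mX inord_val; ring.
  by apply: JD; [apply: Jd|apply: JM].
exists x => p Jp; apply/eqP/negPn/negP => px; apply: J1.
apply: (ideal_unscale iJ px); rewrite mulr1.
have [e [Ep _]] := taylor1 p x.
have -> : (p.@[x])%:MP = p - \sum_j e j * ('X_j - (x j)%:MP) by rewrite {2}Ep; ring.
by apply: ideal_sub => //; elim/big_ind: _ => // j _; apply: JM.
Qed.

(** The minors supply products of linear forms lying in J. Choosing at each stage a factor whose
    adjunction leaves the ideal proper determines the coordinates up to a common multiple, as
    [ideal_point] requires. *)
Lemma slice_null l J : ideal J -> ~ J 1 -> (forall p, p \in slice_gens l -> J p) ->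
  exists x : 'I_3 -> K, forall p, J p -> p.@[x] = 0.
Proof.
move=> iJ J1 Jg.
have JL : J (dot (fun i => (l i)%:MP) (mX K) - 1) by apply: Jg; rewrite inE eqxx.
have Jm k (k3 : (k < 3)%N) := Jg _ (mem_slice_gens_minor l k3).
have [rs [_ _ H3]] := line_cubic_prod.
have [rx Hx] := conic_prod_xz; have [ry Hy] := conic_prod_yz.
have [a3 _ _ _] := good_slice_neq0.
have Jcomb (J' : {mpoly K[3]} -> Prop) s t : ideal J' -> (forall p, J p -> J' p) ->
    J' (s * minor (fun i => (a i)%:MP) (mX K) 0%N + t * minor (fun i => (a i)%:MP) (mX K) 1%N).
  by case=> _ JD JM sub; apply: JD; apply: JM; apply: sub; apply: Jm.
have sf : slice (fun i => (a i)%:MP_[3]).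
  by case: a_good => -[a2 a4 a7] _; split; rewrite ?a2 ?a4 ?a7 mpolyC0.
have [_ _ Em2] := minor_slice (mX K) sf.
have Jcub J' : ideal J' -> (forall p, J p -> J' p) -> J' (mX K 2) ->
    J' (\prod_(x <- rs) (mX K 1 - x%:MP * mX K 0)).
  move=> iJ' sub J2; apply: (@ideal_unscale _ _ _ (- a 3%N)) => //; first by rewrite oppr_eq0.
  have [_ JD JM] := iJ'.
  rewrite mpolyCN -(H3 _ (@mpolyC 3 K) (mX K)).
  set A2 := (X in J' X).
  have -> : A2 = minor (fun i => (a i)%:MP) (mX K) 2%N
      - mX K 2 * ((a 8%N)%:MP * mX K 0 - (a 5%N)%:MP * mX K 1) * mX K 2.
    by rewrite Em2 /A2; ring.
  by apply: ideal_sub => //; [apply: sub; apply: Jm|apply: JM].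
have sub_point J' : (forall p, J p -> J' p) -> (exists x : 'I_3 -> K, forall p, J' p -> p.@[x] = 0) ->
    exists x : 'I_3 -> K, forall p, J p -> p.@[x] = 0.
  by move=> sub [x Hp]; exists x => p /sub/Hp.
have [s [t E]] := Hx _ (@mpolyC 3 K) (mX K).
have : J (\prod_(p <- mX K 2 :: [seq mX K 0 - x%:MP * mX K 2 | x <- rx]) p).
  by rewrite big_cons big_map E; apply: Jcomb.
move=> /(proper_factor iJ J1) [p1]; rewrite inE => /orP [/eqP ->|/mapP [x _ ->]] J1'.
  have iJ1 := ideal_adjoin (mX K 2) iJ; have s1 := @adjoin_sub _ _ J (mX K 2).
  have J12 := adjoin_gen (mX K 2) iJ.
  have := Jcub _ iJ1 s1 J12.
  rewrite -(big_map (fun x => mX K 1 - x%:MP * mX K 0) xpredT id).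
  move=> /(proper_factor iJ1 J1') [p2 /mapP [y _ ->]] J2'.
  set J2 := adjoin _ _ in J2'.
  have iJ2 : ideal J2 by apply: ideal_adjoin.
  have s2 p : J p -> J2 p by move=> Jp; apply/adjoin_sub/s1.
  apply: (sub_point J2) => //; apply: (@ideal_point l J2 (vec3 1 y 0) (mX K 0)) => //.
    exact: s2.
  case=> [|[|[|i]]] // _ /=.
  - by rewrite mpolyC1 mul1r subrr; case: iJ2.
  - by apply: adjoin_gen.
  - by rewrite mpolyC0 mul0r subr0; apply: adjoin_sub.
set J1x := adjoin _ _ in J1'.
have iJ1 : ideal J1x by apply: ideal_adjoin.
have s1 p : J p -> J1x p by apply: adjoin_sub.
have J1x0 : J1x (mX K 0 - x%:MP * mX K 2) by apply: adjoin_gen.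
have [s' [t' E']] := Hy _ (@mpolyC 3 K) (mX K).
have : J1x (\prod_(p <- mX K 2 :: [seq mX K 1 - y%:MP * mX K 2 | y <- ry]) p).
  by rewrite big_cons big_map E'; apply: Jcomb.
move=> /(proper_factor iJ1 J1') [p2]; rewrite inE => /orP [/eqP ->|/mapP [y _ ->]] J2'.
  set J2 := adjoin _ _ in J2'; have iJ2 : ideal J2 by apply: ideal_adjoin.
  have s2 p : J p -> J2 p by move=> Jp; apply/adjoin_sub/s1.
  have J22 : J2 (mX K 2) by apply: adjoin_gen.
  have J20 : J2 (mX K 0).
    have [_ JD JM] := iJ2; rewrite -[mX K 0](subrK (x%:MP * mX K 2)).
    by apply: JD; [apply: adjoin_sub|apply: JM].
  have := Jcub _ iJ2 s2 J22; rewrite -(big_map (fun x => mX K 1 - x%:MP * mX K 0) xpredT id).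
  move=> /(proper_factor iJ2 J2') [p3 /mapP [y _ ->]] J3'.
  set J3 := adjoin _ _ in J3'; have iJ3 : ideal J3 by apply: ideal_adjoin.
  apply: (sub_point J3); first by move=> p Jp; apply/adjoin_sub/s2.
  (* In this branch all three coordinates lie in the ideal, which l = 1 forbids; taking d = 0 leaves
     the contradiction to the lemma. *)
  apply: (@ideal_point l J3 (fun=> 0) 0) => //; first by apply/adjoin_sub/s2.
  have J30 : J3 (mX K 0) by apply: adjoin_sub.
  case=> [|[|[|i]]] // _; rewrite mulr0 subr0 //.
    have [_ JD JM] := iJ3; rewrite -[mX K 1](subrK (y%:MP * mX K 0)).
    by apply: JD; [apply: adjoin_gen|apply: JM].
  by apply: adjoin_sub.
set J2 := adjoin _ _ in J2'; have iJ2 : ideal J2 by apply: ideal_adjoin.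
have s2 p : J p -> J2 p by move=> Jp; apply/adjoin_sub/s1.
apply: (sub_point J2) => //; apply: (@ideal_point l J2 (vec3 x y 1) (mX K 2)) => //.
  exact: s2.
case=> [|[|[|i]]] // _ /=.
- by apply: adjoin_sub.
- by apply: adjoin_gen.
- by rewrite mpolyC1 mul1r subrr; case: iJ2.
Qed.

End GoodSliceGeometry.

Section DirectionalDerivative.
Variables (K : fieldType) (x w : 'I_3 -> K).
Implicit Types (p q : {mpoly K[3]}).

Definition dder p : K := \sum_j p^`M(j).@[x] * w j.

Lemma dderD p q : dder (p + q) = dder p + dder q.
Proof. by rewrite -big_split; apply: eq_bigr => j _; rewrite mderivD mevalD mulrDl. Qed.

Lemma dderN p : dder (- p) = - dder p.
Proof. by rewrite -sumrN; apply: eq_bigr => j _; rewrite mderivN mevalN mulNr. Qed.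

Lemma dderC c : dder c%:MP = 0.
Proof. by rewrite /dder big1 // => j _; rewrite mderivC meval0 mul0r. Qed.

Lemma dderM p q : dder (p * q) = dder p * q.@[x] + p.@[x] * dder q.
Proof.
rewrite /dder mulr_suml mulr_sumr -big_split; apply: eq_bigr => j _.
by rewrite mderivM mevalD !mevalM /=; ring.
Qed.

Lemma dderX i : (i < 3)%N -> dder (mX K i) = w (inord i).
Proof.
move=> i3; rewrite /dder (bigD1 (inord i)) //= mderiv_mX // inordK // eqxx meval1 mul1r.
rewrite big1 ?addr0 // => j ji; rewrite mderiv_mX //.
have /negPf -> : i != j by apply: contraNneq ji => ->; rewrite inord_val.
by rewrite meval0 mul0r.
Qed.

Lemma meval_mX i : (mX K i).@[x] = x (inord i).
Proof. exact: mevalXU. Qed.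

Local Notation u := (fun i => x (inord i)).
Local Notation v := (fun i => w (inord i)).

Lemma dder_dot (l : nat -> K) : dder (dot (fun i => (l i)%:MP) (mX K) - 1) = dot l v.
Proof.
rewrite -mpolyC1 /dot !(dderD, dderN, dderM, dderC) !mevalC !dderX //=.
by ring.
Qed.

Lemma dder_conic_ev (q : nat -> K) : dder (conic_ev (fun i => (q i)%:MP) (mX K)) = dot (conic_grad q u) v.
Proof.
rewrite /conic_ev !expr2 /= !(dderD, dderM, dderC) !mevalM !mevalC !meval_mX !dderX //=.
by rewrite /dot /=; ring.
Qed.

Lemma meval_conic_ev (q : nat -> K) : (conic_ev (fun i => (q i)%:MP) (mX K)).@[x] = conic_ev q u.
Proof. by rewrite /conic_ev /= !(mevalD, mevalM, mevalC, rmorphXn) /= !meval_mX. Qed.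

End DirectionalDerivative.

(** * Transversality at the eigenpoints *)

Section Transversality.
Variables (K : numClosedFieldType) (a : nat -> K).
Hypothesis a_good : good_slice a.

(** Homogeneous equations always admit the radial direction u as a tangent; the chart equation l = 1
    removes it. *)
Lemma parallel_tangent (l u v : nat -> K) : dot l u = 1 -> dot l v = 0 ->
  (forall i j, (i < 3)%N -> (j < 3)%N -> v i * u j = v j * u i) ->
  forall i, (i < 3)%N -> v i = 0.
Proof.
move=> lu lv H i i3; rewrite -[LHS]mulr1 -lu.
transitivity (dot l v * u i); last by rewrite lv mul0r.
have [[H0 H1] H2] := (H i 0%N i3 isT, H i 1%N i3 isT, H i 2%N i3 isT).
rewrite /dot; transitivity (l 0%N * (v i * u 0%N) + l 1%N * (v i * u 1%N) + l 2%N * (v i * u 2%N)).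
  by ring.
by rewrite H0 H1 H2; ring.
Qed.

Lemma parallel_or_cross (u v : nat -> K) :
  (forall i j, (i < 3)%N -> (j < 3)%N -> v i * u j = v j * u i) \/
  exists2 k, (k < 3)%N & cross u v k != 0.
Proof.
have [c0|] := boolP [forall k : 'I_3, cross u v k == 0]; last first.
  by rewrite negb_forall => /existsP [k ck]; right; exists k.
have c k (k3 : (k < 3)%N) : cross u v k = 0 by apply/eqP: (forallP c0 (Ordinal k3)).
have /eqP := c 0%N isT; have /eqP := c 1%N isT; have /eqP := c 2%N isT.
rewrite /cross /= !subr_eq0 => /eqP E2 /eqP E1 /eqP E0; left=> i j i3 j3.
by case: i i3 => [|[|[|i]]] // _; case: j j3 => [|[|[|j]]] // _;
  rewrite ![v _ * _]mulrC // ?E0 ?E1 ?E2.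
Qed.

(** By Euler's relation both gradients are orthogonal to u, and by assumption to v. If v were not
    parallel to u, the gradients would be proportional, the conics tangent, and [pencil_disc]
    zero. *)
Lemma tangent_off_line (l u v : nat -> K) : dot l u = 1 -> dot l v = 0 -> u 2%N != 0 ->
  conic_ev (conic1 a) u = 0 -> conic_ev (conic2 a) u = 0 ->
  dot (conic_grad (conic1 a) u) v = 0 -> dot (conic_grad (conic2 a) u) v = 0 ->
  forall i, (i < 3)%N -> v i = 0.
Proof.
move=> lu lv u2 c1 c2 d1 d2; apply: (parallel_tangent lu lv).
have [//|[k k3 ck]] := parallel_or_cross u v.
have [_ pd _ _] := good_slice_neq0 a_good; case/negP: pd; apply/eqP.
set g1 := conic_grad (conic1 a) u in d1; set g2 := conic_grad (conic2 a) u in d2.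
have dC (x y : nat -> K) : dot x y = dot y x by rewrite /dot; ring.
have e1 : dot u g1 = 0 by rewrite dC conic_euler c1 mul0rn.
have e2 : dot u g2 = 0 by rewrite dC conic_euler c2 mul0rn.
rewrite dC in d1; rewrite dC in d2.
have P := cross_proportional k3 ck e1 d1 e2 d2.
have [g0|] := boolP [forall k : 'I_3, g1 k == 0].
  apply: (@pencil_disc_tangent _ _ _ u 1 0) => //; first by rewrite xpair_eqE oner_eq0.
  by move=> i i3; rewrite mul0r mul1r addr0; apply/eqP: (forallP g0 (Ordinal i3)).
rewrite negb_forall => /existsP [m gm].
apply: (@pencil_disc_tangent _ _ _ u (g2 m) (- g1 m)) => //.
  by rewrite xpair_eqE oppr_eq0 (negPf gm) andbF.
by move=> i i3; rewrite -/g1 -/g2 mulNr mulrC (P i m) // subrr.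
Qed.

(** On z = 0 the derivative of z N_i is v_2 N_i(u), and [line_res] does not let both N_i vanish at
    u, so v lies in z = 0. There a v not parallel to u would make u a double root of the line
    cubic. *)
Lemma tangent_on_line (l u v : nat -> K) : dot l u = 1 -> dot l v = 0 -> u 2%N = 0 ->
  v 2%N * conic_ev (conic1 a) u = 0 -> v 2%N * conic_ev (conic2 a) u = 0 ->
  let b := line_cubic a in
  b 0%N * u 0%N ^+ 3 + b 1%N * (u 0%N ^+ 2 * u 1%N) + b 2%N * (u 0%N * u 1%N ^+ 2)
    + b 3%N * u 1%N ^+ 3 = 0 ->
  (b 0%N * u 0%N ^+ 2 *+ 3 + b 1%N * (u 0%N * u 1%N) *+ 2 + b 2%N * u 1%N ^+ 2) * v 0%N
  + (b 1%N * u 0%N ^+ 2 + b 2%N * (u 0%N * u 1%N) *+ 2 + b 3%N * u 1%N ^+ 2 *+ 3) * v 1%N = 0 ->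
  forall i, (i < 3)%N -> v i = 0.
Proof.
move=> lu lv u2 c1 c2 b cu dv; have [_ _ ld lr] := good_slice_neq0 a_good.
have u01 : (u 0%N, u 1%N) != (0, 0).
  apply/eqP => -[u0 u1]; move: lu; rewrite /dot u0 u1 u2 !mulr0 !addr0 => /esym/eqP.
  by rewrite oner_eq0.
have v2 : v 2%N = 0.
  apply/eqP/negPn/negP => v2; case/negP: lr; apply/eqP; apply: (quad_res_eq0 u01).
    by apply: (mulfI v2); rewrite mulr0 -[RHS]c1 /conic_ev u2; ring.
  by apply: (mulfI v2); rewrite mulr0 -[RHS]c2 /conic_ev u2; ring.
apply: (parallel_tangent lu lv).
suff E : v 0%N * u 1%N = v 1%N * u 0%N.
  by move=> i j i3 j3; case: i i3 => [|[|[|i]]] // _; case: j j3 => [|[|[|j]]] // _;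
    rewrite ?u2 ?v2 ?mulr0 ?mul0r.
apply/eqP; rewrite -subr_eq0; apply/negPn/negP => ne; case/negP: ld; apply/eqP.
move: dv; set P := (X in X * v 0%N); set Q := (X in _ + X * v 1%N) => dv.
have eu : P * u 0%N + Q * u 1%N = 0 by rewrite -[RHS](mul0rn _ 3) -cu /P /Q; ring.
apply: (cubic_disc_eq0 u01); rewrite -/b -?/P -?/Q; apply: (mulIf ne); rewrite mul0r.
  transitivity (u 1%N * (P * v 0%N + Q * v 1%N) - v 1%N * (P * u 0%N + Q * u 1%N)).
    by ring.
  by rewrite dv eu !mulr0 subr0.
transitivity (v 0%N * (P * u 0%N + Q * u 1%N) - u 0%N * (P * v 0%N + Q * v 1%N)).
  by ring.
by rewrite dv eu !mulr0 subr0.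
Qed.

Lemma slice_transversal (l : nat -> K) (x w : 'I_3 -> K) :
  (forall p, p \in slice_gens a l -> p.@[x] = 0) ->
  (forall p, p \in slice_gens a l -> \sum_j p^`M(j).@[x] * w j = 0) -> forall j, w j = 0.
Proof.
move=> Hx Hw; pose u (i : nat) := x (inord i); pose v (i : nat) := w (inord i).
suff H i : (i < 3)%N -> v i = 0 by move=> j; have := H j (ltn_ord j); rewrite /v inord_val.
have [xM wM] : (forall k, (k < 3)%N -> (minor (fun i => (a i)%:MP) (mX K) k).@[x] = 0) /\
    (forall k, (k < 3)%N -> dder x w (minor (fun i => (a i)%:MP) (mX K) k) = 0).
  by split=> k k3; [apply: Hx|apply: Hw]; apply: mem_slice_gens_minor.
have lv : dot l v = 0 by rewrite -(dder_dot x); apply: Hw; rewrite mem_head.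
have lu : dot l u = 1.
  apply/eqP; rewrite -subr_eq0 -[X in _ == X](Hx _ (mem_head _ _)) /dot.
  by rewrite mevalB !mevalD !mevalM !mevalC ?meval1 !meval_mX.
have sf : slice (fun i => (a i)%:MP_[3]).
  by case: a_good => -[a2 a4 a7] _; split; rewrite ?a2 ?a4 ?a7 mpolyC0.
have [E0 E1 E2] := minor_slice (mX K) sf.
have F1 : conic1 (fun i => (a i)%:MP_[3]) = (fun i => (conic1 a i)%:MP).
  by apply/funext => k; rewrite (rmorph_conic1 (@mpolyC 3 K)).
have F2 : conic2 (fun i => (a i)%:MP_[3]) = (fun i => (conic2 a i)%:MP).
  by apply/funext => k; rewrite (rmorph_conic2 (@mpolyC 3 K)).
have F3 : line_cubic (fun i => (a i)%:MP_[3]) = (fun i => (line_cubic a i)%:MP).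
  by apply/funext => k; rewrite (rmorph_line_cubic (@mpolyC 3 K)).
have x0 : u 2%N * conic_ev (conic1 a) u = 0.
  by have := xM 0%N isT; rewrite E0 F1 mevalM meval_mX meval_conic_ev.
have x1 : u 2%N * conic_ev (conic2 a) u = 0.
  by have := xM 1%N isT; rewrite E1 F2 mevalM meval_mX meval_conic_ev.
have w0 : v 2%N * conic_ev (conic1 a) u + u 2%N * dot (conic_grad (conic1 a) u) v = 0.
  by have := wM 0%N isT; rewrite E0 F1 dderM dderX // dder_conic_ev meval_mX meval_conic_ev.
have w1 : v 2%N * conic_ev (conic2 a) u + u 2%N * dot (conic_grad (conic2 a) u) v = 0.
  by have := wM 1%N isT; rewrite E1 F2 dderM dderX // dder_conic_ev meval_mX meval_conic_ev.
have := xM 2%N isT; rewrite E2 F3; have := wM 2%N isT; rewrite E2 F3.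
rewrite !exprS !expr0 !mulr1 !(dderD, dderN, dderM, dderC) !(mevalD, mevalB, mevalN, mevalM).
rewrite !mevalC !meval_mX !dderX // -/(u 0%N) -/(u 1%N) -/(u 2%N) -/(v 0%N) -/(v 1%N) -/(v 2%N).
have [u2|u2] := eqVneq (u 2%N) 0; last first.
  move=> _ _; move/eqP: x0; rewrite mulf_eq0 (negPf u2) => /eqP x0.
  move/eqP: x1; rewrite mulf_eq0 (negPf u2) => /eqP x1.
  move: w0 w1; rewrite x0 x1 !mulr0 !add0r => /eqP + /eqP; rewrite !mulf_eq0 !(negPf u2) => /eqP w0 /eqP w1.
  exact: (tangent_off_line lu lv).
move: w0 w1; rewrite u2 !mul0r !addr0 => w0 w1 W2 X2.
apply: (tangent_on_line lu lv u2 w0 w1).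
  by rewrite -[RHS]X2; ring.
by rewrite -[RHS]W2; ring.
Qed.

Lemma slice_radical (l : nat -> K) h m :
  gen_ideal (slice_gens a l) (h ^+ m) -> gen_ideal (slice_gens a l) h.
Proof. by apply: radical_criterion; [exact: slice_null|move=> x Hx w; exact: slice_transversal]. Qed.

End Transversality.

(** * Transport along similitudes *)

Section MinorTransport.
Variable A : comNzRingType.
Implicit Types (a b u v x y : nat -> A) (M : nat -> nat -> A).

Lemma eq_minor a b u v k : (forall i, (i < 10)%N -> a i = b i) ->
  (forall i, (i < 3)%N -> u i = v i) -> minor a u k = minor b v k.
Proof.
move=> Ea Eu; case: k => [|[|k]];
  by rewrite /minor /grad /= !Eu // !Ea.
Qed.

Lemma minorZ a (c : A) u k : minor a (fun i => c * u i) k = c ^+ 3 * minor a u k.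
Proof. by case: k => [|[|k]]; rewrite /minor /grad /=; ring. Qed.

Lemma mulv_mulm M N u i : mulv M (mulv N u) i = mulv (mulm M N) u i.
Proof. by rewrite /mulv /mulm /mulv; ring. Qed.

Lemma mulv_scale M c u i : mulv M (fun j => c * u j) i = c * mulv M u i.
Proof. by rewrite /mulv; ring. Qed.

Lemma eq_mulv M u v i : (forall j, (j < 3)%N -> u j = v j) -> mulv M u i = mulv M v i.
Proof. by move=> E; rewrite /mulv !E. Qed.

Variable J : A -> Prop.
Hypotheses (J0 : J 0) (JD : forall p q, J p -> J q -> J (p + q)) (JM : forall c p, J p -> J (c * p)).

Lemma minor_pairs a u : (forall k, (k < 3)%N -> J (minor a u k)) <->
  (forall i j, (i < 3)%N -> (j < 3)%N -> J (u i * grad a u j - u j * grad a u i)).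
Proof.
have JN p : J p -> J (- p) by rewrite -mulN1r; apply: JM.
split=> H.
  have [[H0 H1] H2] := (H 0%N isT, H 1%N isT, H 2%N isT).
  by case=> [|[|[|i]]] // [|[|[|j]]] // _ _; rewrite ?subrr // -opprB; apply: JN.
by case=> [|[|[|k]]] // _; [apply: (H 1%N 2%N)|apply: (H 0%N 2%N)|apply: (H 0%N 1%N)].
Qed.

(** The matrix acts on 2 x 2 minors through its second exterior power. *)
Lemma pairs_mulv M x y :
  (forall i j, (i < 3)%N -> (j < 3)%N -> J (x i * y j - x j * y i)) ->
  forall i j, J (mulv M x i * mulv M y j - mulv M x j * mulv M y i).
Proof.
move=> H i j.
have -> : mulv M x i * mulv M y j - mulv M x j * mulv M y i =
    (M i 0%N * M j 1%N - M i 1%N * M j 0%N) * (x 0%N * y 1%N - x 1%N * y 0%N)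
  + (M i 0%N * M j 2%N - M i 2%N * M j 0%N) * (x 0%N * y 2%N - x 2%N * y 0%N)
  + (M i 1%N * M j 2%N - M i 2%N * M j 1%N) * (x 1%N * y 2%N - x 2%N * y 1%N).
  by rewrite /mulv; ring.
by do 2?[apply: (JD)]; apply: JM; apply: H.
Qed.

End MinorTransport.

Section SimilitudeTransport.
Variables (K : numClosedFieldType) (s : K) (g : nat -> nat -> K).
Hypothesis sg : similitude s g.
Local Notation h := (similitude_inv s g).

Variables (A : comNzRingType) (f : {rmorphism K -> A}).
Local Notation G := (fun i j => f (g i j)).
Local Notation H := (fun i j => f (h i j)).

Lemma mulv_id (M N : nat -> nat -> K) u i :
  (forall i j, (i < 3)%N -> (j < 3)%N -> mulm M N i j = (i == j)%:R) -> (i < 3)%N ->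
  mulv (fun i j => f (M i j)) (mulv (fun i j => f (N i j)) u) i = u i.
Proof.
move=> E i3; rewrite mulv_mulm.
have E' j : (j < 3)%N -> mulm (fun i j => f (M i j)) (fun i j => f (N i j)) i j = (i == j)%:R.
  by move=> j3; rewrite -(rmorph_nat f) -E // /mulm /mulv !(rmorphD, rmorphM).
by rewrite /mulv !E' //; case: i i3 {E'} => [|[|[|i]]] // _ /=; ring.
Qed.

Lemma mulvK u i : (i < 3)%N -> mulv H (mulv G u) i = u i.
Proof. exact: (mulv_id _ (mulm_inv_similitude sg)). Qed.

Lemma mulvVK u i : (i < 3)%N -> mulv G (mulv H u) i = u i.
Proof. exact: (mulv_id _ (mulm_similitude_inv sg)). Qed.

Lemma grad_act_inv a u i : (i < 3)%N ->
  grad (act G a) u i = f s * mulv H (grad a (mulv G u)) i.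
Proof.
move=> i3; have fs j k : f s * H j k = G k j.
  by rewrite -rmorphM /similitude_inv mulrA mulfV ?mul1r //; case: sg.
transitivity (dot (grad (act G a) u) (fun j => (i == j)%:R)).
  by case: i i3 => [|[|[|i]]] // _; rewrite /dot /=; ring.
rewrite grad_act; move: (grad a _) => y; rewrite /mulv !mulrDr !mulrA !fs /dot.
by case: i i3 => [|[|[|i]]] // _ /=; ring.
Qed.

Variable J : A -> Prop.
Hypotheses (J0 : J 0) (JD : forall p q, J p -> J q -> J (p + q)) (JM : forall c p, J p -> J (c * p)).

(** The transpose of g is s times its inverse, so the gradient of the transformed cubic is, up to s,
    the inverse image of the gradient, just as u is the inverse image of g u. The predicate [J] is
    taken to be an ideal of polynomials for reducedness, and equality with zero for points. *)
Lemma minor_act a u : (forall k, (k < 3)%N -> J (minor a (mulv G u) k)) <->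
  (forall k, (k < 3)%N -> J (minor (act G a) u k)).
Proof.
rewrite !minor_pairs //; split=> Hp i j i3 j3.
  rewrite -(mulvK u i3) -(mulvK u j3) !grad_act_inv //.
  rewrite mulrCA [X in _ - X]mulrCA -mulrBr; apply: JM.
  exact: (pairs_mulv JD JM).
have fsV : f s^-1 * f s = 1 by rewrite -rmorphM mulVf ?rmorph1 //; case: sg.
have E k : (k < 3)%N -> grad a (mulv G u) k = f s^-1 * mulv G (grad (act G a) u) k.
  move=> k3; rewrite (eq_mulv _ _ (grad_act_inv a u)) mulv_scale mulvVK // mulrA fsV.
  by rewrite mul1r.
rewrite !E // mulrCA [X in _ - X]mulrCA -mulrBr; apply: JM.
exact: (pairs_mulv JD JM).
Qed.

End SimilitudeTransport.

Lemma radical_transport n (K : fieldType) (gs gs' : seq {mpoly K[n]})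
    (phi psi : {rmorphism {mpoly K[n]} -> {mpoly K[n]}}) :
  cancel psi phi ->
  (forall p, p \in gs' -> gen_ideal gs (phi p)) -> (forall p, p \in gs -> gen_ideal gs' (psi p)) ->
  (forall h m, gen_ideal gs' (h ^+ m) -> gen_ideal gs' h) ->
  forall h m, gen_ideal gs (h ^+ m) -> gen_ideal gs h.
Proof.
move=> psiK Hphi Hpsi rad h m Hh.
have pull (hs hs' : seq {mpoly K[n]}) (f : {rmorphism {mpoly K[n]} -> {mpoly K[n]}}) :
    (forall p, p \in hs -> gen_ideal hs' (f p)) -> forall p, gen_ideal hs p -> gen_ideal hs' (f p).
  move=> Hf; apply: gen_ideal_min => //; have [J0 JD JM] := ideal_gen hs'; split.
  - by rewrite rmorph0.
  - by move=> p q Hp Hq; rewrite rmorphD; apply: JD.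
  - by move=> c p Hp; rewrite rmorphM; apply: JM.
rewrite -[h]psiK; apply: (pull _ _ phi Hphi); apply: (rad _ m).
by rewrite -rmorphXn; apply: (pull _ _ psi Hpsi).
Qed.

(** * Regularity and aligned triple of a good cubic *)

Section GoodCubicGeometry.
Variables (K : numClosedFieldType) (s : K) (g : nat -> nat -> K) (a : nat -> K).
Hypotheses (sg : similitude s g) (a_good : good_slice a).
Variable v : 'rV[K]_10.
Hypothesis v_act : forall k, (k < 10)%N -> rcoefs v k = act g a k.
Local Notation h := (similitude_inv s g).
Local Notation C := (@mpolyC 3 K).

Definition linear_sub (m : nat -> nat -> K) : {mpoly K[3]} -> {mpoly K[3]} :=
  mmap C (fun j : 'I_3 => mulv (fun i j => C (m i j)) (mX K) j).

HB.instance Definition _ m := GRing.RMorphism.on (linear_sub m).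

Lemma linear_subC m c : linear_sub m c%:MP = c%:MP.
Proof. by rewrite /linear_sub mmapC. Qed.

Lemma linear_subX m i : (i < 3)%N -> linear_sub m (mX K i) = mulv (fun i j => C (m i j)) (mX K) i.
Proof. by move=> i3; rewrite /linear_sub mmapX mmap1U inordK. Qed.

Lemma linear_sub_mulv m (M : nat -> nat -> K) i :
  linear_sub m (mulv (fun i j => C (M i j)) (mX K) i) =
  mulv (fun i j => C (M i j)) (mulv (fun i j => C (m i j)) (mX K)) i.
Proof. by rewrite {1}/mulv !rmorphD !rmorphM /= !linear_subC !linear_subX. Qed.

Lemma linear_subK : cancel (linear_sub h) (linear_sub g).
Proof.
elim/mpoly_alg_ind => [c|i|p q Hp Hq|p q Hp Hq].
- by rewrite !linear_subC.
- have -> : 'X_i = mX K i by rewrite /mX inord_val.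
  by rewrite linear_subX // linear_sub_mulv (mulvK sg).
- by rewrite !rmorphD /= Hp Hq.
- by rewrite !rmorphM /= Hp Hq.
Qed.

Lemma linear_sub_minor m (c : nat -> K) k :
  linear_sub m (minor (fun i => (c i)%:MP) (mX K) k) =
  minor (fun i => (c i)%:MP) (mulv (fun i j => C (m i j)) (mX K)) k.
Proof.
rewrite (rmorph_minor (linear_sub m)); apply: eq_minor => i i3 /=.
  by rewrite linear_subC.
by rewrite linear_subX.
Qed.

Lemma good_eigen_minor (k : 'I_3) : eigen_minor (cubic v) k =
  minor (act (fun i j => C (g i j)) (fun i => (a i)%:MP)) (mX K) k.
Proof.
rewrite eigen_minorE; apply: eq_minor => // i i10.
by rewrite v_act // (rmorph_act C).
Qed.

Lemma good_reduced : eigenscheme_reduced (cubic v).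
Proof.
(* Row [i0] of the inverse expresses the coordinate [i0] in terms of the coordinates on the
   slice. *)
move=> i0; pose l j := h i0 j.
set gs := _ :: _; suff : forall p m, gen_ideal gs (p ^+ m) -> gen_ideal gs p by [].
have X0 : 'X_i0 = mX K i0 by rewrite /mX inord_val.
apply: (@radical_transport _ _ gs (slice_gens a l) (linear_sub g) (linear_sub h)).
- exact: linear_subK.
- have [J0 JD JM] := ideal_gen gs.
  move=> p; rewrite inE => /orP [/eqP ->|/mapP [k]].
    rewrite rmorphB rmorph1 [dot _ _]/(mulv (fun i j => C (h i j)) (mX K) i0) /=.
    by rewrite linear_sub_mulv (mulvK sg) // -X0; apply/mem_gen_ideal/mem_head.
  rewrite mem_iota => k3 ->; rewrite /= linear_sub_minor; move: k k3.
  apply/(minor_act sg C J0 JD JM) => k k3.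
  rewrite -(good_eigen_minor (Ordinal k3)); apply: mem_gen_ideal.
  by rewrite inE; apply/orP; right; apply: map_f; rewrite mem_enum.
- have [J0 JD JM] := ideal_gen (slice_gens a l).
  move=> p; rewrite inE => /orP [/eqP ->|/mapP [k _ ->]].
    rewrite rmorphB rmorph1 X0 /= linear_subX //; apply: mem_gen_ideal.
    exact: mem_head.
  rewrite /= eigen_minorE linear_sub_minor.
  rewrite (@eq_minor _ _ (act (fun i j => C (g i j)) (fun i => (a i)%:MP))
    _ (mulv (fun i j => C (h i j)) (mX K))) // => [|i i10]; last first.
    by rewrite v_act // (rmorph_act C).
  have [+ _] := minor_act sg C J0 JD JM (fun i => (a i)%:MP) (mulv (fun i j => C (h i j)) (mX K)).
  apply=> // {}k k3; rewrite (@eq_minor _ _ (fun i => (a i)%:MP) _ (mX K)) // => [|i i3].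
    by apply: mem_gen_ideal; apply: mem_slice_gens_minor.
  exact: (mulvVK sg C).
- exact: slice_radical.
Qed.

Definition point_of (d : nat -> K) : 'rV[K]_3 := \row_j mulv h d j.

Lemma rcoefs_point_of d i : (i < 3)%N -> rcoefs (point_of d) i = mulv h d i.
Proof. by move=> i3; rewrite /rcoefs mxE inordK. Qed.

Lemma good_eigenpointsP p : eigenpoints (cubic v) p <->
  p != 0 /\ forall k, (k < 3)%N -> minor a (mulv g (rcoefs p)) k = 0.
Proof.
rewrite eigenpointsP.
have E : (forall k, (k < 3)%N -> minor (rcoefs v) (rcoefs p) k = 0) <->
    forall k, (k < 3)%N -> minor (act g a) (rcoefs p) k = 0.
  by split=> H k k3; rewrite -[RHS](H k k3); apply: eq_minor => // i i10; rewrite v_act.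
rewrite E (@minor_act _ _ _ sg _ idfun (fun x => x = 0)) //.
  by move=> x y -> ->; rewrite addr0.
by move=> c x ->; rewrite mulr0.
Qed.

Lemma mulv_point_of d i : (i < 3)%N -> mulv g (rcoefs (point_of d)) i = d i.
Proof.
move=> i3; rewrite (eq_mulv _ _ (rcoefs_point_of d)).
exact: (mulvVK sg idfun d i3).
Qed.

(** On z = 0 two of the minors vanish identically and the third is the line cubic; its three
    distinct roots are carried back by the inverse similitude. *)
Lemma good_aligned_triple : has_aligned_triple (cubic v).
Proof.
have [rs [srs urs H]] := line_cubic_prod a_good.
have pt x : x \in rs -> eigenpoints (cubic v) (point_of (vec3 1 x 0)).
  move=> xrs; apply/good_eigenpointsP; split.
    apply/eqP => p0; have := mulv_point_of (vec3 1 x 0) (isT : 0 < 3)%N.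
    rewrite p0 /mulv /rcoefs !mxE !mulr0 !addr0 /= => /esym/eqP.
    by rewrite oner_eq0.
  move=> k k3; rewrite (@eq_minor _ a a _ (vec3 1 x 0)) //; last exact: mulv_point_of.
  have [E0 E1 E2] := minor_slice (vec3 1 x 0) a_good.1.
  case: k k3 => [|[|[|k]]] // _.
  - by rewrite E0 mul0r.
  - by rewrite E1 mul0r.
  - rewrite E2 /= expr0n mul0r addr0; have /= -> := H K idfun (vec3 1 x 0).
    apply/eqP; rewrite mulf_eq0 oppr_eq0 prodf_seq_eq0; apply/orP; right.
    by apply/hasP; exists x => //=; rewrite mulr1 subrr.
have dist x y : x != y -> ~ same_point (point_of (vec3 1 x 0)) (point_of (vec3 1 y 0)).
  move=> xy /eqmxP E; have : (point_of (vec3 1 x 0) <= point_of (vec3 1 y 0))%MS by rewrite E.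
  case/sub_rVP => c Ec; case/negP: xy; apply/eqP.
  have F i : (i < 3)%N -> vec3 1 x 0 i = c * vec3 1 y 0 i.
    move=> i3; rewrite -(mulv_point_of (vec3 1 x 0) i3) -(mulv_point_of (vec3 1 y 0) i3).
    by rewrite Ec -mulv_scale; apply: eq_mulv => j _; rewrite rcoefsZ.
  have := F 0%N isT; have := F 1%N isT; rewrite /= mulr1 => -> <-; by rewrite mul1r.
case: rs srs urs {H} pt => [|x [|y [|z []]]] //= _.
rewrite !inE negb_or andbT -andbA => /and3P [xy xz yz] pt.
exists (point_of (vec3 1 x 0)), (point_of (vec3 1 y 0)), (point_of (vec3 1 z 0)).
split; first by split; apply: pt; rewrite !inE eqxx ?orbT.
split; try exact: dist.
(* The last row of g is the equation of the preimage of z = 0. *)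
exists (\col_j g 2%N j).
have on (d : K) : point_of (vec3 1 d 0) *m (\col_j g 2%N j) = 0.
  apply/matrixP => i j; rewrite !ord1 [RHS]mxE -[RHS](mulv_point_of (vec3 1 d 0) (isT : 2 < 3)%N).
  rewrite mxE !big_ord_recl big_ord0 addr0 addrA /mulv ![g 2%N _ * _]mulrC.
  by rewrite !rcoefs_point_of // !mxE.
split=> //; apply/eqP => /matrixP l0.
have := mulm_similitude_inv sg (isT : 2 < 3)%N (isT : 2 < 3)%N.
have gz j : (j < 3)%N -> g 2%N j = 0.
  by move=> j3; have := l0 (Ordinal j3) 0; rewrite !mxE.
by rewrite /mulm /mulv !gz // !mul0r !addr0 => /esym/eqP; rewrite oner_eq0.
Qed.

Lemma good_finite : projective_dim (eigenpoints (cubic v)) 0.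
Proof.
have [D HD] := slice_eigen_list a_good.
pose D' := [seq p <- [seq point_of d | d <- D] | `[< eigenpoints (cubic v) p >]].
have XD p : eigenpoints (cubic v) p -> exists c q,
    [/\ q \in D', eigenpoints (cubic v) q & p = c *: q].
  move=> /[dup] Ep /good_eigenpointsP [p0 Hp].
  have [c [d [[i iD di] Hd]]] := HD _ Hp.
  have pE : p = c *: point_of d.
    apply: rV3P => j j3; rewrite rcoefsZ rcoefs_point_of // -mulv_scale.
    by rewrite -[LHS](mulvK sg idfun (rcoefs p) j3); apply: eq_mulv.
  have c0 : c != 0 by apply: contraNneq p0 => c0; rewrite pE c0 scale0r.
  have Eq : eigenpoints (cubic v) (point_of d).
    apply/good_eigenpointsP; split.
      by apply: contraNneq p0 => q0; rewrite pE q0 scaler0.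
    move=> k k3; apply: (mulfI (expf_neq0 3 c0)); rewrite mulr0 -minorZ -[RHS](Hp k k3).
    by apply: eq_minor => // j j3; rewrite mulv_point_of // Hd.
  exists c, (point_of d); split=> //; rewrite mem_filter; apply/andP; split; first by apply/asboolP.
  by rewrite di -(nth_map _ (point_of (fun=> 0))) // mem_nth // size_map.
apply: (@projective_dim0_finite _ _ _ D') => //.
- by move=> q; rewrite mem_filter => /andP [/asboolP].
- by move=> q [].
- have [p [_ [_ [[/XD [c [q [qD _ _]]] _ _] _]]]] := good_aligned_triple.
  by apply: contraTneq qD => ->.
Qed.

(** The inverse similitude would carry the zero cubic to [a], whose coefficient [a 3] is nonzero. *)
Lemma good_neq0 : v != 0.
Proof.
apply/eqP => v0; have [a3 _ _ _] := good_slice_neq0 a_good; case/negP: a3; apply/eqP.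
have := @act_mul _ g h a 3%N; rewrite (@act_scalar _ 1 (mulm g h)) // => [|i j i3 j3].
  rewrite expr1n mul1r => <-; rewrite (@eq_act _ _ _ (fun=> 0)) => [|i i10].
    by rewrite /act /dot /grad /=; ring.
  by rewrite -v_act // v0 /rcoefs mxE.
by rewrite mulm_similitude_inv // mul1r.
Qed.

Lemma good_aligned_regular : aligned_regular_cubics v.
Proof.
split; first exact: good_neq0.
  by split; [exact: good_reduced|exact: good_finite].
exact: good_aligned_triple.
Qed.

End GoodCubicGeometry.

(** * The vanishing ideal of the locus and its degree *)

Lemma good_cubic_regular (K : numClosedFieldType) (v : 'rV[K]_10) :
  good_cubic (v 0) -> aligned_regular_cubics v.
Proof.
move=> [s [g [a [sg ga Ev]]]]; apply: (good_aligned_regular sg ga) => k k10.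
by rewrite /rcoefs Ev inordK.
Qed.

Lemma aligned_locus_vanishing (K : fieldType) d (G : dhomog 10 K d) :
  (forall q, aligned_locus q -> (G : {mpoly K[10]}).@[q 0] = 0) <->
  (forall q, aligned_regular_cubics q -> (G : {mpoly K[10]}).@[q 0] = 0).
Proof.
split=> HG q; last by case=> _; apply.
by move=> Uq; apply: HG; split; [case: Uq|move=> e H; apply].
Qed.

(** The regular cubics with an aligned triple lie between the good cubics and the hypersurface of
    the determinant, and every equation of the good cubics is already a multiple of the
    determinant. *)
Lemma aligned_regular_ideal (K : numClosedFieldType) (G : {mpoly K[10]}) :
  (forall q : 'rV[K]_10, aligned_regular_cubics q -> G.@[q 0] = 0) <->
  exists H, G = H * resultant_poly K.
Proof.
have Hres (q : 'rV[K]_10) : aligned_regular_cubics q -> (resultant_poly K).@[q 0] = 0.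
  by case=> _ _ /aligned_apolar [n Hn]; apply: (resultant_poly_apolar Hn).
have good (P : {mpoly K[10]}) : (forall q : 'rV[K]_10, aligned_regular_cubics q -> P.@[q 0] = 0) ->
    forall v : 'I_10 -> K, good_cubic v -> P.@[v] = 0.
  move=> HP v gv; have E : (\row_k v k : 'rV[K]_10) 0 = v by apply/funext => k; rewrite mxE.
  by rewrite -E; apply: HP; apply: good_cubic_regular; rewrite E.
split=> [HG|[H ->] q /Hres E]; last by rewrite mevalM E mulr0.
by apply: good_ideal_principal; apply: good.
Qed.

Theorem theorem5p6 (R : realType) :
  projective_degree (@aligned_locus (complex R)) 15.
Proof.
apply: (@degree_hypersurface_15 _ _ (DHomog (resultant_poly_homog (complex R)))) => [|d G]; last first.
  by rewrite aligned_locus_vanishing aligned_regular_ideal.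
apply/eqP => /= F0; have := resultant_poly_pencil1 (complex R).
by rewrite F0 meval0 eqxx.
Qed.
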